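(* Let $\langle I,\in\rangle$ be a countable transitive structure with $\omega\in I$. The following are equivalent: (I) $\langle I,\in\rangle\models\mathrm{MOST}+\Delta_0^{\mathcal P}\text{-collection}$; (II) there is an $\mathcal L$-structure $\mathcal M\models\mathrm{MOST}$ and a non-trivial automorphism $j:\mathcal M\to\mathcal M$ such that $\mathcal I_{\mathrm{fix}}(j)=\langle I,\in\rangle$.
   Context: $\mathcal{L}$ is the language with one binary relation $\in$. $\mathrm{Mac}$: extensionality, pairing, emptyset, union, infinity, powerset, transitive containment ($\forall x\exists y(\bigcup y\subseteq y\wedge x\subseteq y)$), $\Delta_0$-separation, set foundation, and ''every set can be well-ordered''. $\mathrm{MOST}=\mathrm{Mac}+\Sigma_1$-separation$+\Delta_0$-collection. $\Delta_0^{\mathcal P}$-collection is the collection scheme $\forall\vec z\forall w((\forall x\in w)\exists y\phi\to\exists C(\forall x\in w)(\exists y\in C)\phi)$ restricted to formulae $\phi$ built from atomic formulae using connectives and bounded quantifiers $\exists x\in y,\forall x\in y,\exists x\subseteq y,\forall x\subseteq y$. For an automorphism $j$ of $\mathcal M$, $\mathcal I_{\mathrm{fix}}(j)$ is the substructure of $\mathcal M$ with domain $\{x\in M: j(y)=y\text{ for all }y\in M\text{ with }\mathcal M\models y\in\mathrm{TC}(\{x\})\}$, transitive closure computed in $\mathcal M$. Non-trivial means not the identity. *)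

(* Defs.v *)
(** * Structures for the language with one binary relation symbol *)

Record structure : Type := Structure {
  carrier :> Type;
  mem : carrier -> carrier -> Prop
}.
Arguments mem {_} _ _.

Declare Scope lset_scope.
Delimit Scope lset_scope with lset.
Notation "x ∈ y" := (mem x y) (at level 70) : lset_scope.
Notation "∀ x ∈ y , P" := (forall x, mem x y -> P)
  (at level 200, x name, y at level 69, right associativity) : lset_scope.
Notation "∃ x ∈ y , P" := (exists x, mem x y /\ P)
  (at level 200, x name, y at level 69, right associativity) : lset_scope.
Local Open Scope lset_scope.

Definition bijective {A B : Type} (f : A -> B) : Prop :=
  (forall x y, f x = f y -> x = y) /\ (forall z, exists x, f x = z).

Definition isomorphism {M N : structure} (f : M -> N) : Prop :=
  bijective f /\ forall x y : M, x ∈ y <-> f x ∈ f y.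

Definition automorphism {M : structure} (j : M -> M) : Prop := isomorphism j.

Definition isomorphic (M N : structure) : Prop :=
  exists f : M -> N, isomorphism f.

Definition substructure (M : structure) (P : M -> Prop) : structure :=
  Structure {x : M | P x} (fun x y => proj1_sig x ∈ proj1_sig y).

(** * First-order formulae *)

(* De Bruijn indices: under a quantifier, index 0 is the newly bound variable. *)
Inductive formula : Type :=
| fMem (i j : nat)
| fEq (i j : nat)
| fNot (p : formula)
| fAnd (p q : formula)
| fOr (p q : formula)
| fImp (p q : formula)
| fAll (p : formula)
| fEx (p : formula).

Definition scons {A : Type} (a : A) (rho : nat -> A) (n : nat) : A :=
  match n with 0 => a | S m => rho m end.

Fixpoint sat {M : structure} (rho : nat -> M) (p : formula) : Prop :=
  match p with
  | fMem i j => rho i ∈ rho j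
  | fEq i j => rho i = rho j
  | fNot p => ~ sat rho p
  | fAnd p q => sat rho p /\ sat rho q
  | fOr p q => sat rho p \/ sat rho q
  | fImp p q => sat rho p -> sat rho q
  | fAll p => forall a : M, sat (scons a rho) p
  | fEx p => exists a : M, sat (scons a rho) p
  end.

(* In [fAllIn y p] etc. the bounding variable [y] is an index outside the new
   quantifier, so it is automatically distinct from the quantified variable. *)
Definition fAllIn (y : nat) (p : formula) := fAll (fImp (fMem 0 (S y)) p).
Definition fExIn (y : nat) (p : formula) := fEx (fAnd (fMem 0 (S y)) p).
Definition fSub (i j : nat) := fAll (fImp (fMem 0 (S i)) (fMem 0 (S j))).
Definition fAllSub (y : nat) (p : formula) := fAll (fImp (fSub 0 (S y)) p).
Definition fExSub (y : nat) (p : formula) := fEx (fAnd (fSub 0 (S y)) p).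

Inductive Delta0 : formula -> Prop :=
| Delta0_mem i j : Delta0 (fMem i j)
| Delta0_eq i j : Delta0 (fEq i j)
| Delta0_not p : Delta0 p -> Delta0 (fNot p)
| Delta0_and p q : Delta0 p -> Delta0 q -> Delta0 (fAnd p q)
| Delta0_or p q : Delta0 p -> Delta0 q -> Delta0 (fOr p q)
| Delta0_imp p q : Delta0 p -> Delta0 q -> Delta0 (fImp p q)
| Delta0_all y p : Delta0 p -> Delta0 (fAllIn y p)
| Delta0_ex y p : Delta0 p -> Delta0 (fExIn y p).

Inductive Sigma1 : formula -> Prop :=
| Sigma1_Delta0 p : Delta0 p -> Sigma1 p
| Sigma1_ex p : Sigma1 p -> Sigma1 (fEx p).

Inductive Delta0P : formula -> Prop :=
| Delta0P_mem i j : Delta0P (fMem i j)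
| Delta0P_eq i j : Delta0P (fEq i j)
| Delta0P_not p : Delta0P p -> Delta0P (fNot p)
| Delta0P_and p q : Delta0P p -> Delta0P q -> Delta0P (fAnd p q)
| Delta0P_or p q : Delta0P p -> Delta0P q -> Delta0P (fOr p q)
| Delta0P_imp p q : Delta0P p -> Delta0P q -> Delta0P (fImp p q)
| Delta0P_all y p : Delta0P p -> Delta0P (fAllIn y p)
| Delta0P_ex y p : Delta0P p -> Delta0P (fExIn y p)
| Delta0P_allsub y p : Delta0P p -> Delta0P (fAllSub y p)
| Delta0P_exsub y p : Delta0P p -> Delta0P (fExSub y p).

(** * Theories *)

(* The single axioms are written as their satisfaction in [M]: all quantifiers
   range over the carrier of [M]. *)
Section Theories.
Variable M : structure.
Implicit Types x y z u v w p r s a b c : M.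

Definition subset x y : Prop := ∀ z ∈ x, z ∈ y.
Definition is_empty x : Prop := forall y, ~ y ∈ x.
Definition is_upair p a b : Prop := forall z, z ∈ p <-> z = a \/ z = b.
Definition is_singleton s a : Prop := is_upair s a a.
Definition is_opair p a b : Prop :=
  exists s u, is_singleton s a /\ is_upair u a b /\ is_upair p s u.
Definition is_succ y x : Prop := forall z, z ∈ y <-> z ∈ x \/ z = x.
Definition is_transitive y : Prop := ∀ u ∈ y, ∀ v ∈ u, v ∈ y.

Definition related r a b : Prop := ∃ p ∈ r, is_opair p a b.

Definition well_orders r x : Prop :=
  (∀ p ∈ r, ∃ a ∈ x, ∃ b ∈ x, is_opair p a b) /\
  (∀ a ∈ x, ~ related r a a) /\
  (∀ a ∈ x, ∀ b ∈ x, ∀ c ∈ x, related r a b -> related r b c -> related r a c) /\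
  (∀ a ∈ x, ∀ b ∈ x, related r a b \/ a = b \/ related r b a) /\
  (forall s, subset s x -> ~ is_empty s ->
     ∃ a ∈ s, ∀ b ∈ s, a = b \/ related r a b).

Definition extensionality : Prop :=
  forall x y, (forall z, z ∈ x <-> z ∈ y) -> x = y.
Definition pairing : Prop := forall a b, exists p, is_upair p a b.
Definition emptyset : Prop := exists x, is_empty x.
Definition union : Prop :=
  forall x, exists y, forall z, z ∈ y <-> ∃ w ∈ x, z ∈ w.
Definition infinity : Prop :=
  exists x, (∃ y ∈ x, is_empty y) /\ (∀ y ∈ x, ∃ z ∈ x, is_succ z y).
Definition powerset : Prop :=
  forall x, exists y, forall z, z ∈ y <-> subset z x.
Definition transitive_containment : Prop :=
  forall x, exists y, is_transitive y /\ subset x y.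
Definition set_foundation : Prop :=
  forall x, ~ is_empty x -> ∃ y ∈ x, ∀ z ∈ y, ~ z ∈ x.
Definition well_ordering : Prop := forall x, exists r, well_orders r x.

(* In both schemes the assignment [rho] supplies the parameters of [phi]; in
   [separation] variable 0 of [phi] is x, in [collection] variables 0 and 1 of
   [phi] are y and x. *)
Definition separation (Gamma : formula -> Prop) : Prop :=
  forall phi, Gamma phi -> forall (rho : nat -> M) w,
  exists y, forall x, x ∈ y <-> x ∈ w /\ sat (scons x rho) phi.

Definition collection (Gamma : formula -> Prop) : Prop :=
  forall phi, Gamma phi -> forall (rho : nat -> M) w,
  (∀ x ∈ w, exists y, sat (scons y (scons x rho)) phi) ->
  exists C : M, ∀ x ∈ w, ∃ y ∈ C, sat (scons y (scons x rho)) phi.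

Record Mac : Prop := {
  Mac_extensionality : extensionality;
  Mac_pairing : pairing;
  Mac_emptyset : emptyset;
  Mac_union : union;
  Mac_infinity : infinity;
  Mac_powerset : powerset;
  Mac_transitive_containment : transitive_containment;
  Mac_separation : separation Delta0;
  Mac_foundation : set_foundation;
  Mac_well_ordering : well_ordering
}.

Record MOST : Prop := {
  MOST_Mac : Mac;
  MOST_separation : separation Sigma1;
  MOST_collection : collection Delta0
}.

Definition is_TC c a : Prop :=
  is_transitive c /\ subset a c /\
  forall d : M, is_transitive d -> subset a d -> subset c d.

Definition in_TC_singleton y x : Prop :=
  exists s c, is_singleton s x /\ is_TC c s /\ y ∈ c.

End Theories.

Definition Ifix {M : structure} (j : M -> M) : structure :=
  substructure M (fun x => forall y : M, in_TC_singleton M y x -> j y = y).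

(** * The universe of sets *)

(* Well-founded sets are well-founded trees up to bisimilarity; a set is
   represented by its bisimilarity class, so that equality of sets is [=]. *)
Inductive tree : Type := node (A : Type) (f : A -> tree).

Fixpoint tree_eq (s t : tree) : Prop :=
  match s, t with
  | node A f, node B g =>
      (forall a, exists b, tree_eq (f a) (g b)) /\
      (forall b, exists a, tree_eq (f a) (g b))
  end.

Definition tree_mem (s t : tree) : Prop :=
  match t with node B g => exists b, tree_eq s (g b) end.

Definition zset : Type := {c : tree -> Prop | exists t, c = tree_eq t}.

Definition zset_of (t : tree) : zset :=
  exist _ (tree_eq t) (ex_intro _ t eq_refl).

Definition zmem (x y : zset) : Prop :=
  exists s t, proj1_sig x s /\ proj1_sig y t /\ tree_mem s t.

Definition ztransitive (x : zset) : Prop :=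
  forall y z, zmem y x -> zmem z y -> zmem z x.

Definition zcountable (x : zset) : Prop :=
  exists f : {y : zset | zmem y x} -> nat, forall a b, f a = f b -> a = b.

Definition tree_empty : tree :=
  node Empty_set (fun e => match e with end).

(* t ∪ {t} *)
Definition tree_succ (t : tree) : tree :=
  match t with
  | node A f => node (option A) (fun o => match o with Some a => f a | None => t end)
  end.

Fixpoint tree_nat (n : nat) : tree :=
  match n with 0 => tree_empty | S m => tree_succ (tree_nat m) end.

Definition omega : zset := zset_of (node nat tree_nat).

Definition in_structure (x : zset) : structure :=
  Structure {y : zset | zmem y x} (fun a b => zmem (proj1_sig a) (proj1_sig b)).

(* Main.v *)
(** Call H the axiom that for every v some set contains collapses of all well-founded relations
    on v.  A Löwenheim–Skolem argument inside Mac + H shows that MOST is equivalent to Mac + H, and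
    that the existence of a witness for a bounded formula can be checked in a set obtained from the
    parameters by powersets and H.

    From (II) to (I): the fixed sets form a cut of M that contains every set of M whose elements
    all lie in the cut, which gives Mac and H.  If a powerset-bounded formula had no bound for its
    witnesses, then the ordinals m of the cut would be exactly those m below a nonstandard ordinal
    for which the sets coded on m do not suffice; so the ordinals of the cut would form a set of M.

    From (I) to (II): a Henkin construction over N = I yields an end extension X of N in which every
    set of elements of N is an element of N; powerset-bounded collection provides the pigeonhole
    principle needed for that.  X contains a transitive set B including N whose elements form a
    model M of MOST, and the Karp types of finite sequences over B at levels y from a hereditarily
    transitive nonstandard set.  Equality of types at nonstandard levels is a back-and-forth system
    on the countable model M.  Given a nonstandard set z, the types at a standard level cannot
    separate all elements of TC({z}), since these types are standard and would collapse z into N; by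
    overspill two elements share a type at a nonstandard level, and so one of them can be moved. *)

(* Two obstacles shape the development. Mac has no collection, so the Löwenheim-Skolem argument
   cannot evaluate terms by recursion: terms over s are coded by subsets of a product fixed in
   advance, and evaluation is the least closed relation, cut out with powersets.

   The generic extension X inherits only bounded statements and their ∀∃ consequences; powerset and
   collection cannot be appealed to there. Hence all that is used about X is stated beforehand in
   one [Delta0] formula about B, W, D, L, T. This is the reason for replacing MOST by Mac + H: apart
   from separation these are finitely many axioms, hence one sentence that can be relativized to B,
   and separation is traded for closure properties of the algebra D.

   That ω is standard enters twice: recursion along ω may use external induction, and coordinates of
   sequences in X are true natural numbers, so external formulas can be handled without coding
   syntax.

   In the pigeonhole principle, absence of solutions is a Π1 statement, too complex for the
   collection at hand. Löwenheim-Skolem bounds its quantifier by a set that is recognised by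
   quantifying over subsets only. *)
From Stdlib Require Import Classical ClassicalEpsilon FunctionalExtensionality.
From Stdlib Require Import PropExtensionality ProofIrrelevance Arith Lia List Cantor.
Require Import Defs.
Local Open Scope lset_scope.

(** * Renaming of variables *)

Definition up (f : nat -> nat) : nat -> nat := scons 0 (fun n => S (f n)).

Fixpoint ren (f : nat -> nat) (p : formula) : formula :=
  match p with
  | fMem i j => fMem (f i) (f j)
  | fEq i j => fEq (f i) (f j)
  | fNot p => fNot (ren f p)
  | fAnd p q => fAnd (ren f p) (ren f q)
  | fOr p q => fOr (ren f p) (ren f q)
  | fImp p q => fImp (ren f p) (ren f q)
  | fAll p => fAll (ren (up f) p)
  | fEx p => fEx (ren (up f) p)
  end.

Lemma sat_ren (M : structure) (p : formula) : forall (f : nat -> nat) (rho : nat -> M),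
  sat rho (ren f p) <-> sat (fun i => rho (f i)) p.
Proof.
  assert (E : forall f (rho : nat -> M) a,
    (fun i => scons a rho (up f i)) = scons a (fun i => rho (f i))).
  { intros; apply functional_extensionality; intros [|i]; reflexivity. }
  induction p; intros f rho; simpl; try tauto.
  - rewrite IHp; tauto.
  - rewrite IHp1, IHp2; tauto.
  - rewrite IHp1, IHp2; tauto.
  - rewrite IHp1, IHp2; tauto.
  - split; intros H a; specialize (H a); rewrite IHp, E in *; assumption.
  - split; intros [a H]; exists a; rewrite IHp, E in *; assumption.
Qed.

(** A crude bound on the free variables: quantifiers do not lower it and connectives add. It lets
    finitely many parameters, which form a set of the model, stand for a whole assignment. *)
Fixpoint bnd (p : formula) : nat :=
  match p with
  | fMem i j | fEq i j => S (i + j)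
  | fNot p | fAll p | fEx p => bnd p
  | fAnd p q | fOr p q | fImp p q => bnd p + bnd q
  end.

Lemma sat_bnd (M : structure) (p : formula) : forall rho rho' : nat -> M,
  (forall i, i < bnd p -> rho i = rho' i) -> (sat rho p <-> sat rho' p).
Proof.
  induction p; intros rho rho' H; simpl in *.
  - rewrite (H i), (H j) by lia; tauto.
  - rewrite (H i), (H j) by lia; tauto.
  - rewrite (IHp rho rho') by auto; tauto.
  - rewrite (IHp1 rho rho'), (IHp2 rho rho') by (intros; apply H; lia); tauto.
  - rewrite (IHp1 rho rho'), (IHp2 rho rho') by (intros; apply H; lia); tauto.
  - rewrite (IHp1 rho rho'), (IHp2 rho rho') by (intros; apply H; lia); tauto.
  - assert (E : forall a, sat (scons a rho) p <-> sat (scons a rho') p).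
    { intros a; apply IHp; intros [|i] Hi; simpl; auto; apply H; lia. }
    split; intros K a; apply E, K.
  - assert (E : forall a, sat (scons a rho) p <-> sat (scons a rho') p).
    { intros a; apply IHp; intros [|i] Hi; simpl; auto; apply H; lia. }
    split; intros [a K]; exists a; apply E, K.
Qed.

Lemma sat_ext (M : structure) (p : formula) (rho rho' : nat -> M) :
  (forall i, rho i = rho' i) -> (sat rho p <-> sat rho' p).
Proof. intros; apply sat_bnd; auto. Qed.

(** A parameter for the formula class, so that closure of definability under the logical operations
    is proved once for all three classes. *)
Inductive kind := KD0 | KD0P | KFO.

Definition Gam (k : kind) : formula -> Prop :=
  match k with KD0 => Delta0 | KD0P => Delta0P | KFO => fun _ => True end.

Lemma Delta0_Delta0P (p : formula) : Delta0 p -> Delta0P p.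
Proof. induction 1; constructor; assumption. Qed.

Lemma Gam_mem k i j : Gam k (fMem i j). Proof. destruct k; simpl; try constructor. Qed.
Lemma Gam_eq k i j : Gam k (fEq i j). Proof. destruct k; simpl; try constructor. Qed.
Lemma Gam_not k p : Gam k p -> Gam k (fNot p).
Proof. destruct k; simpl; intros; try constructor; auto. Qed.
Lemma Gam_and k p q : Gam k p -> Gam k q -> Gam k (fAnd p q).
Proof. destruct k; simpl; intros; try constructor; auto. Qed.
Lemma Gam_or k p q : Gam k p -> Gam k q -> Gam k (fOr p q).
Proof. destruct k; simpl; intros; try constructor; auto. Qed.
Lemma Gam_imp k p q : Gam k p -> Gam k q -> Gam k (fImp p q).
Proof. destruct k; simpl; intros; try constructor; auto. Qed.
Lemma Gam_allin k y p : Gam k p -> Gam k (fAllIn y p).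
Proof. destruct k; simpl; intros; try constructor; auto. Qed.
Lemma Gam_exin k y p : Gam k p -> Gam k (fExIn y p).
Proof. destruct k; simpl; intros; try constructor; auto. Qed.

Lemma Gam_ren k p : Gam k p -> forall f, Gam k (ren f p).
Proof.
  destruct k; simpl; auto; induction 1; intros f; constructor; auto.
Qed.

(* [comb e r] interleaves two assignments: even variables read [e], odd ones [r]. *)
Fixpoint comb {A : Type} (e r : nat -> A) (n : nat) : A :=
  match n with
  | 0 => e 0
  | 1 => r 0
  | S (S n) => comb (fun i => e (S i)) (fun i => r (S i)) n
  end.

Lemma comb_even {A : Type} i : forall e r : nat -> A, comb e r (2 * i) = e i.
Proof.
  induction i; intros e r; [reflexivity|].
  replace (2 * S i) with (S (S (2 * i))) by lia; simpl comb; apply IHi.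
Qed.

Lemma comb_odd {A : Type} i : forall e r : nat -> A, comb e r (S (2 * i)) = r i.
Proof.
  induction i; intros e r; [reflexivity|].
  replace (S (2 * S i)) with (S (S (S (2 * i)))) by lia; simpl comb.
  apply (IHi (fun i => e (S i)) (fun i => r (S i))).
Qed.

Lemma even_odd_cases n : exists i, n = 2 * i \/ n = S (2 * i).
Proof.
  induction n as [|n [i [H|H]]]; [exists 0; auto|exists i; lia|exists (S i); lia].
Qed.

Lemma comb_map {A B : Type} (X : A -> B) (a b : nat -> A) :
  (fun n => X (comb a b n)) = comb (fun i => X (a i)) (fun i => X (b i)).
Proof.
  apply functional_extensionality; intro n.
  destruct (even_odd_cases n) as [i [->| ->]]; rewrite ?comb_even, ?comb_odd; reflexivity.
Qed.

Lemma scons_eta {A : Type} (e : nat -> A) : scons (e 0) (fun i => e (S i)) = e.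
Proof. apply functional_extensionality; intros [|i]; reflexivity. Qed.

(** * Definable predicates *)

(* A family of structures with a class of admissible constants in each member;
   a definition is one formula that works throughout the family. *)
Record fam := Fam {
  fJ : Type;
  fS : fJ -> structure;
  fC : forall j, fS j -> Prop;
  fpt : forall j, fS j;
  fCpt : forall j, fC j (fpt j)
}.

Section Definability.
Context {G : fam} {k : kind}.

(** Even variables of the formula read the environment, odd ones the constants; thus constants can
    be added at any time without renumbering the environment. *)
Definition Dfn (P : forall j, (nat -> fS G j) -> Prop) : Prop :=
  exists p (r : forall j, nat -> fS G j), Gam k p /\ (forall j i, fC G j (r j i)) /\
    forall j e, P j e <-> sat (comb e (r j)) p.

Definition IsT (t : forall j, (nat -> fS G j) -> fS G j) : Prop :=
  (exists i, forall j e, t j e = e i) \/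
  (exists a : forall j, fS G j, (forall j, fC G j (a j)) /\ forall j e, t j e = a j).

Lemma IsT_comb t : IsT t -> exists i (r : forall j, nat -> fS G j),
  (forall j i, fC G j (r j i)) /\ forall j e, t j e = comb e (r j) i.
Proof.
  intros [[i H]|[a [Ha H]]].
  - exists (2 * i), (fun j _ => fpt G j); split; [intros; apply fCpt|].
    intros; rewrite comb_even; auto.
  - exists 1, (fun j _ => a j); split; auto.
Qed.

(** Two definitions are brought over a common sequence of constants by interleaving their sequences;
    this renumbering recovers the first one, [comb_right] the second. *)
Lemma comb_left {A : Type} (e r1 r2 : nat -> A) m :
  comb e (comb r1 r2) (comb (fun i => 2 * i) (fun i => S (2 * (2 * i))) m) = comb e r1 m.
Proof.
  destruct (even_odd_cases m) as [i [->| ->]]; rewrite ?comb_even, ?comb_odd;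
    rewrite ?comb_even, ?comb_odd, ?comb_even; reflexivity.
Qed.

Lemma comb_right {A : Type} (e r1 r2 : nat -> A) m :
  comb e (comb r1 r2) (comb (fun i => 2 * i) (fun i => S (2 * S (2 * i))) m) = comb e r2 m.
Proof.
  destruct (even_odd_cases m) as [i [->| ->]]; rewrite ?comb_even, ?comb_odd;
    rewrite ?comb_even, ?comb_odd, ?comb_odd; reflexivity.
Qed.

Lemma comb_C (r1 r2 : forall j, nat -> fS G j) :
  (forall j i, fC G j (r1 j i)) -> (forall j i, fC G j (r2 j i)) ->
  forall j i, fC G j (comb (r1 j) (r2 j) i).
Proof.
  intros H1 H2 j i; destruct (even_odd_cases i) as [m [->| ->]];
    rewrite ?comb_even, ?comb_odd; auto.
Qed.

Lemma IsT_two t1 t2 : IsT t1 -> IsT t2 -> exists i1 i2 (r : forall j, nat -> fS G j),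
  (forall j i, fC G j (r j i)) /\ (forall j e, t1 j e = comb e (r j) i1) /\
  (forall j e, t2 j e = comb e (r j) i2).
Proof.
  intros H1 H2; destruct (IsT_comb _ H1) as [i1 [r1 [C1 E1]]].
  destruct (IsT_comb _ H2) as [i2 [r2 [C2 E2]]].
  exists (comb (fun i => 2 * i) (fun i => S (2 * (2 * i))) i1),
    (comb (fun i => 2 * i) (fun i => S (2 * S (2 * i))) i2), (fun j => comb (r1 j) (r2 j)).
  repeat split; [apply comb_C; auto|..]; intros; rewrite ?comb_left, ?comb_right; auto.
Qed.

Lemma Dfn_two P Q : Dfn P -> Dfn Q -> exists p q (r : forall j, nat -> fS G j),
  Gam k p /\ Gam k q /\ (forall j i, fC G j (r j i)) /\
  (forall j e, P j e <-> sat (comb e (r j)) p) /\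
  (forall j e, Q j e <-> sat (comb e (r j)) q).
Proof.
  intros [p [r1 [Gp [C1 E1]]]] [q [r2 [Gq [C2 E2]]]].
  exists (ren (comb (fun i => 2 * i) (fun i => S (2 * (2 * i)))) p),
    (ren (comb (fun i => 2 * i) (fun i => S (2 * S (2 * i)))) q), (fun j => comb (r1 j) (r2 j)).
  split; [apply Gam_ren; auto|split; [apply Gam_ren; auto|split; [apply comb_C; auto|]]].
  split; intros j e; rewrite sat_ren; [rewrite E1|rewrite E2]; apply sat_ext; intros; symmetry;
    [apply comb_left|apply comb_right].
Qed.

Lemma D_ext (P Q : forall j, (nat -> fS G j) -> Prop) :
  (forall j e, P j e <-> Q j e) -> Dfn Q -> Dfn P.
Proof.
  intros H [p [r [Gp [C E]]]]; exists p, r; repeat split; auto; intros; apply E, H || apply H, E;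
    assumption.
Qed.

Lemma D_mem t1 t2 : IsT t1 -> IsT t2 -> Dfn (fun j e => mem (t1 j e) (t2 j e)).
Proof.
  intros H1 H2; destruct (IsT_two _ _ H1 H2) as [i1 [i2 [r [C [E1 E2]]]]].
  exists (fMem i1 i2), r; repeat split; auto using Gam_mem; intros; simpl in *.
  - rewrite <- E1, <- E2; auto.
  - rewrite E1, E2; auto.
Qed.

Lemma D_eq t1 t2 : IsT t1 -> IsT t2 -> Dfn (fun j e => t1 j e = t2 j e).
Proof.
  intros H1 H2; destruct (IsT_two _ _ H1 H2) as [i1 [i2 [r [C [E1 E2]]]]].
  exists (fEq i1 i2), r; repeat split; auto using Gam_eq; intros; simpl in *.
  - rewrite <- E1, <- E2; auto.
  - rewrite E1, E2; auto.
Qed.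

Lemma D_not P : Dfn P -> Dfn (fun j e => ~ P j e).
Proof.
  intros [p [r [Gp [C E]]]]; exists (fNot p), r; split; [apply Gam_not; auto|split; auto].
  intros; simpl; rewrite E; tauto.
Qed.

Lemma D_and P Q : Dfn P -> Dfn Q -> Dfn (fun j e => P j e /\ Q j e).
Proof.
  intros H1 H2; destruct (Dfn_two _ _ H1 H2) as [p [q [r [Gp [Gq [C [E1 E2]]]]]]].
  exists (fAnd p q), r; split; [apply Gam_and; auto|split; auto].
  intros; simpl; rewrite E1, E2; tauto.
Qed.

Lemma D_or P Q : Dfn P -> Dfn Q -> Dfn (fun j e => P j e \/ Q j e).
Proof.
  intros H1 H2; destruct (Dfn_two _ _ H1 H2) as [p [q [r [Gp [Gq [C [E1 E2]]]]]]].
  exists (fOr p q), r; split; [apply Gam_or; auto|split; auto].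
  intros; simpl; rewrite E1, E2; tauto.
Qed.

Lemma D_imp P Q : Dfn P -> Dfn Q -> Dfn (fun j e => P j e -> Q j e).
Proof.
  intros H1 H2; destruct (Dfn_two _ _ H1 H2) as [p [q [r [Gp [Gq [C [E1 E2]]]]]]].
  exists (fImp p q), r; split; [apply Gam_imp; auto|split; auto].
  intros; simpl; rewrite E1, E2; tauto.
Qed.

Lemma D_iff P Q : Dfn P -> Dfn Q -> Dfn (fun j e => P j e <-> Q j e).
Proof.
  intros H1 H2; apply (D_ext _ (fun j e => (P j e -> Q j e) /\ (Q j e -> P j e))).
  - intros; unfold iff; tauto.
  - apply D_and; apply D_imp; auto.
Qed.

Lemma D_ren (P : forall j, (nat -> fS G j) -> Prop) (f : nat -> nat) :
  Dfn P -> Dfn (fun j e => P j (fun i => e (f i))).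
Proof.
  intros [p [r [Gp [C E]]]].
  exists (ren (comb (fun i => 2 * f i) (fun i => S (2 * i))) p), r.
  split; [apply Gam_ren; auto|split; auto].
  intros j e; rewrite sat_ren, E; apply sat_ext; intros m.
  destruct (even_odd_cases m) as [i [->| ->]]; rewrite ?comb_even, ?comb_odd;
    rewrite ?comb_even, ?comb_odd; reflexivity.
Qed.

Lemma comb_scons {A : Type} (x : A) (e r : nat -> A) :
  (fun m => scons x (comb e r) (comb (scons 0 (fun i => S (2 * i))) (fun i => S (S (2 * i))) m))
  = comb (scons x e) r.
Proof.
  rewrite (comb_map (scons x (comb e r))).
  f_equal; apply functional_extensionality.
  - intros [|i]; [reflexivity|]. unfold scons at 1 2. unfold scons. apply comb_even.
  - intros i; simpl. apply comb_odd.
Qed.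

(** Moves the bound variable from entry 0 of the environment to the front of the interleaved
    assignment, the place where a quantifier of the object language puts it. *)
Lemma Dfn_bind (P : forall j, (nat -> fS G j) -> fS G j -> Prop) :
  Dfn (fun j e => P j (fun i => e (S i)) (e 0)) ->
  exists p (r : forall j, nat -> fS G j), Gam k p /\ (forall j i, fC G j (r j i)) /\
    forall j e x, P j e x <-> sat (scons x (comb e (r j))) p.
Proof.
  intros [p [r [Gp [C E]]]].
  exists (ren (comb (scons 0 (fun i => S (2 * i))) (fun i => S (S (2 * i)))) p), r.
  split; [apply Gam_ren; auto|split; auto].
  intros j e x; rewrite sat_ren, comb_scons.
  rewrite <- E; simpl; reflexivity.
Qed.

Lemma D_quant (t : forall j, (nat -> fS G j) -> fS G j)
  (P : forall j, (nat -> fS G j) -> fS G j -> Prop) :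
  IsT t -> Dfn (fun j e => P j (fun i => e (S i)) (e 0)) ->
  exists y p (r : forall j, nat -> fS G j), Gam k p /\ (forall j i, fC G j (r j i)) /\
   (forall j e, t j e = comb e (r j) y) /\
    forall j e x, P j e x <-> sat (scons x (comb e (r j))) p.
Proof.
  intros Ht HP.
  destruct (IsT_comb _ Ht) as [y [r1 [C1 E1]]].
  destruct (Dfn_bind _ HP) as [p [r2 [Gp [C2 E2]]]].
  exists (comb (fun i => 2 * i) (fun i => S (2 * (2 * i))) y),
    (ren (up (comb (fun i => 2 * i) (fun i => S (2 * S (2 * i))))) p), (fun j => comb (r1 j) (r2 j)).
  split; [apply Gam_ren; auto|split; [apply comb_C; auto|split]].
  - intros; rewrite comb_left; auto.
  - intros; rewrite E2, sat_ren; apply sat_ext; intros [|i]; [reflexivity|].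
    simpl up; unfold scons; symmetry; apply comb_right.
Qed.

Lemma D_allin t P : IsT t -> Dfn (fun j e => P j (fun i => e (S i)) (e 0)) ->
  Dfn (fun j e => forall x, mem x (t j e) -> P j e x).
Proof.
  intros Ht HP; destruct (D_quant _ _ Ht HP) as [y [p [r [Gp [C [E1 E2]]]]]].
  exists (fAllIn y p), r; split; [apply Gam_allin; auto|split; auto].
  intros; simpl; rewrite E1; split; intros H x Hx; apply E2; auto.
Qed.

Lemma D_exin t P : IsT t -> Dfn (fun j e => P j (fun i => e (S i)) (e 0)) ->
  Dfn (fun j e => exists x, mem x (t j e) /\ P j e x).
Proof.
  intros Ht HP; destruct (D_quant _ _ Ht HP) as [y [p [r [Gp [C [E1 E2]]]]]].
  exists (fExIn y p), r; split; [apply Gam_exin; auto|split; auto].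
  intros; simpl; rewrite E1; split; intros [x [H1 H2]]; exists x; split; auto; apply E2; auto.
Qed.

Lemma IsT_shift t : IsT t -> IsT (fun j e => t j (fun i => e (S i))).
Proof.
  intros [[i H]|[a [Ha H]]]; [left; exists (S i)|right; exists a; split]; auto; intros; rewrite H;
    auto.
Qed.

End Definability.
Arguments Dfn G k P : clear implicits.
Arguments IsT G t : clear implicits.

Lemma D_kind {G k} P : Dfn G KD0 P -> Dfn G k P.
Proof.
  intros [p [r [Gp H]]]; exists p, r; split; auto.
  destruct k; simpl in *; auto using Delta0_Delta0P.
Qed.

Lemma D_allsub {G} t P : IsT G t -> Dfn G KD0P (fun j e => P j (fun i => e (S i)) (e 0)) ->
  Dfn G KD0P (fun j e => forall x, subset (fS G j) x (t j e) -> P j e x).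
Proof.
  intros Ht HP; destruct (D_quant _ _ Ht HP) as [y [p [r [Gp [C [E1 E2]]]]]].
  exists (fAllSub y p), r; split; [constructor; auto|split; auto].
  intros; simpl; unfold subset; rewrite E1; split; intros H x Hx; apply E2; auto.
Qed.

Lemma D_exsub {G} t P : IsT G t -> Dfn G KD0P (fun j e => P j (fun i => e (S i)) (e 0)) ->
  Dfn G KD0P (fun j e => exists x, subset (fS G j) x (t j e) /\ P j e x).
Proof.
  intros Ht HP; destruct (D_quant _ _ Ht HP) as [y [p [r [Gp [C [E1 E2]]]]]].
  exists (fExSub y p), r; split; [constructor; auto|split; auto].
  intros; simpl; unfold subset; rewrite E1; split; intros [x [H1 H2]]; exists x; split; auto;
    apply E2; auto.
Qed.

Lemma D_all {G} P : Dfn G KFO (fun j e => P j (fun i => e (S i)) (e 0)) ->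
  Dfn G KFO (fun j e => forall x, P j e x).
Proof.
  intros HP; destruct (Dfn_bind _ HP) as [p [r [Gp [C E]]]].
  exists (fAll p), r; split; [exact I|split; auto].
  intros; simpl; split; intros H x; apply E; auto.
Qed.

Lemma D_ex {G} P : Dfn G KFO (fun j e => P j (fun i => e (S i)) (e 0)) ->
  Dfn G KFO (fun j e => exists x, P j e x).
Proof.
  intros HP; destruct (Dfn_bind _ HP) as [p [r [Gp [C E]]]].
  exists (fEx p), r; split; [exact I|split; auto].
  intros; simpl; split; intros [x H]; exists x; apply E; auto.
Qed.

Lemma D_sat {G k} p (f : nat -> nat) : Gam k p ->
  Dfn G k (fun j e => sat (fun i => e (f i)) p).
Proof.
  intros Gp; exists (ren (fun i => 2 * f i) p), (fun j _ => fpt G j).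
  split; [apply Gam_ren; auto|split; [intros; apply fCpt|]].
  intros; rewrite sat_ren; apply sat_ext; intros; rewrite comb_even; reflexivity.
Qed.

Definition famC (M : structure) (C : M -> Prop) (x0 : M) (H : C x0) : fam :=
  Fam unit (fun _ => M) (fun _ => C) (fun _ => x0) (fun _ => H).

Definition fam1 (M : structure) (x0 : M) : fam := famC M (fun _ => True) x0 Logic.I.

(* The family of all pointed structures: definitions in it are uniform, the point being
   the only admissible constant. *)
Definition famU : fam :=
  Fam {M : structure & carrier M} (fun j => projT1 j) (fun j x => x = projT2 j)
    (fun j => projT2 j) (fun j => eq_refl).

Lemma IsT_ren {G} t (f : nat -> nat) : IsT G t -> IsT G (fun j e => t j (fun i => e (f i))).
Proof.
  intros [[i H]|[a [Ha H]]]; [left; exists (f i)|right; exists a; split]; auto; intros; rewrite H;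
    auto.
Qed.

Ltac dT := first
  [ assumption
  | left; eexists; intros; reflexivity
  | right; eexists; split; [|intros; reflexivity]; intros; simpl; auto; fail
  | apply IsT_ren; dT ].

Ltac dfn0 :=
  cbv beta; first
  [ assumption
  | apply D_iff; dfn0 | apply D_not; dfn0
  | apply D_and; dfn0 | apply D_or; dfn0 | apply D_imp; dfn0
  | apply D_mem; dT | apply D_eq; dT
  | apply D_allin; [dT|dfn0] | apply D_exin; [dT|dfn0]
  | apply D_ren; assumption ].

(** * Definability of the basic set-theoretic notions *)

Section Notions.
Context {G : fam} {k : kind} (t1 t2 t3 t4 : forall j, (nat -> fS G j) -> fS G j).
Hypothesis (H1 : IsT G t1) (H2 : IsT G t2) (H3 : IsT G t3) (H4 : IsT G t4).

Lemma D_subset : Dfn G k (fun j e => subset (fS G j) (t1 j e) (t2 j e)).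
Proof using H1 H2. unfold subset; dfn0. Qed.

Lemma D_empty : Dfn G k (fun j e => is_empty (fS G j) (t1 j e)).
Proof using H1.
  apply (D_ext _ (fun j e => forall x, mem x (t1 j e) -> ~ x = x)); [|dfn0].
  intros; unfold is_empty; clear; firstorder.
Qed.

Lemma D_upair : Dfn G k (fun j e => is_upair (fS G j) (t1 j e) (t2 j e) (t3 j e)).
Proof using H1 H2 H3.
  apply (D_ext _ (fun j e => (mem (t2 j e) (t1 j e) /\ mem (t3 j e) (t1 j e)) /\
    forall x, mem x (t1 j e) -> x = t2 j e \/ x = t3 j e)); [|dfn0].
  intros j e; unfold is_upair; split.
  - intros H; repeat split; try (apply H; auto).
  - intros [[Ha Hb] H] z; split; auto; intros [->| ->]; auto.
Qed.

Lemma D_succ : Dfn G k (fun j e => is_succ (fS G j) (t1 j e) (t2 j e)).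
Proof using H1 H2.
  apply (D_ext _ (fun j e => (mem (t2 j e) (t1 j e) /\
      forall x, mem x (t2 j e) -> mem x (t1 j e)) /\
    forall x, mem x (t1 j e) -> mem x (t2 j e) \/ x = t2 j e)); [|dfn0].
  intros j e; unfold is_succ; split.
  - intros H; repeat split; try (apply H; auto). intros; apply H; auto.
  - intros [[Ha Hb] H] z; split; auto; intros [?| ->]; auto.
Qed.

Lemma D_trans : Dfn G k (fun j e => is_transitive (fS G j) (t1 j e)).
Proof using H1. unfold is_transitive; dfn0. Qed.

End Notions.

Lemma is_opair_bounded (M : structure) (p a b : M) : is_opair M p a b <->
  exists s, mem s p /\ exists u, mem u p /\
    is_upair M s a a /\ is_upair M u a b /\ is_upair M p s u.
Proof.
  unfold is_opair, is_singleton; split; [|clear; firstorder].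
  intros [s [u [Hs [Hu Hp]]]]; exists s; split; [apply Hp; auto|]; exists u; split; auto.
  apply Hp; auto.
Qed.

(** This bounds the quantifiers over components of pairs, and so over arguments and values of
    relations, in the lemmas below. *)
Lemma is_opair_union (M : structure) (p a b : M) : is_opair M p a b ->
  exists u, mem u p /\ mem a u /\ mem b u.
Proof.
  intros [s [u [Hs [Hu Hp]]]]; exists u; split; [apply Hp; auto|]; split; apply Hu; auto.
Qed.

Ltac dfn0 ::=
  cbv beta; first
  [ assumption
  | apply D_iff; dfn0 | apply D_not; dfn0
  | apply D_and; dfn0 | apply D_or; dfn0 | apply D_imp; dfn0
  | apply D_mem; dT | apply D_eq; dT
  | apply D_subset; dT | apply D_empty; dT | apply D_upair; dT | apply D_succ; dT
  | apply D_trans; dT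
  | apply D_allin; [dT|dfn0] | apply D_exin; [dT|dfn0]
  | apply D_ren; assumption ].

Section Notions2.
Context {G : fam} {k : kind} (t1 t2 t3 : forall j, (nat -> fS G j) -> fS G j).
Context (P : forall j, (nat -> fS G j) -> fS G j -> Prop).
Hypothesis (H1 : IsT G t1) (H2 : IsT G t2) (H3 : IsT G t3).
Hypothesis (HP : Dfn G k (fun j e => P j (fun i => e (S i)) (e 0))).

Lemma D_opair : Dfn G k (fun j e => is_opair (fS G j) (t1 j e) (t2 j e) (t3 j e)).
Proof using H1 H2 H3.
  eapply D_ext; [intros; apply is_opair_bounded|]. dfn0.
Qed.

Lemma D_ex_union : Dfn G k (fun j e => exists x, (exists u, mem u (t1 j e) /\ mem x u) /\ P j e x).
Proof using H1 HP.
  apply (D_ext _ (fun j e => exists u, mem u (t1 j e) /\ exists x, mem x u /\ P j e x));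
    [clear; firstorder|].
  apply D_exin; [dT|]; apply D_exin; [dT|]; cbv beta.
  apply (D_ren _ (fun i => match i with 0 => 0 | S i => S (S i) end) HP).
Qed.

Lemma D_all_union : Dfn G k (fun j e => forall x, (exists u, mem u (t1 j e) /\ mem x u) -> P j e x).
Proof using H1 HP.
  apply (D_ext _ (fun j e => forall u, mem u (t1 j e) -> forall x, mem x u -> P j e x));
    [clear; firstorder|].
  apply D_allin; [dT|]; apply D_allin; [dT|]; cbv beta.
  apply (D_ren _ (fun i => match i with 0 => 0 | S i => S (S i) end) HP).
Qed.
End Notions2.

Section Notions3.
Context {G : fam} {k : kind} (t1 t2 t3 : forall j, (nat -> fS G j) -> fS G j).
Context (P : forall j, (nat -> fS G j) -> fS G j -> Prop).
Hypothesis (H1 : IsT G t1) (H2 : IsT G t2) (H3 : IsT G t3).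
Hypothesis (HP : Dfn G k (fun j e => P j (fun i => e (S i)) (e 0))).

Lemma D_related : Dfn G k (fun j e => related (fS G j) (t1 j e) (t2 j e) (t3 j e)).
Proof using H1 H2 H3. unfold related; apply D_exin; [dT|]; apply D_opair; dT. Qed.

Lemma D_ex_opair2 : Dfn G k (fun j e => exists x, is_opair (fS G j) (t1 j e) (t2 j e) x /\ P j e x).
Proof using H1 H2 HP.
  apply (D_ext _ (fun j e => exists x, (exists u, mem u (t1 j e) /\ mem x u) /\
    is_opair (fS G j) (t1 j e) (t2 j e) x /\ P j e x)).
  - intros j e; split; [intros [x [Hx Hp]]; exists x|clear; firstorder]; split; auto.
    destruct (is_opair_union _ _ _ _ Hx) as [u ?]; exists u; tauto.
  - apply D_ex_union; [dT|]; apply D_and; [apply D_opair; dT|auto].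
Qed.

Lemma D_all_opair2 : Dfn G k (fun j e => forall x, is_opair (fS G j) (t1 j e) (t2 j e) x -> P j e x).
Proof using H1 H2 HP.
  apply (D_ext _ (fun j e => forall x, (exists u, mem u (t1 j e) /\ mem x u) ->
    is_opair (fS G j) (t1 j e) (t2 j e) x -> P j e x)).
  - intros j e; split; [clear; firstorder|intros H x Hx]; apply H; auto.
    destruct (is_opair_union _ _ _ _ Hx) as [u ?]; exists u; tauto.
  - apply D_all_union; [dT|]; apply D_imp; [apply D_opair; dT|auto].
Qed.

Lemma D_ex_related2 : Dfn G k (fun j e => exists x, related (fS G j) (t1 j e) (t2 j e) x /\ P j e x).
Proof using H1 H2 HP.
  apply (D_ext _ (fun j e => exists p, mem p (t1 j e) /\ exists x, (exists u, mem u p /\ mem x u) /\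
    is_opair (fS G j) p (t2 j e) x /\ P j e x)).
  - intros j e; split.
    + intros [x [[p [Hp Ho]] Hx]]; exists p; split; auto; exists x; repeat split; auto.
      destruct (is_opair_union _ _ _ _ Ho) as [u ?]; exists u; tauto.
    + intros [p [Hp [x [_ [Ho Hx]]]]]; exists x; split; auto; exists p; auto.
  - apply D_exin; [dT|]; apply D_ex_union; [dT|]; cbv beta; apply D_and; [apply D_opair; dT|].
    apply (D_ren _ (fun i => match i with 0 => 0 | S i => S (S i) end) HP).
Qed.

Lemma D_all_related2 : Dfn G k (fun j e => forall x, related (fS G j) (t1 j e) (t2 j e) x -> P j e x).
Proof using H1 H2 HP.
  apply (D_ext _ (fun j e => forall p, mem p (t1 j e) -> forall x, (exists u, mem u p /\ mem x u) ->
    is_opair (fS G j) p (t2 j e) x -> P j e x)).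
  - intros j e; split.
    + intros H p Hp x _ Ho; apply H; exists p; auto.
    + intros H x [p [Hp Ho]]; apply (H p); auto.
      destruct (is_opair_union _ _ _ _ Ho) as [u ?]; exists u; tauto.
  - apply D_allin; [dT|]; apply D_all_union; [dT|]; cbv beta; apply D_imp; [apply D_opair; dT|].
    apply (D_ren _ (fun i => match i with 0 => 0 | S i => S (S i) end) HP).
Qed.

Lemma D_all_opair1 : Dfn G k (fun j e => forall x, is_opair (fS G j) (t1 j e) x (t2 j e) -> P j e x).
Proof using H1 H2 HP.
  apply (D_ext _ (fun j e => forall x, (exists u, mem u (t1 j e) /\ mem x u) ->
    is_opair (fS G j) (t1 j e) x (t2 j e) -> P j e x)).
  - intros j e; split; [clear; firstorder|intros H x Hx]; apply H; auto.
    destruct (is_opair_union _ _ _ _ Hx) as [u ?]; exists u; tauto.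
  - apply D_all_union; [dT|]; apply D_imp; [apply D_opair; dT|auto].
Qed.

End Notions3.

Section Notions4.
Context {G : fam} {k : kind} (t1 : forall j, (nat -> fS G j) -> fS G j).
Context (P : forall j, (nat -> fS G j) -> fS G j -> fS G j -> Prop).
Hypothesis (H1 : IsT G t1).
Hypothesis (HP : Dfn G k (fun j e => P j (fun i => e (S (S i))) (e 1) (e 0))).

Lemma D_all_related : Dfn G k (fun j e => forall a b, related (fS G j) (t1 j e) a b -> P j e a b).
Proof using H1 HP.
  apply (D_ext _ (fun j e => forall p, mem p (t1 j e) ->
    forall a, (exists u, mem u p /\ mem a u) -> forall b, is_opair (fS G j) p a b -> P j e a b)).
  - intros j e; split.
    + intros H p Hp a _ b Ho; apply H; exists p; auto.
    + intros H a b [p [Hp Ho]]; apply (H p); auto.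
      destruct (is_opair_union _ _ _ _ Ho) as [u ?]; exists u; tauto.
  - apply D_allin; [dT|]; apply D_all_union; [dT|]; cbv beta; apply D_all_opair2; [dT..|].
    apply (D_ren _ (fun i => match i with 0 => 0 | 1 => 1 | S (S i) => S (S (S i)) end) HP).
Qed.

Lemma D_ex_related : Dfn G k (fun j e => exists a b, related (fS G j) (t1 j e) a b /\ P j e a b).
Proof using H1 HP.
  apply (D_ext _ (fun j e => exists p, mem p (t1 j e) /\
    exists a, (exists u, mem u p /\ mem a u) /\ exists b, is_opair (fS G j) p a b /\ P j e a b)).
  - intros j e; split.
    + intros [a [b [[p [Hp Ho]] H]]]; exists p; split; auto; exists a; split; [|exists b; auto].
      destruct (is_opair_union _ _ _ _ Ho) as [u ?]; exists u; tauto.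
    + intros [p [Hp [a [_ [b [Ho H]]]]]]; exists a, b; split; auto; exists p; auto.
  - apply D_exin; [dT|]; apply D_ex_union; [dT|]; cbv beta; apply D_ex_opair2; [dT..|].
    apply (D_ren _ (fun i => match i with 0 => 0 | 1 => 1 | S (S i) => S (S (S i)) end) HP).
Qed.
End Notions4.

(** The order of the attempts matters: unification may unfold [iff] and [not], so these are tried
    before conjunction and implication. *)
Ltac dapp :=
  lazymatch goal with |- Dfn ?G ?k _ => first
  [ apply (@D_iff G k) | apply (@D_not G k)
  | apply (@D_and G k) | apply (@D_or G k)
  | apply (@D_mem G k); dT | apply (@D_eq G k); dT
  | apply (@D_subset G k); dT | apply (@D_empty G k); dT | apply (@D_upair G k); dT
  | apply (@D_succ G k); dT
  | apply (@D_trans G k); dT | apply (@D_opair G k); dT | apply (@D_related G k); dT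
  | apply (@D_ex_opair2 G k); [dT|dT|] | apply (@D_all_opair2 G k); [dT|dT|]
  | apply (@D_all_opair1 G k); [dT|dT|]
  | apply (@D_ex_related2 G k); [dT|dT|] | apply (@D_all_related2 G k); [dT|dT|]
  | apply (@D_all_related G k); [dT|] | apply (@D_ex_related G k); [dT|]
  | apply (@D_allin G k); [dT|] | apply (@D_exin G k); [dT|]
  | apply (@D_imp G k)
  | apply (@D_allsub G); [dT|] | apply (@D_exsub G); [dT|]
  | apply (@D_all G) | apply (@D_ex G) ]
  end.

Ltac dfn_hook := fail.
Ltac dfn := cbv beta; first
  [ assumption
  | dfn_hook; dfn
  | dapp; dfn
  | lazymatch goal with |- Dfn ?G ?k _ => apply (@D_ren G k); assumption end ].

(** * A weak base theory *)

(** The part of the theory that passes to the generic extension: each axiom is bounded or asks for a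
    witness of a bounded condition. Products are an axiom because there is no powerset from which to
    obtain them. *)
Record BST (M : structure) : Prop := {
  b_ext : extensionality M;
  b_pair : pairing M;
  b_empty : emptyset M;
  b_union : union M;
  b_prod : forall a b : M, exists p : M, forall z,
    z ∈ p <-> exists x, x ∈ a /\ exists y, y ∈ b /\ is_opair M z x y;
  b_sep : separation M Delta0;
  b_found : set_foundation M
}.

Lemma sep_def (M : structure) k : separation M (Gam k) -> forall (w : M) (P : M -> Prop),
  Dfn (fam1 M w) k (fun _ e => P (e 0)) -> exists y, forall x, x ∈ y <-> x ∈ w /\ P x.
Proof.
  intros HS w P HD.
  destruct (Dfn_bind (G := fam1 M w) (fun _ _ x => P x) HD) as [p [r [Gp [_ E]]]].
  destruct (HS p Gp (comb (fun _ => w) (r tt)) w) as [y Hy]; exists y; intros x.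
  rewrite Hy. specialize (E tt (fun _ => w) x); simpl in E; tauto.
Qed.

Lemma Dfn_bind2 (M : structure) k (w : M) (P : M -> M -> Prop) :
  Dfn (fam1 M w) k (fun _ e => P (e 1) (e 0)) ->
  exists p (rho : nat -> M), Gam k p /\ forall x y, P x y <-> sat (scons y (scons x rho)) p.
Proof.
  intros HD.
  destruct (Dfn_bind (G := fam1 M w) (fun _ e y => P (e 0) y) HD) as [p [r [Gp [_ E]]]].
  exists (ren (up (comb (scons 0 (fun i => S (2 * i))) (fun i => S (S (2 * i))))) p),
    (comb (fun _ => w) (r tt)); split; [apply Gam_ren; auto|].
  intros x y; rewrite sat_ren.
  specialize (E tt (scons x (fun _ => w)) y); simpl in E; rewrite E.
  apply sat_ext; intros [|i]; [reflexivity|]; simpl.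
  rewrite <- comb_scons; reflexivity.
Qed.

Lemma coll_def (M : structure) k : collection M (Gam k) -> forall (w : M) (P : M -> M -> Prop),
  Dfn (fam1 M w) k (fun _ e => P (e 1) (e 0)) ->
  (forall x, x ∈ w -> exists y, P x y) ->
  exists C : M, forall x, x ∈ w -> exists y, y ∈ C /\ P x y.
Proof.
  intros HS w P HD H.
  destruct (Dfn_bind2 _ _ _ _ HD) as [p [rho [Gp E]]].
  destruct (HS p Gp rho w) as [C HC].
  - intros x Hx; destruct (H x Hx) as [y Hy]; exists y; apply E, Hy.
  - exists C; intros x Hx; destruct (HC x Hx) as [y [Hy K]]; exists y; split; auto; apply E, K.
Qed.

Section BSTlemmas.
Context {M : structure} (HB : BST M).
Implicit Types a b c d p q r s x y z u v w : M.

Lemma ext x y : (forall z, z ∈ x <-> z ∈ y) -> x = y.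
Proof. apply (b_ext M HB). Qed.

Lemma sep w (P : M -> Prop) : Dfn (fam1 M w) KD0 (fun _ e => P (e 0)) ->
  exists y, forall x, x ∈ y <-> x ∈ w /\ P x.
Proof. apply (sep_def M KD0 (b_sep M HB)). Qed.

Lemma min_def w (P : M -> Prop) : Dfn (fam1 M w) KD0 (fun _ e => P (e 0)) ->
  (exists x, x ∈ w /\ P x) -> exists x, x ∈ w /\ P x /\ forall z, z ∈ x -> z ∈ w -> ~ P z.
Proof.
  intros HD [x Hx]; destruct (sep w P HD) as [y Hy].
  destruct (b_found M HB y) as [m [Hm K]].
  - intros E; apply (E x), Hy, Hx.
  - exists m; apply Hy in Hm; destruct Hm; repeat split; auto.
    intros z Hz Hw HP; apply (K z Hz), Hy; auto.
Qed.

Lemma mem_ind_in w (P : M -> Prop) : Dfn (fam1 M w) KD0 (fun _ e => P (e 0)) ->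
  (forall x, x ∈ w -> (forall z, z ∈ x -> z ∈ w -> P z) -> P x) -> forall x, x ∈ w -> P x.
Proof.
  intros HD H x Hx; apply NNPP; intros HN.
  destruct (min_def w (fun x => ~ P x)) as [m [Hm [K1 K2]]]; [apply D_not; auto|eauto|].
  apply K1, H; auto; intros z Hz Hw; apply NNPP, K2; auto.
Qed.

Lemma pair_ex a b : exists p, is_upair M p a b. Proof. apply (b_pair M HB). Qed.

Lemma upair_unique p q a b : is_upair M p a b -> is_upair M q a b -> p = q.
Proof. intros Hp Hq; apply ext; intros z; rewrite (Hp z), (Hq z); tauto. Qed.

Lemma opair_ex a b : exists p, is_opair M p a b.
Proof.
  destruct (pair_ex a a) as [s Hs], (pair_ex a b) as [u Hu], (pair_ex s u) as [p Hp].
  exists p, s, u; auto.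
Qed.

Lemma opair_unique p q a b : is_opair M p a b -> is_opair M q a b -> p = q.
Proof.
  intros [s [u [Hs [Hu Hp]]]] [s' [u' [Hs' [Hu' Hq]]]].
  rewrite (upair_unique _ _ _ _ Hs' Hs), (upair_unique _ _ _ _ Hu' Hu) in Hq.
  eapply upair_unique; eauto.
Qed.

Lemma opair_inj p a b c d : is_opair M p a b -> is_opair M p c d -> a = c /\ b = d.
Proof.
  intros [s [u [Hs [Hu Hp]]]] [s' [u' [Hs' [Hu' Hq]]]].
  assert (Eac : a = c).
  { assert (s ∈ p) by (apply Hp; auto). apply Hq in H.
    destruct H as [<-|E]; [assert (K : c ∈ s) by (apply Hs'; auto)|
      assert (K : c ∈ s) by (rewrite E; apply Hu'; auto)]; apply Hs in K;
      destruct K; auto. }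
  split; auto; subst c.
  assert (Es : s' = s) by (eapply upair_unique; eauto); subst s'.
  assert (Hb : b = a \/ b = d).
  { assert (E : u ∈ p) by (apply Hp; auto). apply Hq in E. destruct E as [E|E].
    - left. assert (K : b ∈ s) by (rewrite <- E; apply Hu; auto). apply Hs in K; destruct K; auto.
    - assert (K : b ∈ u') by (rewrite <- E; apply Hu; auto). apply Hu' in K; auto. }
  assert (Hd : d = a \/ d = b).
  { assert (E : u' ∈ p) by (apply Hq; auto). apply Hp in E. destruct E as [E|E].
    - left. assert (K : d ∈ s) by (rewrite <- E; apply Hu'; auto). apply Hs in K; destruct K; auto.
    - assert (K : d ∈ u) by (rewrite <- E; apply Hu'; auto). apply Hu in K; auto. }
  destruct Hb as [Hb|]; auto; destruct Hd as [Hd|]; congruence.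
Qed.

Lemma union2_ex a b : exists c, forall z, z ∈ c <-> z ∈ a \/ z ∈ b.
Proof.
  destruct (pair_ex a b) as [p Hp], (b_union M HB p) as [c Hc]; exists c; intros z.
  rewrite Hc; split.
  - intros [w [Hw Hz]]; apply Hp in Hw; destruct Hw; subst; auto.
  - intros [Hz|Hz]; [exists a|exists b]; split; auto; apply Hp; auto.
Qed.

Lemma adj_ex a b : exists c, forall z, z ∈ c <-> z ∈ a \/ z = b.
Proof.
  destruct (pair_ex b b) as [p Hp], (union2_ex a p) as [c Hc]; exists c; intros z.
  rewrite Hc, (Hp z); tauto.
Qed.

Lemma not_self x : ~ x ∈ x.
Proof.
  intros H; destruct (pair_ex x x) as [p Hp].
  destruct (b_found M HB p) as [y [Hy K]].
  - intros E; apply (E x), Hp; auto.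
  - apply Hp in Hy; assert (y = x) by tauto; subst; apply (K x); auto; apply Hp; auto.
Qed.

Lemma not_cyc x y : x ∈ y -> ~ y ∈ x.
Proof.
  intros H H'; destruct (pair_ex x y) as [p Hp].
  destruct (b_found M HB p) as [m [Hy K]].
  - intros E; apply (E x), Hp; auto.
  - apply Hp in Hy; destruct Hy; subst m; [apply (K y)|apply (K x)]; auto; apply Hp; auto.
Qed.

Lemma mkrel a b (P : M -> M -> Prop) : Dfn (fam1 M a) KD0 (fun _ e => P (e 1) (e 0)) ->
  exists r, (forall p, p ∈ r -> exists x, x ∈ a /\ exists y, y ∈ b /\ is_opair M p x y) /\
    forall x y, related M r x y <-> x ∈ a /\ y ∈ b /\ P x y.
Proof.
  intros HD; destruct (b_prod M HB a b) as [q Hq].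
  destruct (sep q (fun p => exists x, x ∈ a /\ exists y, is_opair M p x y /\ P x y)) as [r Hr].
  { change (Dfn (fam1 M a) KD0 (fun _ e =>
      exists x, x ∈ a /\ exists y, is_opair M (e 0) x y /\ P x y)).
    dapp; cbv beta; dapp; cbv beta; exact HD. }
  exists r; split.
  - intros p Hp; apply Hr in Hp; apply Hq; tauto.
  - intros x y; split.
    + intros [p [Hp Ho]]; apply Hr in Hp; destruct Hp as [Hp [x' [Hx' [y' [Ho' HP]]]]].
      apply Hq in Hp; destruct Hp as [x'' [? [y'' [? Ho'']]]].
      destruct (opair_inj _ _ _ _ _ Ho Ho'), (opair_inj _ _ _ _ _ Ho Ho''); subst; auto.
    + intros [Hx [Hy HP]]; destruct (opair_ex x y) as [p Hp]; exists p; split; auto.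
      apply Hr; split; [apply Hq; eauto|exists x; split; auto; exists y; auto].
Qed.

Lemma succ_inj x y z : is_succ M z x -> is_succ M z y -> x = y.
Proof.
  intros Hx Hy.
  assert (A : x ∈ y \/ x = y) by (apply Hy, Hx; auto).
  assert (B : y ∈ x \/ y = x) by (apply Hx, Hy; auto).
  destruct A; auto; destruct B; auto; exfalso; eapply not_cyc; eauto.
Qed.

Lemma succ_unique x y z : is_succ M x z -> is_succ M y z -> x = y.
Proof. intros Hx Hy; apply ext; intros u; rewrite (Hx u), (Hy u); tauto. Qed.

Lemma empty_unique x y : is_empty M x -> is_empty M y -> x = y.
Proof. intros Hx Hy; apply ext; intros z; split; intros Hz; [case (Hx z)|case (Hy z)]; auto. Qed.

End BSTlemmas.

Lemma Mac_BST (M : structure) : Mac M -> BST M.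
Proof.
  intros H; constructor; try apply H.
  intros a b.
  assert (U : forall a b : M, exists c, forall z, z ∈ c <-> z ∈ a \/ z ∈ b).
  { intros a' b'; destruct (Mac_pairing M H a' b') as [p Hp], (Mac_union M H p) as [c Hc];
      exists c; intros z; rewrite Hc; split.
    - intros [w [Hw Hz]]; apply Hp in Hw; destruct Hw; subst; auto.
    - intros [Hz|Hz]; [exists a'|exists b']; split; auto; apply Hp; auto. }
  destruct (U a b) as [c Hc], (Mac_powerset M H c) as [q Hq], (Mac_powerset M H q) as [Q HQ].
  destruct (sep_def M KD0 (Mac_separation M H) Q
    (fun z => exists x, x ∈ a /\ exists y, y ∈ b /\ is_opair M z x y)) as [p Hp]; [dfn|].
  exists p; intros z; rewrite Hp; split; [tauto|]; intros E; split; auto.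
  destruct E as [x [Hx [y [Hy [s [u [Hs [Hu Hz]]]]]]]].
  apply HQ; intros w Hw; apply Hq; intros v Hv; apply Hc.
  apply Hz in Hw; destruct Hw; subst w; [apply Hs in Hv|apply Hu in Hv]; destruct Hv; subst; auto.
Qed.

(** All variables are substituted at once, as the infinite assignments of [sat] require; choice
    gathers the constants among the terms into one sequence. *)
Lemma D_subst {G k} (P : forall j, (nat -> fS G j) -> Prop)
  (ts : nat -> forall j, (nat -> fS G j) -> fS G j) :
  Dfn G k P -> (forall i, IsT G (ts i)) -> Dfn G k (fun j e => P j (fun i => ts i j e)).
Proof.
  intros [p [r [Gp [C E]]]] HT.
  assert (K : exists idx : nat -> nat, exists a : nat -> forall j, fS G j,
    (forall i j, fC G j (a i j)) /\
    forall i j e, ts i j e = comb e (fun m => a m j) (idx i)).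
  { assert (H : forall i, exists na : nat * (forall j, fS G j),
      (forall j, fC G j (snd na j)) /\
      forall j e (c : nat -> forall j, fS G j), c i = snd na ->
        ts i j e = comb e (fun m => c m j) (fst na)).
    { intros i; destruct (HT i) as [[v H]|[a [Ha H]]].
      - exists (2 * v, fpt G); split; [intros; apply fCpt|].
        intros; rewrite H; unfold fst; rewrite comb_even; reflexivity.
      - exists (S (2 * i), a); split; [auto|].
        intros j e c Hc; rewrite H; unfold fst; rewrite comb_odd, Hc; reflexivity. }
    exists (fun i => fst (proj1_sig (constructive_indefinite_description _ (H i)))),
      (fun i => snd (proj1_sig (constructive_indefinite_description _ (H i)))).
    split; intros i; destruct (constructive_indefinite_description _ (H i)) as [na [H1 H2]] eqn:Ei;
      simpl; auto.
    intros j e; apply H2; rewrite Ei; reflexivity. }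
  destruct K as [idx [a [Ca Ea]]].
  exists (ren (comb (fun i => comb (fun i => 2 * i) (fun i => S (2 * (2 * i))) (idx i))
      (fun i => S (2 * S (2 * i)))) p), (fun j => comb (fun m => a m j) (r j)).
  split; [apply Gam_ren; auto|split; [intros j; apply (comb_C (fun j m => a m j)); auto|]].
  intros j e; rewrite E, sat_ren; apply sat_ext; intros m.
  destruct (even_odd_cases m) as [i [->| ->]]; rewrite ?comb_even, ?comb_odd.
  - rewrite Ea, comb_left; reflexivity.
  - rewrite ?comb_odd; reflexivity.
Qed.

Section Subst.
Context {G : fam} {k : kind} (t0 t1 t2 t3 : forall j, (nat -> fS G j) -> fS G j).
Hypothesis (H0 : IsT G t0) (H1 : IsT G t1) (H2 : IsT G t2) (H3 : IsT G t3).

Lemma D_sub2 (P : forall j, fS G j -> fS G j -> Prop) :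
  Dfn G k (fun j e => P j (e 1) (e 0)) -> Dfn G k (fun j e => P j (t1 j e) (t0 j e)).
Proof using H0 H1.
  intros HD; apply (D_subst _ (fun i => match i with 0 => t0 | _ => t1 end)) in HD; auto.
  intros [|i]; auto.
Qed.

Lemma D_sub3 (P : forall j, fS G j -> fS G j -> fS G j -> Prop) :
  Dfn G k (fun j e => P j (e 2) (e 1) (e 0)) ->
  Dfn G k (fun j e => P j (t2 j e) (t1 j e) (t0 j e)).
Proof using H0 H1 H2.
  intros HD; apply (D_subst _ (fun i => match i with 0 => t0 | 1 => t1 | _ => t2 end)) in HD; auto.
  intros [|[|i]]; auto.
Qed.

Lemma D_sub4 (P : forall j, fS G j -> fS G j -> fS G j -> fS G j -> Prop) :
  Dfn G k (fun j e => P j (e 3) (e 2) (e 1) (e 0)) ->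
  Dfn G k (fun j e => P j (t3 j e) (t2 j e) (t1 j e) (t0 j e)).
Proof using H0 H1 H2 H3.
  intros HD; apply (D_subst _ (fun i => match i with 0 => t0 | 1 => t1 | 2 => t2 | _ => t3 end))
    in HD; auto.
  intros [|[|[|i]]]; auto.
Qed.

Lemma D_dom : Dfn G k (fun j e => exists x, related (fS G j) (t0 j e) (t1 j e) x).
Proof using H0 H1.
  apply (D_ext _ (fun j e => exists x, related (fS G j) (t0 j e) (t1 j e) x /\ x = x)).
  - intros j e; split; [intros [x Hx]|intros [x [Hx _]]]; exists x; auto.
  - dapp; dapp.
Qed.
End Subst.

Tactic Notation "dx" uconstr(L) :=
  lazymatch goal with |- Dfn ?G ?k _ => apply (L G k) end.

(** * Recursion along a well-founded relation *)

(* [Gm F i x A]: "x is the value at i computed from the values of F below i", the set [A]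
   serving as a reservoir of witnesses. *)
Section Recursion.
Context {M : structure} (HB : BST M) (k : kind).
Context (HS : separation M (Gam k)) (HC : collection M (Gam k)).
Context (d : M) (lt : M -> M -> Prop) (Gm : M -> M -> M -> M -> Prop).
Context (Dlt : Dfn (fam1 M d) KD0 (fun _ e => lt (e 1) (e 0))).
Context (DGm : Dfn (fam1 M d) k (fun _ e => Gm (e 3) (e 2) (e 1) (e 0))).
Context (G_loc : forall F F' i x A, i ∈ d ->
  (forall l y, l ∈ d -> lt l i -> (related M F l y <-> related M F' l y)) ->
  Gm F i x A -> Gm F' i x A).
Context (G_mon : forall F i x A A', subset M A A' -> Gm F i x A -> Gm F i x A').
Context (G_uni : forall F i x x' A A', i ∈ d ->
  (forall l y y', related M F l y -> related M F l y' -> y = y') -> Gm F i x A -> Gm F i x' A' -> x = x').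
Context (G_tot : forall F i, i ∈ d -> (forall l, l ∈ d -> lt l i -> exists x, related M F l x) ->
  (forall l x x', related M F l x -> related M F l x' -> x = x') ->
  exists x A, Gm F i x A).
Context (wf : forall s, subset M s d -> ~ is_empty M s -> exists i, i ∈ s /\ forall l, l ∈ s -> ~ lt l i).

(** Attempts are partial functions whose domain is closed under predecessors, which is enough for
    any two of them to agree where both are defined. *)
Definition att (F A : M) : Prop := forall i x, related M F i x ->
  i ∈ d /\ (forall x', related M F i x' -> x' = x) /\
  (forall l, l ∈ d -> lt l i -> exists y, related M F l y) /\ Gm F i x A.

Definition att_at (i : M) : Prop := exists F A, att F A /\ exists x, related M F i x.

(** Induction for the class of i that have an attempt is a hypothesis because its source varies:
    [Sigma1]-separation for collapses and types, external induction along the standard ω for the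
    chain of levels. *)
Context (ind : (forall i, i ∈ d -> (forall l, l ∈ d -> lt l i -> att_at l) -> att_at i) ->
  forall i, i ∈ d -> att_at i).

Lemma D_att t1 t2 : IsT (fam1 M d) t1 -> IsT (fam1 M d) t2 ->
  Dfn (fam1 M d) k (fun j e => att (t1 j e) (t2 j e)).
Proof using DGm Dlt.
  intros; unfold att; dapp; cbv beta; dapp; [dfn|]; dapp; [dfn|]; dapp.
  - dapp; cbv beta; dapp; [|dx @D_dom; dT].
    apply D_kind; refine (@D_sub2 (fam1 M d) KD0 _ _ _ _ (fun _ => lt) Dlt); dT.
  - refine (@D_sub4 (fam1 M d) k _ _ _ _ _ _ _ _ (fun _ => Gm) DGm); dT.
Qed.

Lemma att_agree F A F' A' i x x' : att F A -> att F' A' ->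
  related M F i x -> related M F' i x' -> x = x'.
Proof using DGm Dlt G_loc G_mon G_tot G_uni HB wf.
  intros H H' Hx Hx'; apply NNPP; intros Hne.
  destruct (sep HB d (fun i => exists x, related M F i x /\
    exists x', related M F' i x' /\ ~ x = x')) as [s Hs]; [dfn|].
  destruct (wf s) as [m [Hm Hmin]].
  { intros z Hz; apply Hs in Hz; tauto. }
  { intros E; apply (E i), Hs; split; [apply (H _ _ Hx)|eauto]. }
  apply Hs in Hm; destruct Hm as [Hd [y [Hy [y' [Hy' Hn]]]]].
  destruct (H _ _ Hy) as [_ [F1 [F2 F3]]], (H' _ _ Hy') as [_ [F1' [F2' F3']]].
  apply Hn; eapply G_uni; [exact Hd| | |exact F3'].
  { intros l z z' Hz Hz'; symmetry; apply (H' _ _ Hz); auto. }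
  eapply G_loc; [exact Hd| |exact F3].
  intros l z Hl Hlt.
  destruct (F2 l Hl Hlt) as [u Hu], (F2' l Hl Hlt) as [u' Hu'].
  assert (u = u').
  { apply NNPP; intros Hu1; apply (Hmin l); auto; apply Hs; split; eauto. }
  subst u'; split; intros Hz.
  - replace z with u; auto; symmetry; apply (H _ _ Hu); auto.
  - replace z with u; auto; symmetry; apply (H' _ _ Hu'); auto.
Qed.

Lemma att_glue e0 : subset M e0 d -> (forall i, i ∈ e0 -> att_at i) ->
  exists F A, att F A /\ forall i, i ∈ e0 -> exists x, related M F i x.
Proof using DGm Dlt G_loc G_mon G_tot G_uni HB HC HS wf.
  intros He0 H.
  (* Collection is applied to the unordered pairs of an attempt and its reservoir; the resulting set
     may contain other things, so attempts are selected again afterwards. *)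
  destruct (coll_def M k HC e0 (fun i y => exists F, F ∈ y /\ exists A, A ∈ y /\
    att F A /\ exists x, related M F i x)) as [C HCC].
  { change (Dfn (fam1 M d) k (fun _ e => exists F, F ∈ e 0 /\ exists A, A ∈ e 0 /\
      att F A /\ exists x, related M F (e 1) x)).
    do 2 (dapp; cbv beta); dapp; [apply D_att; dT || auto|dx @D_dom; dT]. }
  { intros i Hi; destruct (H i Hi) as [F [A [HF Hx]]].
    destruct (pair_ex HB F A) as [y Hy]; exists y; exists F; split; [apply Hy; auto|].
    exists A; split; [apply Hy; auto|auto]. }
  (* V includes every collected attempt and every collected reservoir. It therefore serves both as
     the ambient set for the union of the attempts and as their common reservoir. *)
  destruct (b_union M HB C) as [U HU], (b_union M HB U) as [V HV].
  destruct (sep_def M k HS V (fun p => exists F, F ∈ U /\ exists A, A ∈ U /\ att F A /\ p ∈ F))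
    as [F HF].
  { change (Dfn (fam1 M d) k (fun _ e => exists F, F ∈ U /\ exists A, A ∈ U /\
      att F A /\ e 0 ∈ F)).
    do 2 (dapp; cbv beta); dapp; [apply D_att; dT || auto|dfn]. }
  assert (HR : forall i x, related M F i x <->
    exists F', F' ∈ U /\ exists A, A ∈ U /\ att F' A /\ related M F' i x).
  { intros i x; split.
    - intros [p [Hp Ho]]; apply HF in Hp; destruct Hp as [_ [F' [? [A [? [? ?]]]]]].
      exists F'; split; auto; exists A; split; auto; split; auto; exists p; auto.
    - intros [F' [HF' [A [HA [Hat [p [Hp Ho]]]]]]]; exists p; split; auto; apply HF.
      split; [apply HV; eauto|exists F'; split; auto; exists A; auto]. }
  exists F, V; split.
  - intros i x Hx; apply HR in Hx; destruct Hx as [F' [HF' [A [HA [Hat Hx]]]]].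
    destruct (Hat _ _ Hx) as [Hi [K1 [K2 K3]]]; split; auto; split; [|split].
    + intros x' Hx'; apply HR in Hx'; destruct Hx' as [F2 [_ [A2 [_ [Hat2 Hx2]]]]].
      symmetry; apply (att_agree F' A F2 A2 i); auto.
    + intros l Hl Hlt; destruct (K2 l Hl Hlt) as [y Hy]; exists y; apply HR; exists F'; split; auto; exists A; auto.
    + apply G_mon with A; [intros z Hz; apply HV; eauto|].
      eapply G_loc; [exact Hi| |exact K3]; intros l y Hl Hlt.
      destruct (K2 l Hl Hlt) as [u Hu]; split; intros Hy.
      * apply HR; exists F'; split; auto; exists A; auto.
      * apply HR in Hy; destruct Hy as [F2 [_ [A2 [_ [Hat2 Hy]]]]].
        replace y with u; auto; apply (att_agree F' A F2 A2 l); auto.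
  - intros i Hi; destruct (HCC i Hi) as [y [Hy [F' [HF' [A [HA [Hat [x Hx]]]]]]]].
    exists x; apply HR; exists F'; split; [apply HU; eauto|].
    exists A; split; [apply HU; eauto|auto].
Qed.

Lemma recursion : exists F A, att F A /\ forall i, i ∈ d -> exists x, related M F i x.
Proof using DGm Dlt G_loc G_mon G_tot G_uni HB HC HS wf ind.
  apply att_glue; [intros z; auto|]; apply ind; intros i Hi IH.
  destruct (sep HB d (fun l => lt l i)) as [e0 He0].
  { refine (@D_sub2 (fam1 M d) KD0 _ _ _ _ (fun _ => lt) Dlt); dT. }
  destruct (att_glue e0) as [F [A [HF Hdom]]].
  { intros z Hz; apply He0 in Hz; tauto. }
  { intros l Hl; apply He0 in Hl; apply IH; tauto. }
  destruct (classic (exists x, related M F i x)) as [Hx|Hx]; [exists F, A; auto|].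
  destruct (G_tot F i Hi) as [x [A' HG]].
  { intros l Hl Hlt; apply Hdom, He0; auto. }
  { intros l y y' Hy Hy'; destruct (HF _ _ Hy') as [_ [K _]]; auto. }
  destruct (opair_ex HB i x) as [p Hp], (adj_ex HB F p) as [F' HF'], (union2_ex HB A A') as [B HB'].
  assert (HR : forall l y, related M F' l y <-> related M F l y \/ (l = i /\ y = x)).
  { intros l y; split.
    - intros [q [Hq Ho]]; apply HF' in Hq; destruct Hq as [Hq| ->]; [left; exists q; auto|].
      right; eapply opair_inj; eauto.
    - intros [[q [Hq Ho]]|[-> ->]]; [exists q|exists p]; split; auto; apply HF'; auto. }
  assert (Hii : ~ lt i i).
  { intros Hlt; destruct (pair_ex HB i i) as [s Hs]; destruct (wf s) as [m [Hm Hmin]].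
    - intros z Hz; apply Hs in Hz; destruct Hz; subst; auto.
    - intros E; apply (E i), Hs; auto.
    - apply Hs in Hm; apply (Hmin i); [apply Hs; auto|destruct Hm; subst; auto]. }
  assert (Hloc : forall l y, l <> i -> (related M F l y <-> related M F' l y)).
  { intros l y Hl; rewrite HR; split; auto; intros [?|[? ?]]; auto; contradiction. }
  exists F', B; split; [|exists x; apply HR; auto].
  intros l y Hy; apply HR in Hy; destruct Hy as [Hy|[-> ->]].
  - destruct (HF _ _ Hy) as [Hl [K1 [K2 K3]]]; split; auto; split; [|split].
    + intros y' Hy'; apply HR in Hy'; destruct Hy' as [?|[-> ->]]; auto; case Hx; eauto.
    + intros m Hm Hlt; destruct (K2 m Hm Hlt) as [z Hz]; exists z; apply HR; auto.
    + apply G_mon with A; [intros z Hz; apply HB'; auto|].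
      eapply G_loc; [exact Hl| |exact K3]; intros m z Hm Hlt; apply Hloc.
      intros ->; apply Hx, K2; auto.
  - split; auto; split; [|split].
    + intros y' Hy'; apply HR in Hy'; destruct Hy' as [?|[_ ->]]; auto; case Hx; eauto.
    + intros m Hm Hlt; destruct (Hdom m) as [z Hz]; [apply He0; auto|exists z; apply HR; auto].
    + apply G_mon with A'; [intros z Hz; apply HB'; auto|].
      eapply G_loc; [exact Hi| |exact HG]; intros m z Hm Hlt; apply Hloc; intros ->; auto.
Qed.

End Recursion.

(** * Mostowski collapse *)

Section CollapseDefs.
Context (M : structure).
Implicit Types r v p : M.

Definition rel_on r v : Prop := ∀ p ∈ r, exists a, a ∈ v /\ exists b, b ∈ v /\ is_opair M p a b.

Definition wfrel r v : Prop := forall s : M, subset M s v -> ~ is_empty M s ->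
  exists i, i ∈ s /\ forall l, l ∈ s -> ~ related M r l i.

Definition coll_val p r v (i x : M) : Prop :=
  (forall z, z ∈ x -> exists l, l ∈ v /\ related M r l i /\ related M p l z) /\
  (forall l, l ∈ v -> related M r l i -> exists z, z ∈ x /\ related M p l z).

Definition collapse p r v : Prop :=
  (forall i, i ∈ v -> exists x, related M p i x) /\
  (forall i, i ∈ v -> forall x, related M p i x ->
    (forall x', related M p i x' -> x' = x) /\ coll_val p r v i x).

Definition AxHrel v (h : M) : Prop :=
  forall r, rel_on r v -> wfrel r v -> exists p, p ∈ h /\ collapse p r v.

Definition AxH : Prop := forall v, exists h, AxHrel v h.
End CollapseDefs.

Section CollapseDfn.
Context {G : fam} {k : kind} (t0 t1 t2 t3 t4 : forall j, (nat -> fS G j) -> fS G j).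
Hypothesis (H0 : IsT G t0) (H1 : IsT G t1) (H2 : IsT G t2) (H3 : IsT G t3) (H4 : IsT G t4).

Lemma D_rel_on : Dfn G k (fun j e => rel_on (fS G j) (t0 j e) (t1 j e)).
Proof using H0 H1. unfold rel_on; dfn. Qed.

Lemma D_coll_val : Dfn G k (fun j e =>
  coll_val (fS G j) (t0 j e) (t1 j e) (t2 j e) (t3 j e) (t4 j e)).
Proof using H0 H1 H2 H3 H4. unfold coll_val; dfn. Qed.
End CollapseDfn.

Lemma D_collapse {G k} t0 t1 t2 : IsT G t0 -> IsT G t1 -> IsT G t2 ->
  Dfn G k (fun j e => collapse (fS G j) (t0 j e) (t1 j e) (t2 j e)).
Proof.
  intros; unfold collapse; dapp.
  - dapp; dx @D_dom; dT.
  - do 3 dapp; [dfn|]; dx @D_coll_val; dT.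
Qed.

Lemma sep_sigma1 (M : structure) : separation M Sigma1 -> forall (w : M) (P : M -> M -> Prop),
  Dfn (fam1 M w) KD0 (fun _ e => P (e 1) (e 0)) ->
  exists y, forall x, x ∈ y <-> x ∈ w /\ exists u, P x u.
Proof.
  intros HS w P HD.
  destruct (Dfn_bind2 _ _ _ _ HD) as [p [rho [Gp E]]].
  destruct (HS (fEx p) (Sigma1_ex _ (Sigma1_Delta0 _ Gp)) rho w) as [y Hy]; exists y; intros x.
  rewrite Hy; split; intros [Hx [u Hu]]; split; auto; exists u; apply E; auto.
Qed.

(** [Sigma1]-separation makes P on d a set, so its complement in d is a set as well and has a
    minimal element if it is nonempty. *)
Lemma sigma1_induction (M : structure) (HB : BST M) (HS : separation M Sigma1)
  (d : M) (lt : M -> M -> Prop) (P : M -> Prop) (Q : M -> M -> Prop) :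
  (forall i, P i <-> exists u, Q i u) ->
  Dfn (fam1 M d) KD0 (fun _ e => Q (e 1) (e 0)) ->
  (forall s, subset M s d -> ~ is_empty M s -> exists i, i ∈ s /\ forall l, l ∈ s -> ~ lt l i) ->
  (forall i, i ∈ d -> (forall l, l ∈ d -> lt l i -> P l) -> P i) ->
  forall i, i ∈ d -> P i.
Proof.
  intros HP HD wf H i Hi; destruct (sep_sigma1 M HS d Q HD) as [X HX].
  destruct (sep HB d (fun i => ~ i ∈ X)) as [s Hs]; [dfn|].
  apply NNPP; intros HN.
  destruct (wf s) as [m [Hm K]].
  { intros z Hz; apply Hs in Hz; tauto. }
  { intros E; apply (E i), Hs; split; auto; rewrite HX; intros [_ K]; apply HN, HP, K. }
  apply Hs in Hm; destruct Hm as [Hm HmX]; apply HmX, HX; split; auto; apply HP, H; auto.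
  intros l Hl Hlt; apply HP; apply NNPP; intros HL; apply (K l); auto; apply Hs; split; auto.
  rewrite HX; tauto.
Qed.

Lemma att_at_sigma (M : structure) (HB : BST M) d lt Gm i : att_at (M := M) d lt Gm i <->
  exists u, exists F, F ∈ u /\ exists A, A ∈ u /\ att d lt Gm F A /\ exists x, related M F i x.
Proof.
  split; [|intros [u [F [_ [A [_ H]]]]]; exists F, A; auto].
  intros [F [A H]]; destruct (pair_ex HB F A) as [u Hu]; exists u, F; split; [apply Hu; auto|].
  exists A; split; [apply Hu; auto|auto].
Qed.

Lemma D_att_sigma (M : structure) k d lt Gm :
  Dfn (fam1 M d) KD0 (fun _ e => lt (e 1) (e 0)) ->
  Dfn (fam1 M d) k (fun _ e => Gm (e 3) (e 2) (e 1) (e 0)) ->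
  Dfn (fam1 M d) k (fun _ e => exists F, F ∈ e 0 /\ exists A, A ∈ e 0 /\
    att (M := M) d lt Gm F A /\ exists x, related M F (e 1) x).
Proof. intros; do 2 (dapp; cbv beta); dapp; [apply D_att; dT || auto|dx @D_dom; dT]. Qed.

Section Collapse.
Context {M : structure} (HB : BST M).
Implicit Types r v p : M.

Lemma collapse_unique p p' r v i x x' : wfrel M r v -> collapse M p r v -> collapse M p' r v ->
  i ∈ v -> related M p i x -> related M p' i x' -> x = x'.
Proof using HB.
  intros wf [_ H] [_ H'] Hi Hx Hx'; apply NNPP; intros Hne.
  destruct (sep HB v (fun i => exists x, related M p i x /\
    exists x', related M p' i x' /\ ~ x = x')) as [s Hs]; [dfn|].
  destruct (wf s) as [m [Hm Hmin]].
  { intros z Hz; apply Hs in Hz; tauto. }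
  { intros E; apply (E i), Hs; split; eauto. }
  apply Hs in Hm; destruct Hm as [Hd [y [Hy [y' [Hy' Hn]]]]]; apply Hn.
  destruct (H _ Hd _ Hy) as [_ [A1 A2]], (H' _ Hd _ Hy') as [_ [A1' A2']].
  apply (ext HB); intros z; split; intros Hz.
  - destruct (A1 z Hz) as [l [Hl [Hr Hz']]]; destruct (A2' l Hl Hr) as [z' [Hz1 Hz2]].
    replace z with z'; auto; apply NNPP; intros HN; apply (Hmin l); auto; apply Hs; split; auto.
    exists z; split; auto; exists z'; split; auto.
  - destruct (A1' z Hz) as [l [Hl [Hr Hz']]]; destruct (A2 l Hl Hr) as [z' [Hz1 Hz2]].
    replace z with z'; auto; apply NNPP; intros HN; apply (Hmin l); auto; apply Hs; split; auto.
    exists z'; split; auto; exists z; split; auto.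
Qed.

Lemma range_ex (F : M) : exists R, forall i z, related M F i z -> z ∈ R.
Proof using HB.
  destruct (b_union M HB F) as [U HU], (b_union M HB U) as [V HV]; exists V.
  intros i z [p [Hp Ho]]; destruct (is_opair_union _ _ _ _ Ho) as [u [Hu [_ Hz]]].
  apply HV; exists u; split; auto; apply HU; eauto.
Qed.

Lemma collapse_ex r v : separation M Sigma1 -> collection M Delta0 ->
  wfrel M r v -> exists p, collapse M p r v.
Proof using HB.
  intros HS HC wf.
  set (lt := fun l i : M => related M r l i).
  set (Gm := fun F i x A : M => coll_val M F r v i x).
  assert (Dlt : Dfn (fam1 M v) KD0 (fun _ e => lt (e 1) (e 0))) by (unfold lt; dfn).
  assert (DGm : Dfn (fam1 M v) KD0 (fun _ e => Gm (e 3) (e 2) (e 1) (e 0)))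
    by (unfold Gm; apply (D_coll_val (G := fam1 M v)); dT).
  destruct (recursion HB KD0 (b_sep M HB) HC v lt Gm) as [F [A [HF Hdom]]]; auto.
  - intros F F' i x A0 Hi Hag [A1 A2]; split.
    + intros z Hz; destruct (A1 z Hz) as [l [Hl [Hr Hz']]]; exists l; repeat split; auto.
      apply Hag; auto.
    + intros l Hl Hr; destruct (A2 l Hl Hr) as [z [Hz Hz']]; exists z; split; auto; apply Hag; auto.
  - intros F i x x' A0 A0' Hi Hfun [A1 A2] [A1' A2']; apply (ext HB); intros z; split; intros Hz.
    + destruct (A1 z Hz) as [l [Hl [Hr Hz']]], (A2' l Hl Hr) as [z' [Hz1 Hz2]].
      rewrite (Hfun _ _ _ Hz' Hz2); auto.
    + destruct (A1' z Hz) as [l [Hl [Hr Hz']]], (A2 l Hl Hr) as [z' [Hz1 Hz2]].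
      rewrite (Hfun _ _ _ Hz' Hz2); auto.
  - intros F i Hi Hd Hfun; destruct (range_ex F) as [R HR].
    destruct (sep HB R (fun z => exists l, l ∈ v /\ related M r l i /\ related M F l z)) as [x Hx];
      [dfn|].
    exists x, x; split; [intros z Hz; apply Hx in Hz; tauto|].
    intros l Hl Hr; destruct (Hd l Hl Hr) as [z Hz]; exists z; split; auto; apply Hx; split; eauto.
  - apply (sigma1_induction M HB HS v lt) with (Q := fun i u => exists F, F ∈ u /\
      exists A, A ∈ u /\ att v lt Gm F A /\ exists x, related M F i x); auto.
    + intros i; apply att_at_sigma; auto.
    + apply D_att_sigma; auto.
  - exists F; split; auto; intros i Hi x Hx; destruct (HF _ _ Hx) as [_ [K1 [_ K2]]]; auto.
Qed.
End Collapse.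

Lemma MOST_AxH (M : structure) : MOST M -> AxH M.
Proof.
  intros H; pose proof (MOST_Mac M H) as HM; pose proof (Mac_BST M HM) as HB; intros v.
  destruct (b_prod M HB v v) as [q Hq], (Mac_powerset M HM q) as [Q HQ].
  destruct (Mac_powerset M HM v) as [Pv HPv].
  (* With the powerset of v as a parameter, well-foundedness becomes [Delta0], as the available
     collection demands. The same device recurs in later proofs. *)
  assert (wfE : forall r, wfrel M r v <-> forall s, s ∈ Pv -> ~ is_empty M s ->
    exists i, i ∈ s /\ forall l, l ∈ s -> ~ related M r l i).
  { intros r; split; intros K s Hs; apply K; apply HPv; auto. }
  destruct (coll_def M KD0 (MOST_collection M H) Q (fun r p =>
    (forall s, s ∈ Pv -> ~ is_empty M s ->
      exists i, i ∈ s /\ forall l, l ∈ s -> ~ related M r l i) -> collapse M p r v)) as [h Hh].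
  - dapp; [dfn|]; apply (D_collapse (G := fam1 M Q)); dT.
  - intros r Hr; destruct (classic (wfrel M r v)) as [K|K].
    + destruct (collapse_ex HB r v) as [p Hp]; auto; try apply H; exists p; auto.
    (* Relations that are not well-founded get an arbitrary value. *)
    + exists r; intros K'; apply wfE in K'; contradiction.
  - exists h; intros r Hr Hw; destruct (Hh r) as [p [Hp K]].
    + apply HQ; intros z Hz; apply Hq, Hr, Hz.
    + exists p; split; auto; apply K, wfE, Hw.
Qed.

(** * Numerals, finite blocks of quantifiers *)

Section Numerals.
Context {M : structure} (HB : BST M).

Lemma succ_ex (x : M) : exists y, is_succ M y x.
Proof using HB. destruct (adj_ex HB x x) as [y Hy]; exists y; exact Hy. Qed.

Fixpoint num (n : nat) : M :=
  match n with
  | 0 => proj1_sig (constructive_indefinite_description _ (b_empty M HB))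
  | S n => proj1_sig (constructive_indefinite_description _ (succ_ex (num n)))
  end.

Lemma num_0 : is_empty M (num 0).
Proof using. simpl; destruct constructive_indefinite_description; auto. Qed.

Lemma num_S n : is_succ M (num (S n)) (num n).
Proof using. simpl; destruct constructive_indefinite_description; auto. Qed.

Lemma num_inj n : forall m, num n = num m -> n = m.
Proof using.
  induction n; intros [|m] H; auto.
  - exfalso; apply (num_0 (num m)); rewrite H; apply num_S; auto.
  - exfalso; apply (num_0 (num n)); rewrite <- H; apply num_S; auto.
  - f_equal; apply IHn; apply (succ_inj HB _ _ (num (S n))); [apply num_S|].
    rewrite H; apply num_S.
Qed.

Definition inductive_set (om : M) : Prop :=
  (∃ y ∈ om, is_empty M y) /\ (∀ y ∈ om, ∃ z ∈ om, is_succ M z y).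

Lemma num_in (om : M) n : inductive_set om -> num n ∈ om.
Proof using.
  intros [[y [Hy He]] Hs]; induction n.
  - rewrite (empty_unique HB _ _ num_0 He); auto.
  - destruct (Hs _ IHn) as [z [Hz K]]; rewrite (succ_unique HB _ _ _ (num_S n) K); auto.
Qed.
End Numerals.

Definition pre {A : Type} (k : nat) (c e : nat -> A) (i : nat) : A :=
  if i <? k then c i else e (i - k).

(** The external function c stands for a block of k bounded quantifiers, with bounds and side
    conditions evaluated in the outer environment. It expresses statements about tuples whose length
    is an external number. *)
Lemma D_EX {G kd} k : forall (T : nat -> forall j, (nat -> fS G j) -> fS G j)
  (R : nat -> forall j, (nat -> fS G j) -> fS G j -> Prop) (Q : forall j, (nat -> fS G j) -> Prop),
  (forall i, IsT G (T i)) ->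
  (forall i, Dfn G kd (fun j e => R i j (fun n => e (S n)) (e 0))) -> Dfn G kd Q ->
  Dfn G kd (fun j e => exists c : nat -> fS G j,
    (forall i, i < k -> mem (c i) (T i j e) /\ R i j e (c i)) /\ Q j (pre k c e)).
Proof.
  induction k; intros T R Q HT HR HQ.
  - apply (D_ext _ Q); auto.
    assert (E : forall j (c e : nat -> fS G j), pre 0 c e = e).
    { intros; apply functional_extensionality; intros i; unfold pre; simpl; f_equal; lia. }
    intros j e; split; [intros [c [_ H]]; rewrite E in H; auto|].
    intros H; exists e; rewrite E; split; auto; intros; lia.
  - apply (D_ext _ (fun j e => exists x, mem x (T k j e) /\ (R k j e x /\
      exists c : nat -> fS G j, (forall i, i < k -> mem (c i) (T i j e) /\ R i j e (c i)) /\
        Q j (pre k c (scons x e))))).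
    + intros j e; split.
      * intros [c [H1 H2]]; exists (c k); split; [apply H1; lia|]; split; [apply H1; lia|].
        exists c; split; [intros; apply H1; lia|].
        replace (pre k c (scons (c k) e)) with (pre (S k) c e); auto.
        apply functional_extensionality; intros i; unfold pre.
        destruct (Nat.ltb_spec i (S k)), (Nat.ltb_spec i k); auto; try lia.
        -- replace (i - k) with 0 by lia; replace i with k by lia; auto.
        -- replace (i - k) with (S (i - S k)) by lia; auto.
      * intros [x [H1 [H2 [c [H3 H4]]]]].
        exists (fun i => if i <? k then c i else x); split.
        -- intros i Hi; destruct (Nat.ltb_spec i k); [auto|replace i with k by lia; auto].
        -- match type of H4 with Q j ?a => match goal with |- Q j ?b => replace b with a; auto end end.
           apply functional_extensionality; intros i; unfold pre.
           destruct (Nat.ltb_spec i (S k)), (Nat.ltb_spec i k); auto; try lia.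
           ++ replace (i - k) with 0 by lia; auto.
           ++ replace (i - k) with (S (i - S k)) by lia; auto.
    + apply D_exin; auto. apply D_and; auto.
      specialize (IHk (fun i j e => T i j (fun n => e (S n)))
        (fun i j e x => R i j (fun n => e (S n)) x) Q).
      eapply D_ext; [|apply IHk; auto].
      * intros j e; cbv beta; rewrite scons_eta; reflexivity.
      * intros i; apply IsT_shift; auto.
      * intros i; apply (D_ren _ (fun i => match i with 0 => 0 | S i => S (S i) end) (HR i)).
Qed.

(** * Term codes *)

(* Codes of terms over [s] are subsets of [q = P(om) × s].  Two codes are paired by tagging
   the first coordinates: A ↦ A+1 for the left one and A ↦ {0} ∪ (A+1) for the right one. *)
Section Codes.
Context {M : structure} (HB : BST M) (om Pom s q v : M).
Context (Hom : inductive_set om) (HPom : forall A, A ∈ Pom <-> subset M A om).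
Context (Hs : subset M om s).
Context (Hq : forall p, p ∈ q <-> exists A, A ∈ Pom /\ exists x, x ∈ s /\ is_opair M p A x).
Context (Hv : forall z, subset M z q -> z ∈ v).

Definition sh0 (A' A : M) : Prop :=
  (∀ z ∈ A', ∃ n ∈ A, is_succ M z n) /\ (∀ n ∈ A, ∃ z ∈ A', is_succ M z n).
Definition sh1 (A' A : M) : Prop :=
  (∃ z ∈ A', is_empty M z) /\ (∀ z ∈ A', is_empty M z \/ ∃ n ∈ A, is_succ M z n) /\
  (∀ n ∈ A, ∃ z ∈ A', is_succ M z n).

Lemma sh0_ex A : A ∈ Pom -> exists A', A' ∈ Pom /\ sh0 A' A.
Proof using HB HPom Hom.
  intros HA; destruct (sep HB om (fun z => exists n, n ∈ A /\ is_succ M z n)) as [A' H]; [dfn|].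
  exists A'; split; [apply HPom; intros z Hz; apply H in Hz; tauto|split].
  - intros z Hz; apply H in Hz; tauto.
  - intros n Hn; destruct (proj2 Hom n) as [z [Hz K]]; [apply (HPom A); auto|].
    exists z; split; auto; apply H; eauto.
Qed.

Lemma sh1_ex A : A ∈ Pom -> exists A', A' ∈ Pom /\ sh1 A' A.
Proof using HB HPom Hom.
  intros HA; destruct (sep HB om (fun z => is_empty M z \/ exists n, n ∈ A /\ is_succ M z n))
    as [A' H]; [dfn|].
  exists A'; split; [apply HPom; intros z Hz; apply H in Hz; tauto|split; [|split]].
  - destruct (proj1 Hom) as [z [Hz K]]; exists z; split; auto; apply H; auto.
  - intros z Hz; apply H in Hz; tauto.
  - intros n Hn; destruct (proj2 Hom n) as [z [Hz K]]; [apply (HPom A); auto|].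
    exists z; split; auto; apply H; eauto.
Qed.

Lemma succ_nonempty z n : is_succ M z n -> ~ is_empty M z.
Proof using. intros H E; apply (E n), H; auto. Qed.

Lemma sh0_inj A' A B : sh0 A' A -> sh0 A' B -> A = B.
Proof using HB.
  intros [H1 H2] [K1 K2]; apply (ext HB); intros n; split; intros Hn.
  - destruct (H2 n Hn) as [z [Hz E]], (K1 z Hz) as [m [Hm E']].
    rewrite (succ_inj HB _ _ _ E E'); auto.
  - destruct (K2 n Hn) as [z [Hz E]], (H1 z Hz) as [m [Hm E']].
    rewrite (succ_inj HB _ _ _ E E'); auto.
Qed.

Lemma sh1_inj A' A B : sh1 A' A -> sh1 A' B -> A = B.
Proof using HB.
  intros [_ [H1 H2]] [_ [K1 K2]]; apply (ext HB); intros n; split; intros Hn.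
  - destruct (H2 n Hn) as [z [Hz E]], (K1 z Hz) as [E0|[m [Hm E']]];
      [case (succ_nonempty _ _ E E0)|rewrite (succ_inj HB _ _ _ E E'); auto].
  - destruct (K2 n Hn) as [z [Hz E]], (H1 z Hz) as [E0|[m [Hm E']]];
      [case (succ_nonempty _ _ E E0)|rewrite (succ_inj HB _ _ _ E E'); auto].
Qed.

Lemma sh01 A' A B : sh0 A' A -> sh1 A' B -> False.
Proof using.
  intros [H1 _] [[z [Hz E]] _]; destruct (H1 z Hz) as [n [_ K]]; case (succ_nonempty _ _ K E).
Qed.

Definition cpair (Z X Y : M) : Prop := subset M Z q /\
  ∀ A ∈ Pom, ∀ x ∈ s, ∀ A' ∈ Pom,
    (sh0 A' A -> (related M Z A' x <-> related M X A x)) /\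
    (sh1 A' A -> (related M Z A' x <-> related M Y A x)).

Lemma cpair_ex X Y : exists Z, Z ∈ v /\ cpair Z X Y.
Proof using HB Hq Hv.
  destruct (sep HB q (fun p => exists A', A' ∈ Pom /\ exists x, x ∈ s /\ is_opair M p A' x /\
    exists A, A ∈ Pom /\ (((∀ z ∈ A', ∃ n ∈ A, is_succ M z n) /\ (∀ n ∈ A, ∃ z ∈ A', is_succ M z n))
        /\ related M X A x \/
      ((∃ z ∈ A', is_empty M z) /\ (∀ z ∈ A', is_empty M z \/ ∃ n ∈ A, is_succ M z n) /\
  (∀ n ∈ A, ∃ z ∈ A', is_succ M z n)) /\ related M Y A x))) as [Z HZ]; [dfn|].
  assert (Zq : subset M Z q) by (intros z Hz; apply HZ in Hz; tauto).
  exists Z; split; [apply Hv, Zq|]; split; auto.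
  assert (K : forall A' x, A' ∈ Pom -> x ∈ s -> (related M Z A' x <-> exists A, A ∈ Pom /\
    (sh0 A' A /\ related M X A x \/ sh1 A' A /\ related M Y A x))).
  { intros A' x HA' Hx; split.
    - intros [p [Hp Ho]]; apply HZ in Hp; destruct Hp as [_ [A1 [_ [x1 [_ [Ho1 K]]]]]].
      destruct (opair_inj HB _ _ _ _ _ Ho Ho1); subst; exact K.
    - intros K; destruct (opair_ex HB A' x) as [p Ho]; exists p; split; auto; apply HZ.
      split; [apply Hq; eauto|exists A'; split; auto; exists x; auto]. }
  intros A HA x Hx A' HA'; rewrite (K A' x) by auto; split; intros Hsh; split.
  - intros [B [HBo [[E R]|[E R]]]]; [rewrite (sh0_inj _ _ _ Hsh E); auto|case (sh01 _ _ _ Hsh E)].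
  - intros R; exists A; auto.
  - intros [B [HBo [[E R]|[E R]]]]; [case (sh01 _ _ _ E Hsh)|rewrite (sh1_inj _ _ _ Hsh E); auto].
  - intros R; exists A; auto.
Qed.

Lemma code_ext X Y : subset M X q -> subset M Y q ->
  (∀ A ∈ Pom, ∀ x ∈ s, (related M X A x <-> related M Y A x)) -> X = Y.
Proof using HB Hq.
  intros HX HY H; apply (ext HB); intros p; split; intros Hp.
  - destruct (proj1 (Hq p) (HX p Hp)) as [A [HA [x [Hx Ho]]]].
    destruct (proj1 (H A HA x Hx)) as [p' [Hp' Ho']]; [exists p; auto|].
    rewrite (opair_unique HB _ _ _ _ Ho Ho'); auto.
  - destruct (proj1 (Hq p) (HY p Hp)) as [A [HA [x [Hx Ho]]]].
    destruct (proj2 (H A HA x Hx)) as [p' [Hp' Ho']]; [exists p; auto|].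
    rewrite (opair_unique HB _ _ _ _ Ho Ho'); auto.
Qed.

Lemma cpair_inj Z X Y X' Y' : subset M X q -> subset M Y q -> subset M X' q -> subset M Y' q ->
  cpair Z X Y -> cpair Z X' Y' -> X = X' /\ Y = Y'.
Proof using HB HPom Hom Hq.
  intros HX HY HX' HY' [_ H] [_ H']; split; apply code_ext; auto; intros A HA x Hx.
  - destruct (sh0_ex A HA) as [A' [HA' E]].
    destruct (H A HA x Hx A' HA') as [K _], (H' A HA x Hx A' HA') as [K' _].
    rewrite <- (K E), <- (K' E); tauto.
  - destruct (sh1_ex A HA) as [A' [HA' E]].
    destruct (H A HA x Hx A' HA') as [_ K], (H' A HA x Hx A' HA') as [_ K'].
    rewrite <- (K E), <- (K' E); tauto.
Qed.

Definition cbase (Z x : M) : Prop :=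
  subset M Z q /\ (∀ p ∈ Z, is_opair M p (num HB 0) x) /\ ∃ p ∈ Z, is_opair M p (num HB 0) x.

Lemma cbase_ex x : x ∈ s -> exists Z, Z ∈ v /\ cbase Z x.
Proof using HB HPom Hom Hq Hv.
  intros Hx; destruct (opair_ex HB (num HB 0) x) as [p Hp], (pair_ex HB p p) as [Z HZ].
  assert (K : subset M Z q).
  { intros z Hz; apply HZ in Hz; assert (z = p) by tauto; subst z; apply Hq.
    exists (num HB 0); split; [|eauto].
    apply HPom; intros u Hu; case (num_0 HB u Hu). }
  exists Z; split; [apply Hv, K|]; split; auto; split.
  - intros z Hz; apply HZ in Hz; assert (z = p) by tauto; subst z; auto.
  - exists p; split; auto; apply HZ; auto.
Qed.

Lemma cbase_inj Z x y : cbase Z x -> cbase Z y -> x = y.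
Proof using. intros [_ [_ [p [Hp H]]]] [_ [K _]]; apply (opair_inj HB _ _ _ _ _ H (K p Hp)). Qed.

(** The first component is a tag: 0 for a generator, n+1 for the n-th operation. Injectivity of
    pairing then gives unique readability of codes. *)
Definition code0 (Z x : M) : Prop :=
  ∃ Z1 ∈ v, ∃ Z2 ∈ v, cbase Z1 (num HB 0) /\ cbase Z2 x /\ cpair Z Z1 Z2.
Definition code1 (n : nat) (Z X Y : M) : Prop := (subset M X q /\ subset M Y q) /\
  ∃ Z1 ∈ v, ∃ Z2 ∈ v, cbase Z1 (num HB (S n)) /\ cpair Z2 X Y /\ cpair Z Z1 Z2.

Lemma code0_ex x : x ∈ s -> exists Z, Z ∈ v /\ subset M Z q /\ code0 Z x.
Proof using HB HPom Hom Hq Hs Hv.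
  intros Hx; destruct (cbase_ex (num HB 0)) as [Z1 [H1 K1]]; [apply Hs, num_in, Hom|].
  destruct (cbase_ex x Hx) as [Z2 [H2 K2]], (cpair_ex Z1 Z2) as [Z [HZ K]].
  exists Z; split; auto; split; [apply K|]; exists Z1; split; auto; exists Z2; auto.
Qed.

Lemma code1_ex n X Y : subset M X q -> subset M Y q ->
  exists Z, Z ∈ v /\ subset M Z q /\ code1 n Z X Y.
Proof using HB HPom Hom Hq Hs Hv.
  intros HX HY; destruct (cbase_ex (num HB (S n))) as [Z1 [H1 K1]]; [apply Hs, num_in, Hom|].
  destruct (cpair_ex X Y) as [Z2 [H2 K2]], (cpair_ex Z1 Z2) as [Z [HZ K]].
  exists Z; split; auto; split; [apply K|]; split; auto; exists Z1; split; auto; exists Z2; auto.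
Qed.

Lemma code0_inj Z x y : code0 Z x -> code0 Z y -> x = y.
Proof using HB HPom Hom Hq.
  intros [Z1 [_ [Z2 [_ [H1 [H2 H]]]]]] [Z1' [_ [Z2' [_ [H1' [H2' H']]]]]].
  apply (cpair_inj Z Z1 Z2 Z1' Z2') in H; auto; [|apply H1|apply H2|apply H1'|apply H2'].
  destruct H as [-> ->]; eapply cbase_inj; eauto.
Qed.

Lemma code1_inj n m Z X Y X' Y' : code1 n Z X Y -> code1 m Z X' Y' -> n = m /\ X = X' /\ Y = Y'.
Proof using HB HPom Hom Hq.
  intros [[HX HY] [Z1 [_ [Z2 [_ [H1 [H2 H]]]]]]] [[HX' HY'] [Z1' [_ [Z2' [_ [H1' [H2' H']]]]]]].
  apply (cpair_inj Z Z1 Z2 Z1' Z2') in H; auto; [|apply H1|apply H2|apply H1'|apply H2'].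
  destruct H as [-> ->]; apply (cpair_inj Z2' X Y X' Y') in H2; auto; destruct H2.
  split; auto; pose proof (cbase_inj _ _ _ H1 H1') as E; apply num_inj in E; lia.
Qed.

Lemma code01 n Z x X Y : code0 Z x -> code1 n Z X Y -> False.
Proof using HB HPom Hom Hq.
  intros [Z1 [_ [Z2 [_ [H1 [H2 H]]]]]] [[HX' HY'] [Z1' [_ [Z2' [_ [H1' [H2' H']]]]]]].
  apply (cpair_inj Z Z1 Z2 Z1' Z2') in H; auto; [|apply H1|apply H2|apply H1'|apply H2'].
  destruct H as [-> ->]; pose proof (cbase_inj _ _ _ H1 H1') as E; apply num_inj in E; lia.
Qed.

Context (U : M) (Bs : M -> M -> Prop) (ops : list (M -> M -> M -> Prop)).
Context (DBs : Dfn (fam1 M s) KD0 (fun _ e => Bs (e 1) (e 0))).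
Context (Dops : forall o, In o ops -> Dfn (fam1 M s) KD0 (fun _ e => o (e 2) (e 1) (e 0))).
Context (fBs : forall x a b, a ∈ U -> b ∈ U -> Bs x a -> Bs x b -> a = b).
Context (fops : forall o, In o ops -> forall a b c c', a ∈ U -> b ∈ U -> c ∈ U -> c' ∈ U ->
  o a b c -> o a b c' -> c = c').

(** The finite list of operations is unfolded into a disjunction, which keeps the predicate
    first-order; [~ c = c] is falsity in a form with an evident definition. *)
Fixpoint OPS (n : nat) (l : list (M -> M -> M -> Prop)) (c X Y a b d : M) : Prop :=
  match l with
  | nil => ~ c = c
  | o :: l => (code1 n c X Y /\ o a b d) \/ OPS (S n) l c X Y a b d
  end.

Lemma OPS_inv l : forall n c X Y a b d, OPS n l c X Y a b d ->
  exists i o, nth_error l i = Some o /\ code1 (n + i) c X Y /\ o a b d.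
Proof using.
  induction l as [|o l IH]; simpl; intros n c X Y a b d H; [contradiction|].
  destruct H as [[H1 H2]|H].
  - exists 0, o; rewrite Nat.add_0_r; auto.
  - destruct (IH _ _ _ _ _ _ _ H) as [i [o' [E K]]]; exists (S i), o'; split; auto.
    replace (n + S i) with (S n + i) by lia; auto.
Qed.

Lemma OPS_intro l : forall n i o c X Y a b d, nth_error l i = Some o -> code1 (n + i) c X Y ->
  o a b d -> OPS n l c X Y a b d.
Proof using.
  induction l as [|o l IH]; intros n [|i] o' c X Y a b d E H1 H2; simpl in *; try discriminate.
  - injection E as <-; rewrite Nat.add_0_r in H1; auto.
  - right; apply (IH (S n) i o'); auto; replace (S n + i) with (n + S i) by lia; auto.
Qed.

Lemma D_code1 n t0 t1 t2 : IsT (fam1 M s) t0 -> IsT (fam1 M s) t1 -> IsT (fam1 M s) t2 ->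
  Dfn (fam1 M s) KD0 (fun j e => code1 n (t0 j e) (t1 j e) (t2 j e)).
Proof using. intros; unfold code1, cbase, cpair, sh0, sh1; dfn. Qed.

Lemma D_code0 t0 t1 : IsT (fam1 M s) t0 -> IsT (fam1 M s) t1 ->
  Dfn (fam1 M s) KD0 (fun j e => code0 (t0 j e) (t1 j e)).
Proof using. intros; unfold code0, cbase, cpair, sh0, sh1; dfn. Qed.

Lemma D_OPS t0 t1 t2 t3 t4 t5 : IsT (fam1 M s) t0 -> IsT (fam1 M s) t1 -> IsT (fam1 M s) t2 ->
  IsT (fam1 M s) t3 -> IsT (fam1 M s) t4 -> IsT (fam1 M s) t5 -> forall l n,
  (forall o, In o l -> Dfn (fam1 M s) KD0 (fun _ e => o (e 2) (e 1) (e 0))) ->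
  Dfn (fam1 M s) KD0 (fun j e =>
    OPS n l (t0 j e) (t1 j e) (t2 j e) (t3 j e) (t4 j e) (t5 j e)).
Proof using.
  intros H0 H1 H2 H3 H4 H5 l; induction l as [|o l IH]; intros n Hl; simpl; [dfn|].
  apply D_or; [apply D_and|apply IH; intros; apply Hl; simpl; auto].
  - apply D_code1; auto.
  - refine (@D_sub3 (fam1 M s) KD0 _ _ _ _ _ _ (fun _ => o) (Hl o _)); auto; simpl; auto.
Qed.

Definition hull_closed (Z : M) : Prop :=
  (∀ x ∈ s, ∀ a ∈ U, ∀ c ∈ v, Bs x a -> code0 c x -> related M Z c a) /\
  (∀ X ∈ v, ∀ Y ∈ v, ∀ a ∈ U, ∀ b ∈ U, ∀ d ∈ U, ∀ c ∈ v,
    related M Z X a -> related M Z Y b -> OPS 0 ops c X Y a b d -> related M Z c d).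

Lemma D_hull_closed t0 : IsT (fam1 M s) t0 ->
  Dfn (fam1 M s) KD0 (fun j e => hull_closed (t0 j e)).
Proof using DBs Dops.
  intros; unfold hull_closed; dapp; repeat (dapp; cbv beta).
  - refine (@D_sub2 (fam1 M s) KD0 _ _ _ _ (fun _ => Bs) DBs); dT.
  - apply D_OPS; dT || auto.
Qed.

Hypothesis (HPow : powerset M).

(** Gr evaluates codes. It is the intersection of all closed subsets of v × U; unique readability
    makes it a function. *)
Lemma hull : exists Gr : M,
  (forall c a, related M Gr c a -> c ∈ v /\ a ∈ U) /\
  (forall c a b, related M Gr c a -> related M Gr c b -> a = b) /\
  (forall x a, x ∈ s -> a ∈ U -> Bs x a -> exists c, related M Gr c a) /\
  (forall o, In o ops -> forall X Y a b d, related M Gr X a -> related M Gr Y b -> d ∈ U ->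
    o a b d -> exists c, related M Gr c d).
Proof using DBs Dops fBs fops HB HPom Hom Hq Hs Hv HPow.
  destruct (b_prod M HB v U) as [Q HQ], (HPow Q) as [PQ HPQ].
  destruct (sep HB Q (fun p => ∀ Z ∈ PQ, hull_closed Z -> p ∈ Z)) as [Gr HG].
  { change (Dfn (fam1 M s) KD0 (fun _ e => ∀ Z ∈ PQ, hull_closed Z -> e 0 ∈ Z)).
    dapp; cbv beta; dapp; [apply D_hull_closed; dT|dfn]. }
  assert (Gdom : forall c a, related M Gr c a -> c ∈ v /\ a ∈ U).
  { intros c a [p [Hp Ho]]; apply HG in Hp; destruct Hp as [Hp _]; apply HQ in Hp.
    destruct Hp as [x [Hx [y [Hy Ho']]]]; destruct (opair_inj HB _ _ _ _ _ Ho Ho'); subst; auto. }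
  assert (Gmin : forall Z, Z ∈ PQ -> hull_closed Z -> forall c a, related M Gr c a -> related M Z c a).
  { intros Z HZ Hc c a [p [Hp Ho]]; exists p; split; auto; apply HG in Hp; apply Hp; auto. }
  assert (Gin : forall c a, c ∈ v -> a ∈ U -> (forall Z, Z ∈ PQ -> hull_closed Z -> related M Z c a) ->
    related M Gr c a).
  { intros c a Hc Ha H; destruct (opair_ex HB c a) as [p Hp]; exists p; split; auto; apply HG; split.
    - apply HQ; eauto.
    - intros Z HZ HcZ; destruct (H Z HZ HcZ) as [p' [Hp' Ho']].
      rewrite (opair_unique HB _ _ _ _ Hp Ho'); auto. }
  assert (Gcl : hull_closed Gr).
  { split.
    - intros x Hx a Ha c Hc H1 H2; apply Gin; auto; intros Z HZ [HcZ _]; eapply HcZ; eauto.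
    - intros X HX Y HY a Ha b Hb d Hd c Hc H1 H2 H3; apply Gin; auto; intros Z HZ HcZ.
      apply (proj2 HcZ X HX Y HY a Ha b Hb d Hd c Hc); auto. }
  (* Induction over the least closed set: the pairs of Gr that satisfy P form a closed set again. *)
  assert (Gind : forall P : M -> M -> Prop,
    Dfn (fam1 M s) KD0 (fun _ e => P (e 1) (e 0)) ->
    (forall x c a, x ∈ s -> a ∈ U -> Bs x a -> code0 c x -> c ∈ v -> P c a) ->
    (forall c X Y a b d, related M Gr X a -> P X a -> related M Gr Y b -> P Y b -> d ∈ U -> c ∈ v ->
      OPS 0 ops c X Y a b d -> P c d) ->
    forall c a, related M Gr c a -> P c a).
  { intros P HD H1 H2 c a Hca.
    destruct (mkrel HB v U (fun c a => related M Gr c a /\ P c a)) as [Z [HZ1 HZ2]].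
    { apply D_and; auto; dfn. }
    apply (HZ2 c a); apply Gmin; auto; [apply HPQ; intros p Hp; apply HQ, HZ1, Hp|].
    split.
    - intros x Hx a' Ha' c' Hc' K1 K2; apply HZ2; split; auto; split; auto; split; eauto.
      destruct Gcl as [K _]; eapply K; eauto.
    - intros X HX Y HY a1 Ha1 b1 Hb1 d Hd c1 Hc1 K1 K2 K3; apply HZ2; split; auto; split; auto.
      apply HZ2 in K1; apply HZ2 in K2; split.
      + apply (proj2 Gcl X HX Y HY a1 Ha1 b1 Hb1 d Hd c1 Hc1); tauto.
      + apply (H2 c1 X Y a1 b1 d); tauto. }
  assert (Gq : forall c a, related M Gr c a -> subset M c q).
  { apply Gind; [dfn| |].
    - intros x c a _ _ _ [Z1 [_ [Z2 [_ [_ [_ K]]]]]] _; apply K.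
    - intros c X Y a b d _ _ _ _ _ _ K; destruct (OPS_inv _ _ _ _ _ _ _ _ K)
        as [i [o [_ [[_ [Z1 [_ [Z2 [_ [_ [_ K']]]]]]] _]]]]; apply K'. }
  (* Inversion: every pair of Gr arises from a generator or from an operation applied to pairs of
     Gr. *)
  assert (Ginv : forall c a, related M Gr c a ->
    (∃ x ∈ s, Bs x a /\ code0 c x) \/
    (∃ X ∈ v, ∃ Y ∈ v, ∃ b ∈ U, ∃ b' ∈ U,
      related M Gr X b /\ related M Gr Y b' /\ OPS 0 ops c X Y b b' a)).
  { apply Gind.
    - apply D_or.
      + apply (@D_exin (fam1 M s) KD0); [dT|]; apply D_and.
        * refine (@D_sub2 (fam1 M s) KD0 _ _ _ _ (fun _ => Bs) DBs); dT.
        * apply D_code0; dT.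
      + do 4 (apply (@D_exin (fam1 M s) KD0); [dT|]; cbv beta).
        apply D_and; [dfn|]; apply D_and; [dfn|]; apply D_OPS; dT || auto.
    - intros x c a Hx Ha HBs Hc _; left; eauto.
    - intros c X Y a b d K1 _ K2 _ Hd Hc K3; right; destruct (Gdom _ _ K1), (Gdom _ _ K2).
      exists X; split; auto; exists Y; split; auto; exists a; split; auto; exists b; auto. }
  assert (Gfun : forall c a, related M Gr c a -> forall b, b ∈ U -> related M Gr c b -> b = a).
  { apply (Gind (fun c a => forall b, b ∈ U -> related M Gr c b -> b = a)); [dfn| |].
    - intros x c a Hx Ha HBs Hc _ b Hb Hcb; destruct (Ginv _ _ Hcb) as [[x' [_ [K1 K2]]]|K].
      + apply (fBs x'); auto; rewrite (code0_inj _ _ _ K2 Hc); auto.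
      + destruct K as [X [_ [Y [_ [d [_ [d' [_ [_ [_ K]]]]]]]]]].
        destruct (OPS_inv _ _ _ _ _ _ _ _ K) as [i [o [_ [K' _]]]]; case (code01 _ _ _ _ _ Hc K').
    - intros c X Y a b d K1 K2 K3 K4 Hd Hc K e He Hce.
      destruct (OPS_inv _ _ _ _ _ _ _ _ K) as [i [o [Ei [Kc Ko]]]].
      destruct (Ginv _ _ Hce) as [[x' [_ [_ K0]]]|K']; [case (code01 _ _ _ _ _ K0 Kc)|].
      destruct K' as [X' [_ [Y' [_ [a' [Ha' [b' [Hb' [R1 [R2 K']]]]]]]]]].
      destruct (OPS_inv _ _ _ _ _ _ _ _ K') as [i' [o' [Ei' [Kc' Ko']]]].
      destruct (code1_inj _ _ _ _ _ _ _ Kc Kc') as [E [EX EY]]; subst X' Y'.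
      simpl in E; subst i'; rewrite Ei in Ei'; injection Ei' as <-.
      assert (a' = a) by (apply K2; auto). assert (b' = b) by (apply K4; auto). subst.
      apply (fops o (nth_error_In _ _ Ei) a b); auto. }
  exists Gr; split; auto; split; [|split].
  - intros c a b H1 H2; symmetry; apply (Gfun c a); auto; apply (Gdom c b); auto.
  - intros x a Hx Ha HBs; destruct (code0_ex x Hx) as [c [Hc [_ K]]]; exists c.
    apply (proj1 Gcl x Hx a Ha c Hc); auto.
  - intros o Ho X Y a b d H1 H2 Hd Hod; destruct (In_nth_error _ _ Ho) as [i Ei].
    destruct (code1_ex i X Y) as [c [Hc [_ K]]]; [eapply Gq; eauto..|]; exists c.
    destruct (Gdom _ _ H1), (Gdom _ _ H2).
    apply (proj2 Gcl X H Y H3 a H0 b H4 d Hd c Hc); auto.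
    apply (OPS_intro _ 0 i o); auto.
Qed.
End Codes.

(** * Downward Löwenheim–Skolem for bounded formulas *)

(** The matrices for which a substructure must contain witnesses in order to reflect p; a universal
    quantifier asks for a counterexample. *)
Fixpoint skl (p : formula) : list formula :=
  match p with
  | fMem _ _ | fEq _ _ => nil
  | fNot p => skl p
  | fAnd p q | fOr p q | fImp p q => skl p ++ skl q
  | fAll p => fNot p :: skl p
  | fEx p => p :: skl p
  end.

Lemma skl_bnd p : forall q, In q (skl p) -> bnd q <= bnd p.
Proof.
  induction p; simpl; intros r H; try contradiction; try (apply in_app_iff in H; destruct H);
    try (destruct H as [<-|H]; simpl); try (apply IHp in H); try (apply IHp1 in H);
    try (apply IHp2 in H); auto; try lia.
Qed.

Section Hull.
Context {M : structure} (HB : BST M) (HPow : powerset M).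
Context (om Pom s q v t R : M).
Context (Hom : inductive_set om) (HPom : forall A, A ∈ Pom <-> subset M A om).
Context (Hs : subset M om s).
Context (Hq : forall p, p ∈ q <-> exists A, A ∈ Pom /\ exists x, x ∈ s /\ is_opair M p A x).
Context (Hv : forall z, subset M z q -> z ∈ v).
Context (ttr : is_transitive M t) (st : subset M s t) (HR : well_orders M R t).
Context (y0 : M) (Hy0 : y0 ∈ t) (fl : list formula) (Bd : nat).
Context (Hfl : forall p, In p fl -> bnd p <= Bd).

(** Since p is an external formula with at most Bd relevant variables, satisfaction at the internal
    assignment f is one formula that looks up f at Bd numerals. *)
Definition Sat (f a : M) (p : formula) : Prop := exists c : nat -> M,
  (forall i, i < Bd -> c i ∈ t /\ related M f (num HB i) (c i)) /\ sat (scons a c) p.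

Lemma D_Sat p (x0 : M) : Delta0 p -> bnd p <= Bd ->
  Dfn (fam1 M x0) KD0 (fun _ e => Sat (e 1) (e 0) p).
Proof using.
  intros Hp Hb; unfold Sat.
  eapply (@D_ext (fam1 M x0) KD0); [|apply (@D_EX (fam1 M x0) KD0 Bd (fun _ _ _ => t)
    (fun i _ e x => related M (e 1) (num HB i) x)
    (fun _ e => sat (fun i => e (match i with 0 => Bd | S i => i end)) p))].
  - intros j e; simpl; split; intros [c [H1 H2]]; exists c; split; auto.
    + eapply sat_bnd; [|exact H2]; intros [|i] Hi; unfold pre; simpl.
      * rewrite Nat.ltb_irrefl, Nat.sub_diag; auto.
      * destruct (Nat.ltb_spec i Bd); auto; lia.
    + eapply sat_bnd; [|exact H2]; intros [|i] Hi; unfold pre; simpl.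
      * rewrite Nat.ltb_irrefl, Nat.sub_diag; auto.
      * destruct (Nat.ltb_spec i Bd); auto; lia.
  - intros; dT.
  - intros; dfn.
  - apply D_sat; auto.
Qed.

Lemma functions_ex : exists U Q : M, (forall p, p ∈ Q <-> exists x, x ∈ om /\ exists y, y ∈ t /\
    is_opair M p x y) /\
  forall f, f ∈ U <-> subset M f Q /\ ∀ i ∈ om, ∃ x ∈ t, related M f i x /\
    forall x', related M f i x' -> x' = x.
Proof using HB HPow.
  destruct (b_prod M HB om t) as [Q HQ], (HPow Q) as [PQ HPQ].
  destruct (sep HB PQ (fun f => ∀ i ∈ om, ∃ x ∈ t, related M f i x /\
    forall x', related M f i x' -> x' = x)) as [U HU]; [dfn|].
  exists U, Q; split; auto; intros f; rewrite HU, HPQ; tauto.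
Qed.

Context (U Q : M) (HQ : forall p, p ∈ Q <-> exists x, x ∈ om /\ exists y, y ∈ t /\
  is_opair M p x y).
Context (HU : forall f, f ∈ U <-> subset M f Q /\ ∀ i ∈ om, ∃ x ∈ t, related M f i x /\
    forall x', related M f i x' -> x' = x).

Lemma U_val f i : f ∈ U -> i ∈ om -> exists x, x ∈ t /\ related M f i x.
Proof using HU. intros Hf Hi; apply HU in Hf; destruct (proj2 Hf i Hi) as [x ?]; exists x; tauto. Qed.

Lemma U_fun f i x y : f ∈ U -> related M f i x -> related M f i y -> x = y.
Proof using HB HQ HU.
  intros Hf Hx Hy; apply HU in Hf; destruct Hf as [Hf Hf'].
  destruct Hx as [p [Hp Ho]]; pose proof (Hf p Hp) as K; apply HQ in K.
  destruct K as [i' [Hi [x' [_ Ho']]]]; destruct (opair_inj HB _ _ _ _ _ Ho Ho'); subst.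
  destruct (Hf' i' Hi) as [z [_ [_ K]]]; rewrite (K x'), (K y); auto; exists p; auto.
Qed.

Lemma U_dom f i x : f ∈ U -> related M f i x -> i ∈ om /\ x ∈ t.
Proof using HB HQ HU.
  intros Hf [p [Hp Ho]]; apply HU in Hf; apply (proj1 Hf) in Hp; apply HQ in Hp.
  destruct Hp as [i' [Hi [x' [Hx Ho']]]]; destruct (opair_inj HB _ _ _ _ _ Ho Ho'); subst; auto.
Qed.

Lemma U_ext f g : f ∈ U -> g ∈ U -> (forall i, i ∈ om -> exists x, related M f i x /\ related M g i x) ->
  f = g.
Proof using HB HQ HU.
  assert (K : forall f g, f ∈ U -> g ∈ U ->
    (forall i, i ∈ om -> exists x, related M f i x /\ related M g i x) -> subset M f g).
  { intros f' g' Hf Hg H p Hp; pose proof (proj1 (HU f') Hf) as Hf'.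
    pose proof (proj1 Hf' p Hp) as Hp'; apply HQ in Hp'.
    destruct Hp' as [i [Hi [x [Hx Ho]]]]; destruct (H i Hi) as [y [H1 H2]].
    assert (y = x) by (apply (U_fun f' i); auto; exists p; auto); subst y.
    destruct H2 as [p' [Hp' Ho']]; rewrite (opair_unique HB _ _ _ _ Ho Ho'); auto. }
  intros Hf Hg H; apply (ext HB); intros p; split; apply K; auto.
  intros i Hi; destruct (H i Hi) as [x [? ?]]; exists x; auto.
Qed.

Lemma mkfun (P : M -> M -> Prop) : Dfn (fam1 M om) KD0 (fun _ e => P (e 1) (e 0)) ->
  (forall i, i ∈ om -> exists x, x ∈ t /\ P i x) -> (forall i x y, P i x -> P i y -> x = y) ->
  exists f, f ∈ U /\ forall i x, i ∈ om -> P i x -> x ∈ t -> related M f i x.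
Proof using HB HQ HU.
  intros HD H1 H2; destruct (mkrel HB om t P HD) as [f [Hf1 Hf2]].
  exists f; split; [|intros i x Hi HP Hx; apply Hf2; auto].
  apply HU; split; [intros p Hp; apply HQ, Hf1, Hp|].
  intros i Hi; destruct (H1 i Hi) as [x [Hx HP]]; exists x; split; auto; split; [apply Hf2; auto|].
  intros x' Hx'; apply Hf2 in Hx'; apply (H2 i); tauto.
Qed.

(** The hull is built from assignments ω → t rather than elements, an element being represented by a
    constant assignment. Thus operations of arity two suffice: updates write the arguments into one
    assignment, and a Skolem function becomes unary in it. *)
Definition cst (f a : M) : Prop := ∀ i ∈ om, related M f i a.

Definition o_upd (n : nat) (f g d : M) : Prop := ∀ i ∈ om,
  (i = num HB n -> ∃ x ∈ t, related M d i x /\ related M g (num HB 0) x) /\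
  (~ i = num HB n -> ∃ x ∈ t, related M d i x /\ related M f i x).

Definition o_sk (p : formula) (f g d : M) : Prop := ∃ a ∈ t, cst d a /\
  Sat f a p /\ ∀ b ∈ t, Sat f b p -> a = b \/ related M R a b.

Definition hull_ops : list (M -> M -> M -> Prop) :=
  (fun f g d => cst d y0) :: map o_upd (seq 0 Bd) ++ map o_sk fl.

Lemma cst_ex a : a ∈ t -> exists f, f ∈ U /\ cst f a.
Proof using HB HQ HU.
  intros Ha; destruct (mkfun (fun i x => x = a)) as [f [Hf K]]; [dfn|eauto|congruence|].
  exists f; split; auto; intros i Hi; apply K; auto.
Qed.

Context (Hfl0 : forall p, In p fl -> Delta0 p).

Lemma hull_skolem : exists Gr : M,
  (forall c a, related M Gr c a -> c ∈ v /\ a ∈ U) /\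
  (forall c a b, related M Gr c a -> related M Gr c b -> a = b) /\
  (forall x a, x ∈ s -> a ∈ U -> cst a x -> exists c, related M Gr c a) /\
  (forall o, In o hull_ops -> forall X Y a b d, related M Gr X a -> related M Gr Y b -> d ∈ U ->
    o a b d -> exists c, related M Gr c d).
Proof using HB HPom HPow HQ HR HU Hfl Hfl0 Hom Hq Hs Hv.
  assert (cstu : forall a x y, a ∈ U -> cst a x -> cst a y -> x = y).
  { intros a x y Ha H1 H2; apply (U_fun a (num HB 0)); auto; [apply H1|apply H2]; apply num_in, Hom. }
  apply (hull HB om Pom s q v); auto.
  - unfold cst; dfn.
  - intros o [<-|Ho]; [unfold cst; dfn|]; apply in_app_iff in Ho; destruct Ho as [Ho|Ho];
      apply in_map_iff in Ho.
    + destruct Ho as [n [<- _]]; unfold o_upd; dfn.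
    + destruct Ho as [p [<- Hp]]; unfold o_sk, cst.
      assert (HD := fun x0 => D_Sat p x0 (Hfl0 p Hp) (Hfl p Hp)).
      dapp; cbv beta; dapp; [dfn|]; dapp.
      * refine (@D_sub2 (fam1 M s) KD0 _ _ _ _ (fun _ f a => Sat f a p) (HD s)); dT.
      * dapp; cbv beta; dapp; [|dfn].
        refine (@D_sub2 (fam1 M s) KD0 _ _ _ _ (fun _ f a => Sat f a p) (HD s)); dT.
  - intros x a b Ha Hb H1 H2; apply U_ext; auto; intros i Hi; exists x; auto.
  - intros o [<-|Ho] a b c c' Ha Hb Hc Hc' H1 H2; [|apply in_app_iff in Ho; destruct Ho as [Ho|Ho];
      apply in_map_iff in Ho].
    + apply U_ext; auto; intros i Hi; exists y0; auto.
    + destruct Ho as [n [<- _]]; apply U_ext; auto; intros i Hi.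
      destruct (H1 i Hi) as [A1 A2], (H2 i Hi) as [B1 B2].
      destruct (classic (i = num HB n)) as [E|E].
      * destruct (A1 E) as [x [_ [K1 K2]]], (B1 E) as [y [_ [L1 L2]]].
        rewrite (U_fun b _ _ _ Hb L2 K2) in L1; eauto.
      * destruct (A2 E) as [x [_ [K1 K2]]], (B2 E) as [y [_ [L1 L2]]].
        rewrite (U_fun a _ _ _ Ha L2 K2) in L1; eauto.
    + destruct Ho as [p [<- Hp]]; destruct H1 as [x [Hx [C1 [S1 L1]]]], H2 as [y [Hy [C2 [S2 L2]]]].
      assert (x = y).
      { destruct HR as [_ [irr [trn _]]].
        destruct (L1 y Hy S2) as [|R1]; auto; destruct (L2 x Hx S1) as [|R2]; auto.
        case (irr x Hx); apply (trn x Hx y Hy x Hx); auto. }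
      subst y; apply U_ext; auto; intros i Hi; exists x; auto.
Qed.

(* A set X of size at most |v| with s ⊆ X ⊆ t, closed under Skolem functions for [fl]. *)
Lemma skolem_hull : exists val : M,
  (forall c x, related M val c x -> c ∈ v /\ x ∈ t) /\
  (forall c x y, related M val c x -> related M val c y -> x = y) /\
  (forall x, x ∈ s -> exists c, related M val c x) /\ (exists c, related M val c y0) /\
  (forall p, In p fl -> forall rho, (forall i, exists c, related M val c (rho i)) ->
    (exists a, a ∈ t /\ sat (scons a rho) p) ->
    exists a, (exists c, related M val c a) /\ sat (scons a rho) p).
Proof using HB HPom HPow HQ HR HU Hfl Hfl0 Hom Hq Hs Hv st Hy0.
  destruct hull_skolem as [Gr [G1 [G2 [G3 G4]]]].
  destruct (mkrel HB v t (fun c x => exists f, related M Gr c f /\ related M f (num HB 0) x))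
    as [val [_ Hval]]; [dfn|].
  assert (N0 : num HB 0 ∈ om) by (apply num_in, Hom).
  assert (V : forall c f x, related M Gr c f -> related M f (num HB 0) x -> related M val c x).
  { intros c f x H1 H2; destruct (G1 _ _ H1) as [Hc Hf]; apply Hval; split; auto.
    split; [apply (U_dom f _ _ Hf H2)|eauto]. }
  (* Operations need arguments even to produce the constant y0; a code of the generator 0 provides
     them. *)
  assert (Vy : exists c f, related M Gr c f /\ cst f y0).
  { destruct (cst_ex y0 Hy0) as [f [Hf Kf]].
    assert (Hn : num HB 0 ∈ s) by (apply Hs; auto).
    destruct (cst_ex (num HB 0) (st _ Hn)) as [g [Hg Kg]].
    destruct (G3 _ g Hn Hg Kg) as [c Hc].
    destruct (G4 (fun _ _ d => cst d y0)) with (X := c) (Y := c) (a := g) (b := g) (d := f) as [c' Hc'];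
      auto; [left; auto|]; eauto. }
  exists val; split; [|split; [|split; [|split]]].
  - intros c x H; apply Hval in H; tauto.
  - intros c x y Hx Hy; apply Hval in Hx; apply Hval in Hy.
    destruct Hx as [_ [_ [f [Hf Kf]]]], Hy as [_ [_ [g [Hg Kg]]]].
    rewrite (G2 _ _ _ Hg Hf) in Kg; apply (U_fun f (num HB 0)); auto; apply (G1 _ _ Hf).
  - intros x Hx; destruct (cst_ex x (st _ Hx)) as [f [Hf Kf]], (G3 x f Hx Hf Kf) as [c Hc].
    exists c; apply (V c f); auto.
  - destruct Vy as [c [f [Hc Hf]]]; exists c; apply (V c f); auto.
  - intros p Hp rho Hrho [a0 [Ha0 Sa0]].
    (* The values of rho are written one after the other into a single assignment that has a
       code. *)
    assert (K : forall k, k <= Bd -> exists c f, related M Gr c f /\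
      forall i, i < k -> related M f (num HB i) (rho i)).
    { induction k; intros Hk.
      - destruct Vy as [c [f [Hc Hf]]]; exists c, f; split; auto; intros; lia.
      - destruct IHk as [c [f [Hc Hf]]]; [lia|]; destruct (Hrho k) as [c' Hc'].
        apply Hval in Hc'; destruct Hc' as [_ [Ht' [g [Hg Kg]]]].
        destruct (G1 _ _ Hc) as [_ HfU], (G1 _ _ Hg) as [_ HgU].
        destruct (mkfun (fun i x => (i = num HB k /\ x = rho k) \/ (~ i = num HB k /\ related M f i x)))
          as [d [Hd Kd]].
        + dfn.
        + intros i Hi; destruct (classic (i = num HB k)); [exists (rho k); auto|].
          destruct (U_val f i HfU Hi) as [x [? ?]]; exists x; auto.
        + intros i x y [[? ?]|[? H1]] [[? ?]|[? H2]]; subst; auto; try contradiction.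
          apply (U_fun f i); auto.
        + destruct (G4 (o_upd k)) with (X := c) (Y := c') (a := f) (b := g) (d := d) as [c2 Hc2]; auto.
          * right; apply in_app_iff; left; apply in_map_iff; exists k; split; auto.
            apply in_seq; lia.
          * intros i Hi; split; intros E.
            -- exists (rho k); split; auto.
            -- destruct (U_val f i HfU Hi) as [x [? ?]]; exists x; split; auto.
          * exists c2, d; split; auto; intros i Hi; destruct (Nat.eq_dec i k) as [->|E].
            -- apply Kd; auto; apply num_in, Hom.
            -- assert (R1 : related M f (num HB i) (rho i)) by (apply Hf; lia).
               destruct (U_dom f _ _ HfU R1); apply Kd; auto; right; split; auto.
               intros E'; apply num_inj in E'; auto. }
    destruct (K Bd (le_n _)) as [c [f [Hc Hf]]]; destruct (G1 _ _ Hc) as [_ HfU].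
    assert (E : forall a, Sat f a p <-> sat (scons a rho) p).
    { intros a; split.
      - intros [c' [H1 H2]]; eapply sat_bnd; [|exact H2]; intros [|i] Hi; simpl; auto.
        specialize (Hfl p Hp); symmetry; apply (U_fun f (num HB i)); auto; [apply H1|apply Hf]; lia.
      - intros H; exists rho; split; auto; intros i Hi; split; auto.
        apply (U_dom f (num HB i)); auto. }
    destruct (sep HB t (fun a => Sat f a p)) as [W HW].
    { refine (@D_sub2 (fam1 M t) KD0 _ _ _ _ (fun _ f a => Sat f a p) (D_Sat p t _ _)); auto; dT. }
    destruct HR as [_ [_ [_ [_ lst]]]]; destruct (lst W) as [a [Ha La]].
    { intros z Hz; apply HW in Hz; tauto. }
    { intros Em; apply (Em a0), HW; split; auto; apply E, Sa0. }
    apply HW in Ha; destruct Ha as [Ha Sa]; destruct (cst_ex a Ha) as [d [Hd Kd]].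
    destruct (G4 (o_sk p)) with (X := c) (Y := c) (a := f) (b := f) (d := d) as [c2 Hc2]; auto.
    { right; apply in_app_iff; right; apply in_map; auto. }
    { exists a; split; auto; split; auto; split; auto; intros b Hb Sb; apply La, HW; auto. }
    exists a; split; [exists c2; apply (V c2 d); auto|apply E, Sa].
Qed.
End Hull.

Lemma skl_Delta0 p : Delta0 p -> forall q, In q (skl p) -> Delta0 q.
Proof.
  induction 1; simpl; intros r K; auto; try contradiction;
    try (apply in_app_iff in K; destruct K; auto).
  - destruct K as [<-|K]; auto; repeat constructor; auto.
  - destruct K as [<-|K]; auto; repeat constructor; auto.
Qed.

(* The values of the functions in [h] include all sets of hereditary size at most that of
   P(P(om) × s). *)
Record hbound (M : structure) (om Pom s q v h : M) : Prop := {
  hb_om : inductive_set om;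
  hb_Pom : forall A, A ∈ Pom <-> subset M A om;
  hb_s : subset M om s;
  hb_tr : is_transitive M s;
  hb_q : forall p, p ∈ q <-> exists A, A ∈ Pom /\ exists x, x ∈ s /\ is_opair M p A x;
  hb_v : forall z, subset M z q -> z ∈ v;
  hb_h : AxHrel M v h
}.

(** Take a Skolem hull X of s and y0 inside a transitive set, named by elements of v. Membership
    pulled back to names is a well-founded relation on v, so h contains its collapse. The collapse
    is an isomorphism of X with a transitive set, is the identity on s and preserves p; the image of
    y0 is the witness. *)
Theorem loewenheim_skolem (M : structure) (HM : Mac M) (om Pom s q v h : M) :
  hbound M om Pom s q v h ->
  forall p, Delta0 p -> forall rho, (forall i, rho i ∈ s) -> forall y0, sat (scons y0 rho) p ->
  exists y, sat (scons y rho) p /\ ∃ f ∈ h, ∃ i ∈ v, related M f i y.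
Proof.
  intros [Hom HPom Hs str Hq Hv Hh] p Hp rho Hrho y0 Hy0.
  pose proof (Mac_BST M HM) as HB.
  destruct (adj_ex HB s y0) as [s' Hs'].
  destruct (Mac_transitive_containment M HM s') as [t [ttr st']].
  assert (st : subset M s t) by (intros z Hz; apply st', Hs'; auto).
  assert (Hyt : y0 ∈ t) by (apply st', Hs'; auto).
  destruct (Mac_well_ordering M HM t) as [R HR].
  (* A witness for [qe] is an element of the difference of two sets; closing the hull under it makes
     X extensional. The 5 in [Bd] is its [bnd]. *)
  set (qe := fAnd (fMem 0 1) (fNot (fMem 0 2))).
  set (Bd := bnd p + 5).
  destruct (functions_ex HB (Mac_powerset M HM) om t) as [U [Q [HQ HU]]].
  destruct (skolem_hull HB (Mac_powerset M HM) om Pom s q v t R Hom HPom Hs Hq Hv st HR y0 Hyt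
    (qe :: skl p) Bd) with (U := U) (Q := Q) as [val [V1 [V2 [V3 [V4 V5]]]]]; auto.
  { intros r [<-|K]; [simpl; lia|apply skl_bnd in K; lia]. }
  { intros r [<-|K]; [repeat constructor|apply (skl_Delta0 p); auto]. }
  clear U Q HQ HU Bd.
  set (X := fun x => exists c, related M val c x).
  destruct (mkrel HB v v (fun l c => exists x, related M val l x /\
    exists x', related M val c x' /\ x ∈ x')) as [r [Hr1 Hr2]]; [dfn|].
  assert (Hwf : wfrel M r v).
  { intros w Hw Hne.
    destruct (classic (exists c, c ∈ w /\ ~ exists x, related M val c x)) as [[c [Hc K]]|K].
    - exists c; split; auto; intros l _ Hl; apply Hr2 in Hl.
      destruct Hl as [_ [_ [x [_ [x' [Hx' _]]]]]]; apply K; eauto.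
    - destruct (min_def HB t (fun x => ∃ c ∈ w, related M val c x)) as [x [_ [[c [Hc Hx]] Hmin]]];
        [dfn| |].
      + apply NNPP; intros N; apply Hne; intros c Hc; apply K; exists c; split; auto.
        intros [x Hx]; apply N; exists x; split; [apply (V1 _ _ Hx)|eauto].
      + exists c; split; auto; intros l Hl Hrl; apply Hr2 in Hrl.
        destruct Hrl as [_ [_ [y [Hy [x' [Hx' Hyx]]]]]].
        rewrite (V2 _ _ _ Hx' Hx) in Hyx; apply (Hmin y); eauto; apply (V1 _ _ Hy). }
  destruct (Hh r Hr1 Hwf) as [f [Hf [Ftot Fval]]].
  (* [cX x z]: the collapse sends some name of x to z. The claims [C1] to [C5] make it an
     isomorphism that is the identity on s. *)
  set (cX := fun x z => exists c, related M val c x /\ related M f c z).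
  assert (C1 : forall x, X x -> exists z, cX x z).
  { intros x [c Hc]; destruct (Ftot c) as [z Hz]; [apply (V1 _ _ Hc)|exists z, c; auto]. }
  assert (C3a : forall x z, cX x z -> forall w, w ∈ z -> exists u, u ∈ x /\ cX u w).
  { intros x z [c [Hc Hz]] w Hw; destruct (V1 _ _ Hc) as [Hcv _].
    destruct (Fval c Hcv z Hz) as [_ [A1 _]]; destruct (A1 w Hw) as [l [Hl [Hrl Hlw]]].
    apply Hr2 in Hrl; destruct Hrl as [_ [_ [u [Hu [x' [Hx' Hux]]]]]].
    rewrite (V2 _ _ _ Hx' Hc) in Hux; exists u; split; auto; exists l; auto. }
  assert (C3b : forall x z u, cX x z -> X u -> u ∈ x -> exists w, w ∈ z /\ cX u w).
  { intros x z u [c [Hc Hz]] [l Hl] Hu; destruct (V1 _ _ Hc) as [Hcv _], (V1 _ _ Hl) as [Hlv _].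
    destruct (Fval c Hcv z Hz) as [_ [_ A2]]; destruct (A2 l Hlv) as [w [Hw Hlw]].
    - apply Hr2; split; auto; split; eauto.
    - exists w; split; auto; exists l; auto. }
  assert (cXX : forall x z, cX x z -> X x) by (intros x z [c [Hc _]]; exists c; auto).
  assert (C2 : forall x z z', cX x z -> cX x z' -> z = z').
  (* An element may have several names; they have the same predecessors, hence the same collapse. *)
  { assert (K : forall x c c' z z', related M val c x -> related M val c' x ->
      related M f c z -> related M f c' z' -> subset M z z').
    { intros x c c' z z' Hc Hc' Hz Hz' w Hw.
      destruct (V1 _ _ Hc) as [Hcv _], (V1 _ _ Hc') as [Hcv' _].
      destruct (Fval c Hcv z Hz) as [_ [A1 _]]; destruct (A1 w Hw) as [l [Hl [Hrl Hlw]]].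
      apply Hr2 in Hrl; destruct Hrl as [_ [_ [u [Hu [x' [Hx' Hux]]]]]].
      rewrite (V2 _ _ _ Hx' Hc) in Hux.
      destruct (Fval c' Hcv' z' Hz') as [_ [_ A2]]; destruct (A2 l Hl) as [w' [Hw' Hlw']].
      - apply Hr2; split; auto; split; eauto.
      - replace w with w'; auto; apply (Fval l Hl w Hlw); auto. }
    intros x z z' [c [Hc Hz]] [c' [Hc' Hz']]; apply (ext HB); intros w; split;
      [apply (K x c c')|apply (K x c' c)]; auto. }
  assert (C4 : forall x, x ∈ t -> forall x' z, cX x z -> cX x' z -> x = x').
  { assert (K : forall x, x ∈ t -> ∀ x' ∈ t, ∀ c ∈ v, ∀ c' ∈ v, forall z, related M f c z ->
      related M val c x -> related M f c' z -> related M val c' x' -> x = x').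
    { apply (mem_ind_in HB t (fun x => ∀ x' ∈ t, ∀ c ∈ v, ∀ c' ∈ v, forall z, related M f c z ->
        related M val c x -> related M f c' z -> related M val c' x' -> x = x')); [dfn|].
      intros x Hx IH x' Hx' c Hc c' Hc' z Hz Hcx Hz' Hcx'.
      assert (IH' : forall u, u ∈ x -> forall u' w, cX u w -> cX u' w -> u = u').
      { intros u Hu u' w [l [Hl Hlw]] [l' [Hl' Hlw']].
        apply (IH u Hu) with (c := l) (c' := l') (z := w); auto; try (apply (V1 _ _ Hl)).
        - apply (V1 _ _ Hl').
        - apply (V1 _ _ Hl'). }
      assert (Q1 : cX x z) by (exists c; auto). assert (Q2 : cX x' z) by (exists c'; auto).
      assert (E1 : forall u, X u -> u ∈ x -> u ∈ x').
      { intros u Hu Hux; destruct (C3b _ _ _ Q1 Hu Hux) as [w [Hw Hcw]].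
        destruct (C3a _ _ Q2 w Hw) as [u' [Hu' Hcu']].
        rewrite (IH' u Hux u' w); auto. }
      assert (E2 : forall u, X u -> u ∈ x' -> u ∈ x).
      { intros u Hu Hux; destruct (C3b _ _ _ Q2 Hu Hux) as [w [Hw Hcw]].
        destruct (C3a _ _ Q1 w Hw) as [u' [Hu' Hcu']].
        rewrite <- (IH' u' Hu' u w); auto. }
      (* Extensionality of X, from the Skolem function for [qe]. *)
      assert (ex : forall a b, X a -> X b -> (forall u, X u -> u ∈ a -> u ∈ b) -> subset M a b).
      { intros a b Ha Hb Hab; apply NNPP; intros N.
        destruct (V5 qe (or_introl eq_refl) (scons a (fun _ => b))) as [u [Hu [S1 S2]]].
        - intros [|i]; auto.
        - apply NNPP; intros N'; apply N; intros u Hu; apply NNPP; intros Hu'; apply N'.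
          exists u; split; [|split; auto]; destruct Ha as [ca Hca]; apply (ttr a); auto.
          apply (V1 _ _ Hca).
        - apply S2; simpl; apply Hab; auto. }
      apply (ext HB); intros u; split; apply ex; eauto. }
    intros x Hx x' z [c [Hc Hz]] [c' [Hc' Hz']].
    apply (K x Hx) with (c := c) (c' := c') (z := z); auto; try (apply (V1 _ _ Hc)).
    - apply (V1 _ _ Hc').
    - apply (V1 _ _ Hc'). }
  assert (C5 : forall x, x ∈ s -> cX x x).
  { assert (K : forall x, x ∈ s -> ∀ c ∈ v, forall z, related M f c z -> related M val c x -> z = x).
    { apply (mem_ind_in HB s (fun x => ∀ c ∈ v, forall z, related M f c z ->
        related M val c x -> z = x)); [dfn|].
      intros x Hx IH c Hc z Hz Hcx.
      assert (Q1 : cX x z) by (exists c; auto).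
      apply (ext HB); intros u; split; intros Hu.
      - destruct (C3a _ _ Q1 u Hu) as [u' [Hu' [l [Hl Hlu]]]].
        assert (u = u') by (apply (IH u' Hu' (str x Hx u' Hu') l); auto; apply (V1 _ _ Hl)).
        subst; auto.
      - destruct (C3b _ _ u Q1) as [w [Hw [l [Hl Hlu]]]]; auto.
        { apply V3, (str x); auto. }
        assert (w = u) by (apply (IH u Hu (str x Hx u Hu) l); auto; apply (V1 _ _ Hl)).
        subst; auto. }
    intros x Hx; destruct (C1 x (V3 x Hx)) as [z [c [Hc Hz]]].
    assert (z = x) by (apply (K x Hx c); auto; apply (V1 _ _ Hc)); subst; exists c; auto. }
  (* Induction over the subformulas of p: the Tarski-Vaught criterion combined with the isomorphism
     onto a transitive set. *)
  assert (Main : forall p', Delta0 p' -> (forall q', In q' (skl p') -> In q' (skl p)) ->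
    forall r1 r2, (forall i, cX (r1 i) (r2 i)) -> (sat r1 p' <-> sat r2 p')).
  { assert (Tv : forall q', In q' (skl p) -> forall r1 r2, (forall i, cX (r1 i) (r2 i)) ->
      forall a, a ∈ t -> sat (scons a r1) q' -> exists a, X a /\ sat (scons a r1) q').
    { intros q' Hq' r1 r2 H a Ha Sa; destruct (V5 q' (or_intror Hq') r1) as [b [Hb Sb]]; eauto.
      intros i; apply (cXX _ _ (H i)). }
    assert (SC : forall r1 r2 a b, (forall i, cX (r1 i) (r2 i)) -> cX a b ->
      forall i, cX (scons a r1 i) (scons b r2 i)) by (intros r1 r2 a b H1 H2 [|i]; simpl; auto).
    assert (Xt : forall x, X x -> x ∈ t) by (intros x [c Hc]; apply (V1 _ _ Hc)).
    induction 1 as [i j|i j|p' _ IH|p1 p2 _ IH1 _ IH2|p1 p2 _ IH1 _ IH2|p1 p2 _ IH1 _ IH2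
      |y p' _ IH|y p' _ IH]; intros Hin r1 r2 H; simpl in *.
    - split; intros K.
      + destruct (C3b _ _ _ (H j) (cXX _ _ (H i)) K) as [w [Hw Kw]].
        rewrite (C2 _ _ _ (H i) Kw); auto.
      + destruct (C3a _ _ (H j) _ K) as [u [Hu Ku]].
        rewrite (C4 (r1 i)) with (x' := u) (z := r2 i); auto; apply Xt, (cXX _ _ (H i)).
    - split; intros K.
      + apply (C2 (r1 i)); auto; rewrite K; auto.
      + apply (C4 (r1 i)) with (z := r2 i); auto; [apply Xt, (cXX _ _ (H i))|rewrite K; auto].
    - rewrite (IH Hin r1 r2 H); tauto.
    - rewrite (IH1 (fun q' K => Hin q' (in_or_app _ _ _ (or_introl K))) r1 r2 H),
        (IH2 (fun q' K => Hin q' (in_or_app _ _ _ (or_intror K))) r1 r2 H); tauto.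
    - rewrite (IH1 (fun q' K => Hin q' (in_or_app _ _ _ (or_introl K))) r1 r2 H),
        (IH2 (fun q' K => Hin q' (in_or_app _ _ _ (or_intror K))) r1 r2 H); tauto.
    - rewrite (IH1 (fun q' K => Hin q' (in_or_app _ _ _ (or_introl K))) r1 r2 H),
        (IH2 (fun q' K => Hin q' (in_or_app _ _ _ (or_intror K))) r1 r2 H); tauto.
    - assert (Hin' : forall q', In q' (skl p') -> In q' (skl p)) by (intros; apply Hin; auto).
      split.
      + intros K b Hb; destruct (C3a _ _ (H y) _ Hb) as [a [Ha Kab]].
        apply (IH Hin' (scons a r1)); auto.
      + intros K a Ha; apply NNPP; intros N.
        destruct (Tv _ (Hin _ (or_introl eq_refl)) r1 r2 H a) as [a' [Xa' Sa']].
        * apply (ttr (r1 y)); auto; apply Xt, (cXX _ _ (H y)).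
        * simpl; auto.
        * simpl in Sa'; apply Sa'; intros Ha'.
          destruct (C3b _ _ _ (H y) Xa' Ha') as [b [Hb Kb]].
          apply (IH Hin' (scons a' r1) (scons b r2)); auto.
    - assert (Hin' : forall q', In q' (skl p') -> In q' (skl p)) by (intros; apply Hin; auto).
      split.
      + intros [a [Ha Sa]].
        destruct (Tv _ (Hin _ (or_introl eq_refl)) r1 r2 H a) as [a' [Xa' [Ha' Sa']]].
        * apply (ttr (r1 y)); auto; apply Xt, (cXX _ _ (H y)).
        * simpl; auto.
        * destruct (C3b _ _ _ (H y) Xa' Ha') as [b [Hb Kb]]; exists b; split; auto.
          apply (IH Hin' (scons a' r1) (scons b r2)); auto.
      + intros [b [Hb Sb]]; destruct (C3a _ _ (H y) _ Hb) as [a [Ha Kab]].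
        exists a; split; auto; apply (IH Hin' (scons a r1) (scons b r2)); auto. }
  destruct (C1 y0 V4) as [z0 Hz0]; exists z0; split.
  - apply (Main p Hp (fun q' K => K) (scons y0 rho)); auto.
    intros [|i]; simpl; auto.
  - exists f; split; auto; destruct Hz0 as [c [Hc Hz]]; exists c; split; auto; apply (V1 _ _ Hc).
Qed.

(** * MOST is Mac together with the axiom H *)

Lemma hbound_ex (M : structure) (HM : Mac M) (HH : AxH M) (om x : M) : inductive_set om ->
  exists Pom s q v h, hbound M om Pom s q v h /\ subset M x s.
Proof.
  intros Hom; pose proof (Mac_BST M HM) as HB.
  destruct (Mac_powerset M HM om) as [Pom HPom].
  destruct (union2_ex HB om x) as [u Hu], (Mac_transitive_containment M HM u) as [s [str Hs]].
  destruct (b_prod M HB Pom s) as [q Hq], (Mac_powerset M HM q) as [v Hv], (HH v) as [h Hh].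
  exists Pom, s, q, v, h; split; [constructor; auto|].
  - intros z Hz; apply Hs, Hu; auto.
  - intros z Hz; apply Hv; auto.
  - intros z Hz; apply Hs, Hu; auto.
Qed.

Lemma values_ex (M : structure) (HB : BST M) (h : M) :
  exists H, forall f i y, f ∈ h -> related M f i y -> y ∈ H.
Proof.
  destruct (b_union M HB h) as [U HU], (range_ex HB U) as [H HH]; exists H.
  intros f i y Hf [p [Hp Ho]]; apply (HH i); exists p; split; auto; apply HU; eauto.
Qed.

Lemma finite_set_ex (M : structure) (HB : BST M) (rho : nat -> M) k :
  exists x, forall i, i < k -> rho i ∈ x.
Proof.
  induction k as [|k [x Hx]]; [destruct (b_empty M HB) as [x _]; exists x; intros; lia|].
  destruct (adj_ex HB x (rho k)) as [y Hy]; exists y; intros i Hi; apply Hy.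
  destruct (Nat.eq_dec i k) as [->|]; auto; left; apply Hx; lia.
Qed.

(** The bound C depends on x alone, because the data of Löwenheim-Skolem are chosen before the
    formula and its parameters. *)
Lemma sigma1_reflection (M : structure) (HM : Mac M) (HH : AxH M) (x : M) :
  (exists a, a ∈ x) ->
  exists C, forall p, Delta0 p -> forall rho, (forall i, i < bnd p -> rho i ∈ x) ->
  (exists y, sat (scons y rho) p) -> exists y, y ∈ C /\ sat (scons y rho) p.
Proof.
  intros [a Ha]; pose proof (Mac_BST M HM) as HB.
  destruct (Mac_infinity M HM) as [om Hom].
  destruct (hbound_ex M HM HH om x Hom) as [Pom [s [q [v [h [Hb Hx]]]]]].
  destruct (values_ex M HB h) as [C HC]; exists C; intros p Hp rho Hrho [y Hy].
  (* Irrelevant variables are sent to an element of x, because Löwenheim-Skolem asks for all values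
     in s. *)
  set (rho' := fun i => if i <? bnd p then rho i else a).
  assert (E : forall y, sat (scons y rho) p <-> sat (scons y rho') p).
  { intros z; apply sat_bnd; intros [|i] Hi; simpl; auto; unfold rho'.
    destruct (Nat.ltb_spec i (bnd p)); auto; lia. }
  destruct (loewenheim_skolem M HM om Pom s q v h Hb p Hp rho') with (y0 := y)
    as [z [Hz [f [Hf [i [Hi Hr]]]]]].
  - intros i; apply Hx; unfold rho'; destruct (Nat.ltb_spec i (bnd p)); auto.
  - apply E, Hy.
  - exists z; split; [apply (HC f i); auto|apply E, Hz].
Qed.

(** Two witnesses are contracted into their unordered pair; order is irrelevant since the bounded
    quantifiers search in it. *)
Lemma Sigma1_normal p : Sigma1 p -> exists q, Delta0 q /\
  forall (M : structure), pairing M -> forall rho : nat -> M,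
    sat rho p <-> exists t, sat (scons t rho) q.
Proof.
  induction 1 as [p Hp|p _ [q [Hq E]]].
  - exists (ren S p); split; [apply (Gam_ren KD0); auto|].
    intros M _ rho; split.
    + intros H; exists (rho 0); rewrite sat_ren; exact H.
    + intros [t H]; rewrite sat_ren in H; exact H.
  - exists (fExIn 0 (fExIn 1 (ren (fun i => match i with 0 => 0 | 1 => 1 | S i => S (S i) end) q))).
    split; [constructor; constructor; apply (Gam_ren KD0); auto|].
    assert (K : forall (M : structure) (rho : nat -> M) t a u,
      sat (scons t (scons a (scons u rho)))
        (ren (fun i => match i with 0 => 0 | 1 => 1 | S i => S (S i) end) q) <->
      sat (scons t (scons a rho)) q).
    { intros M rho t a u; rewrite sat_ren; apply sat_ext; intros [|[|i]]; reflexivity. }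
    intros M HP rho; simpl; split.
    + intros [a Ha]; apply E in Ha; auto; destruct Ha as [t Ht].
      destruct (HP a t) as [u Hu]; exists u, a; split; [apply Hu; auto|].
      exists t; split; [apply Hu; auto|apply K; auto].
    + intros [u [a [_ [t [_ Ht]]]]]; exists a; apply E; auto; exists t; apply K in Ht; auto.
Qed.

(** The reflecting set C answers collection at once, and as a parameter it turns a [Sigma1] formula
    into a [Delta0] one, to which separation in Mac applies. *)
Theorem Mac_AxH_MOST (M : structure) : Mac M -> AxH M -> MOST M.
Proof.
  intros HM HH; pose proof (Mac_BST M HM) as HB.
  assert (R : forall p, Delta0 p -> forall (rho : nat -> M) w, exists C, forall x, x ∈ w ->
    (exists y, sat (scons y (scons x rho)) p) -> exists y, y ∈ C /\ sat (scons y (scons x rho)) p).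
  { intros p Hp rho w; destruct (finite_set_ex M HB rho (bnd p)) as [f Hf].
    destruct (adj_ex HB f w) as [g Hg], (union2_ex HB w g) as [x0 Hx0].
    destruct (sigma1_reflection M HM HH x0) as [C HC].
    { exists w; apply Hx0; right; apply Hg; auto. }
    exists C; intros x Hx; apply HC; auto.
    intros [|i] Hi; simpl; apply Hx0; auto; right; apply Hg; left; apply Hf; lia. }
  constructor; auto.
  - intros p Hp rho w; destruct (Sigma1_normal p Hp) as [q [Hq E]].
    destruct (R q Hq rho w) as [C HC].
    destruct (Mac_separation M HM (fExIn 1
      (ren (fun i => match i with 0 => 0 | 1 => 1 | S i => S (S i) end) q))) with
      (rho := scons C rho) (w := w) as [y Hy].
    { constructor; apply (Gam_ren KD0); auto. }
    assert (K : forall t x, sat (scons t (scons x (scons C rho)))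
        (ren (fun i => match i with 0 => 0 | 1 => 1 | S i => S (S i) end) q) <->
      sat (scons t (scons x rho)) q).
    { intros t x; rewrite sat_ren; apply sat_ext; intros [|[|i]]; reflexivity. }
    exists y; intros x; rewrite Hy, (E M (Mac_pairing M HM)); simpl; split; intros [Hx H]; split; auto.
    + destruct H as [t [_ Ht]]; exists t; apply K, Ht.
    + destruct (HC x Hx H) as [t [Ht Kt]]; exists t; split; auto; apply K, Kt.
  - intros p Hp rho w H; destruct (R p Hp rho w) as [C HC]; exists C; auto.
Qed.

(** * Absoluteness *)

Record initial {N M : structure} (i : N -> M) : Prop := {
  in_inj : forall a b, i a = i b -> a = b;
  in_mem : forall a b, a ∈ b <-> i a ∈ i b;
  in_tr : forall a x, x ∈ i a -> exists b, i b = x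
}.

(** The larger structure adds no subsets to old elements; this makes quantifiers over subsets, and
    well-foundedness, absolute. *)
Definition subclosed {N M : structure} (i : N -> M) : Prop :=
  forall a x, subset M x (i a) -> exists b, i b = x.

Lemma scons_map {A B : Type} (f : A -> B) a (rho : nat -> A) n :
  f (scons a rho n) = scons (f a) (fun n => f (rho n)) n.
Proof. destruct n; reflexivity. Qed.

Section Absoluteness.
Context {N M : structure} (i : N -> M) (Hi : initial i).

Lemma sat_scons_map a (rho : nat -> N) p :
  sat (fun n => i (scons a rho n)) p <-> sat (scons (i a) (fun n => i (rho n))) p.
Proof using. apply sat_ext; intros n; apply scons_map. Qed.

Lemma initial_subset a b : subset N a b <-> subset M (i a) (i b).
Proof using Hi.
  split; intros H z Hz.
  - destruct (in_tr i Hi _ _ Hz) as [c <-]; apply (in_mem i Hi), H, (in_mem i Hi), Hz.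
  - apply (in_mem i Hi), H, (in_mem i Hi), Hz.
Qed.

Lemma sat_absolute_P p : Delta0P p -> subclosed i \/ Delta0 p -> forall rho,
  sat rho p <-> sat (fun n => i (rho n)) p.
Proof using Hi.
  induction 1 as [a b|a b|p _ IH|p q _ IHp _ IHq|p q _ IHp _ IHq|p q _ IHp _ IHq
    |y p _ IH|y p _ IH|y p _ IH|y p _ IH]; intros Hc rho; simpl.
  - apply (in_mem i Hi).
  - split; [congruence|apply (in_inj i Hi)].
  - rewrite IH; [tauto|]; destruct Hc as [|Hc]; auto; inversion Hc; auto.
  - rewrite IHp, IHq; [tauto|..]; destruct Hc as [|Hc]; auto; inversion Hc; auto.
  - rewrite IHp, IHq; [tauto|..]; destruct Hc as [|Hc]; auto; inversion Hc; auto.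
  - rewrite IHp, IHq; [tauto|..]; destruct Hc as [|Hc]; auto; inversion Hc; auto.
  - assert (Hc' : subclosed i \/ Delta0 p) by (destruct Hc as [|Hc]; auto; inversion Hc; auto).
    split; intros H.
    + intros x Hx; destruct (in_tr i Hi _ _ Hx) as [b <-].
      rewrite <- sat_scons_map, <- IH; auto; apply H, (in_mem i Hi), Hx.
    + intros b Hb; apply IH; auto; rewrite sat_scons_map; apply H, (in_mem i Hi), Hb.
  - assert (Hc' : subclosed i \/ Delta0 p) by (destruct Hc as [|Hc]; auto; inversion Hc; auto).
    split.
    + intros [b [Hb Sb]]; exists (i b); split; [apply (in_mem i Hi), Hb|].
      rewrite <- sat_scons_map, <- IH; auto.
    + intros [x [Hx Sx]]; destruct (in_tr i Hi _ _ Hx) as [b <-]; exists b.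
      split; [apply (in_mem i Hi), Hx|]; apply IH; auto; rewrite sat_scons_map; auto.
  - assert (Hc' : subclosed i) by (destruct Hc as [|Hc]; auto; inversion Hc).
    split; intros H.
    + intros x Hx; destruct (Hc' (rho y) x Hx) as [b <-].
      rewrite <- sat_scons_map, <- IH; auto; apply H, (proj2 (initial_subset b (rho y)) Hx).
    + intros b Hb; apply IH; auto; rewrite sat_scons_map; apply H.
      apply (proj1 (initial_subset b (rho y)) Hb).
  - assert (Hc' : subclosed i) by (destruct Hc as [|Hc]; auto; inversion Hc).
    split.
    + intros [b [Hb Sb]]; exists (i b); split; [apply (proj1 (initial_subset b (rho y)) Hb)|].
      rewrite <- sat_scons_map, <- IH; auto.
    + intros [x [Hx Sx]]; destruct (Hc' (rho y) x Hx) as [b <-]; exists b.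
      split; [apply (proj2 (initial_subset b (rho y)) Hx)|]; apply IH; auto; rewrite sat_scons_map; auto.
Qed.

Lemma sat_absolute p : Delta0 p -> forall rho, sat rho p <-> sat (fun n => i (rho n)) p.
Proof using Hi. intros Hp; apply sat_absolute_P; auto using Delta0_Delta0P. Qed.

Lemma absU (P : forall j : fJ famU, (nat -> fS famU j) -> Prop) : Dfn famU KD0 P ->
  forall pt e, P (existT _ N pt) e <-> P (existT _ M (i pt)) (fun n => i (e n)).
Proof using Hi.
  intros [p [r [Hp [C E]]]] pt e; rewrite E, E, sat_absolute; auto.
  apply sat_ext; intros n; destruct (even_odd_cases n) as [m [->| ->]];
    rewrite ?comb_even, ?comb_odd; auto.
  rewrite (C (existT _ M (i pt)) m), (C (existT _ N pt) m); reflexivity.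
Qed.

Lemma abs1 (Q : forall X : structure, X -> Prop) :
  Dfn famU KD0 (fun j e => Q (fS famU j) (e 0)) -> forall a, Q N a <-> Q M (i a).
Proof using Hi. intros H a; apply (absU _ H a (fun _ => a)). Qed.

Lemma abs2 (Q : forall X : structure, X -> X -> Prop) :
  Dfn famU KD0 (fun j e => Q (fS famU j) (e 0) (e 1)) -> forall a b, Q N a b <-> Q M (i a) (i b).
Proof using Hi. intros H a b; apply (absU _ H a (scons a (fun _ => b))). Qed.

Lemma abs3 (Q : forall X : structure, X -> X -> X -> Prop) :
  Dfn famU KD0 (fun j e => Q (fS famU j) (e 0) (e 1) (e 2)) ->
  forall a b c, Q N a b c <-> Q M (i a) (i b) (i c).
Proof using Hi. intros H a b c; apply (absU _ H a (scons a (scons b (fun _ => c)))). Qed.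

Lemma abs_related r a b : related N r a b <-> related M (i r) (i a) (i b).
Proof using Hi. apply (abs3 related); dfn. Qed.

Lemma abs_opair r a b : is_opair N r a b <-> is_opair M (i r) (i a) (i b).
Proof using Hi. apply (abs3 is_opair); dfn. Qed.

Lemma abs_empty a : is_empty N a <-> is_empty M (i a).
Proof using Hi. apply (abs1 is_empty); dfn. Qed.

Lemma abs_collapse p r v : collapse N p r v <-> collapse M (i p) (i r) (i v).
Proof using Hi. apply (abs3 collapse); apply (@D_collapse famU KD0); dT. Qed.

Lemma abs_rel_on r v : rel_on N r v <-> rel_on M (i r) (i v).
Proof using Hi. apply (abs2 rel_on); unfold rel_on; dfn. Qed.

Lemma abs_wfrel r v : subclosed i -> (wfrel N r v <-> wfrel M (i r) (i v)).
Proof using Hi.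
  intros Hc; split; intros H s Hs Hne.
  - destruct (Hc _ _ Hs) as [s' <-]; destruct (H s') as [a [Ha K]].
    + apply initial_subset, Hs.
    + rewrite abs_empty; auto.
    + exists (i a); split; [apply (in_mem i Hi), Ha|]; intros l Hl.
      destruct (in_tr i Hi _ _ Hl) as [b <-]; rewrite <- abs_related.
      apply K, (in_mem i Hi), Hl.
  - destruct (H (i s)) as [x [Hx K]].
    + apply (initial_subset s v), Hs.
    + rewrite <- abs_empty; auto.
    + destruct (in_tr i Hi _ _ Hx) as [a <-]; exists a; split; [apply (in_mem i Hi), Hx|].
      intros l Hl; rewrite abs_related; apply K, (in_mem i Hi), Hl.
Qed.

End Absoluteness.

(** * Classes closed enough to be models of Mac and H *)

Section GoodClass.
Context {N M : structure} (i : N -> M) (Hi : initial i) (HM : Mac M).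
Context (gc_sub : subclosed i)
  (gc_pair : forall a b, exists p, is_upair M (i p) (i a) (i b))
  (gc_union : forall a, exists u, forall z, z ∈ i u <-> ∃ w ∈ i a, z ∈ w)
  (gc_pow : forall a, exists p, forall z, z ∈ i p <-> subset M z (i a))
  (gc_tc : forall a, exists t, is_transitive M (i t) /\ subset M (i a) (i t))
  (gc_inf : exists om, inductive_set (i om))
  (gc_H : forall v, exists h, AxHrel M (i v) (i h)).

Lemma good_Mac : Mac N.
Proof using Hi HM gc_sub gc_pair gc_union gc_pow gc_tc gc_inf.
  pose proof (Mac_BST M HM) as HB; pose proof (in_mem i Hi) as im; pose proof (in_tr i Hi) as it.
  constructor.
  - intros x y H; apply (in_inj i Hi), (ext HB); intros z; split; intros Hz;
      destruct (it _ _ Hz) as [b <-]; apply im, H, im, Hz.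
  - intros a b; destruct (gc_pair a b) as [p Hp]; exists p; apply (abs3 i Hi is_upair); [dfn|auto].
  - destruct gc_inf as [om _], (b_empty M HB) as [e He].
    destruct (gc_sub om e) as [b <-]; [intros z Hz; case (He z Hz)|].
    exists b; apply (abs_empty i Hi); auto.
  - intros a; destruct (gc_union a) as [u Hu]; exists u; intros z; rewrite im, Hu; split.
    + intros [w [Hw Hz]]; destruct (it _ _ Hw) as [b <-]; exists b; rewrite !im; auto.
    + intros [w [Hw Hz]]; exists (i w); rewrite <- !im; auto.
  - destruct gc_inf as [om Hom]; exists om.
    apply (abs1 i Hi (fun X om => @inductive_set X om)); [unfold inductive_set; dfn|auto].
  - intros a; destruct (gc_pow a) as [p Hp]; exists p; intros z.
    rewrite im, Hp, (initial_subset i Hi); tauto.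
  - intros a; destruct (gc_tc a) as [t [H1 H2]]; exists t; split.
    + apply (abs1 i Hi is_transitive); [dfn|auto].
    + apply (initial_subset i Hi); auto.
  - intros p Hp rho w.
    destruct (Mac_separation M HM p Hp (fun n => i (rho n)) (i w)) as [y Hy].
    destruct (gc_sub w y) as [b <-]; [intros z Hz; apply Hy in Hz; tauto|].
    exists b; intros x; rewrite im, Hy, (sat_absolute i Hi p Hp), im, sat_scons_map; tauto.
  - intros x Hx; destruct (b_found M HB (i x)) as [y [Hy K]].
    + rewrite <- (abs_empty i Hi); auto.
    + destruct (it _ _ Hy) as [b <-]; exists b; split; [apply im, Hy|].
      intros z Hz Hzx; apply (K (i z)); apply im; auto.
  - intros x; destruct (Mac_well_ordering M HM (i x)) as [R [H1 [H2 [H3 [H4 H5]]]]].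
    (* A well-order of x is a subset of P(P(x)), hence belongs to N. *)
    destruct (gc_pow x) as [p1 Hp1], (gc_pow p1) as [p2 Hp2], (gc_sub p2 R) as [r <-].
    { intros p Hp; apply Hp2; destruct (H1 p Hp) as [a [Ha [b [Hb [s [u [Hs [Hu Hpp]]]]]]]].
      intros w Hw; apply Hp1; apply Hpp in Hw; intros z Hz; destruct Hw; subst w;
        [apply Hs in Hz|apply Hu in Hz]; destruct Hz; subst; auto. }
    exists r; split; [|split; [|split; [|split]]].
    + intros p Hp; destruct (H1 (i p)) as [a [Ha [b [Hb Ho]]]]; [apply im, Hp|].
      destruct (it _ _ Ha) as [a' <-], (it _ _ Hb) as [b' <-].
      exists a'; split; [apply im, Ha|]; exists b'; split; [apply im, Hb|].
      apply (abs_opair i Hi), Ho.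
    + intros a Ha; rewrite (abs_related i Hi); apply H2, im, Ha.
    + intros a Ha b Hb c Hc; rewrite !(abs_related i Hi); apply H3; apply im; auto.
    + intros a Ha b Hb; rewrite !(abs_related i Hi).
      destruct (H4 (i a)) with (b := i b) as [|[E|]]; try (apply im; auto); auto.
      right; left; apply (in_inj i Hi), E.
    + intros s Hs Hne; destruct (H5 (i s)) as [a [Ha K]].
      * apply (initial_subset i Hi s x), Hs.
      * rewrite <- (abs_empty i Hi); auto.
      * destruct (it _ _ Ha) as [a' <-]; exists a'; split; [apply im, Ha|].
        intros b Hb; rewrite (abs_related i Hi).
        destruct (K (i b)) as [E|]; [apply im, Hb|left; apply (in_inj i Hi), E|auto].
Qed.

Lemma good_AxH : AxH N.
Proof using Hi gc_sub gc_H.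
  intros v; destruct (gc_H v) as [h Hh]; exists h; intros r Hr Hw.
  destruct (Hh (i r)) as [p [Hp K]].
  - apply (abs_rel_on i Hi); auto.
  - apply (abs_wfrel i Hi); auto.
  - destruct (in_tr i Hi _ _ Hp) as [b <-]; exists b; split; [apply (in_mem i Hi), Hp|].
    apply (abs_collapse i Hi), K.
Qed.
End GoodClass.

(** * Relativization to a set *)

(** The relativizing set sits at index b, which grows under quantifiers; the other variables are
    renumbered around it. *)
Definition sh (b n : nat) : nat := if n <? b then n else S n.

Fixpoint rel (b : nat) (p : formula) : formula :=
  match p with
  | fMem i j => fMem (sh b i) (sh b j)
  | fEq i j => fEq (sh b i) (sh b j)
  | fNot p => fNot (rel b p)
  | fAnd p q => fAnd (rel b p) (rel b q)
  | fOr p q => fOr (rel b p) (rel b q)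
  | fImp p q => fImp (rel b p) (rel b q)
  | fAll p => fAllIn b (rel (S b) p)
  | fEx p => fExIn b (rel (S b) p)
  end.

Lemma rel_Delta0 p : forall b, Delta0 (rel b p).
Proof. induction p; intros b; simpl; constructor; auto. Qed.

Lemma sat_rel (M : structure) (B : M) p : forall b (rho : nat -> substructure M (fun x => x ∈ B))
  (rho' : nat -> M), rho' b = B -> (forall n, rho' (sh b n) = proj1_sig (rho n)) ->
  (sat rho p <-> sat rho' (rel b p)).
Proof.
  assert (K : forall b (rho : nat -> substructure M (fun x => x ∈ B)) (rho' : nat -> M)
    (x : substructure M (fun x => x ∈ B)), (forall n, rho' (sh b n) = proj1_sig (rho n)) ->
    forall n, scons (proj1_sig x) rho' (sh (S b) n) = proj1_sig (scons x rho n)).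
  { intros b rho rho' x H [|n]; [reflexivity|]; simpl; rewrite <- H; unfold sh.
    destruct (Nat.ltb_spec (S n) (S b)), (Nat.ltb_spec n b); try lia; reflexivity. }
  induction p; intros b rho rho' Hb H; simpl.
  - rewrite !H; tauto.
  - rewrite !H; split; [congruence|]; intros E.
    destruct (rho i), (rho j); simpl in E; apply subset_eq_compat; auto.
  - rewrite (IHp b rho rho'); tauto.
  - rewrite (IHp1 b rho rho'), (IHp2 b rho rho'); tauto.
  - rewrite (IHp1 b rho rho'), (IHp2 b rho rho'); tauto.
  - rewrite (IHp1 b rho rho'), (IHp2 b rho rho'); tauto.
  - split.
    + intros Hs a Ha; rewrite Hb in Ha.
      apply (IHp (S b) (scons (exist _ a Ha) rho)); simpl; auto.
      apply (K b rho rho' (exist _ a Ha)); auto.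
    + intros Hs x; apply (IHp (S b) _ (scons (proj1_sig x) rho')); simpl; auto.
      apply Hs; rewrite Hb; apply (proj2_sig x).
  - split.
    + intros [x Hs]; exists (proj1_sig x); split; [rewrite Hb; apply (proj2_sig x)|].
      apply (IHp (S b) (scons x rho)); simpl; auto.
    + intros [a [Ha Hs]]; rewrite Hb in Ha; exists (exist _ a Ha).
      apply (IHp (S b) _ (scons a rho')); simpl; auto.
      apply (K b rho rho' (exist _ a Ha)); auto.
Qed.

(** * The cut fixed by an automorphism *)

(** Only transitive sets inside a given transitive t are intersected, which bounds the quantifier by
    P(t); any other transitive superset of a is cut down to its trace on t. *)
Lemma TC_ex (M : structure) (HM : Mac M) (a : M) : exists c, is_TC M c a.
Proof.
  pose proof (Mac_BST M HM) as HB.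
  destruct (Mac_transitive_containment M HM a) as [t [tt at_]], (Mac_powerset M HM t) as [P HP].
  destruct (sep HB t (fun z => ∀ d ∈ P, is_transitive M d -> subset M a d -> z ∈ d)) as [c Hc]; [dfn|].
  exists c; split; [|split].
  - intros u Hu v Hv; apply Hc in Hu; destruct Hu as [Hu K]; apply Hc; split; [apply (tt u); auto|].
    intros d Hd Hdt Had; apply (Hdt u); auto.
  - intros z Hz; apply Hc; split; [apply at_, Hz|]; intros d _ _ Had; apply Had, Hz.
  - intros d Hd Had z Hz; apply Hc in Hz; destruct Hz as [Hz K].
    destruct (sep HB t (fun z => z ∈ d)) as [e He]; [dfn|].
    apply (He z), K.
    + apply HP; intros w Hw; apply He in Hw; tauto.
    + intros u Hu w Hw; apply He in Hu; apply He; split; [apply (tt u)|apply (Hd u)]; tauto.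
    + intros w Hw; apply He; auto.
Qed.

Lemma automorphism_initial (M : structure) (j : M -> M) : automorphism j -> initial j.
Proof.
  intros [[Hinj Hsur] Hm]; constructor; auto; intros a x _; apply Hsur.
Qed.

Section Fixed.
Context {M : structure} (HM : Mac M) (j : M -> M) (Hj : automorphism j).

Definition fixed (x : M) : Prop := forall y : M, in_TC_singleton M y x -> j y = y.

Lemma TC1_ex (x : M) : exists s c, is_singleton M s x /\ is_TC M c s.
Proof using HM.
  destruct (Mac_pairing M HM x x) as [s Hs], (TC_ex M HM s) as [c Hc]; exists s, c; auto.
Qed.

Lemma fixed_of_transitive (t x : M) : is_transitive M t -> x ∈ t -> (forall y, y ∈ t -> j y = y) ->
  fixed x.
Proof using.
  intros Ht Hx H y [s [c [Hs [Hc Hy]]]]; apply H, (proj2 (proj2 Hc) t Ht); auto.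
  intros z Hz; apply Hs in Hz; destruct Hz; subst; auto.
Qed.

Lemma fixed_transitive (x : M) : fixed x -> exists t, is_transitive M t /\ x ∈ t /\
  forall y, y ∈ t -> fixed y.
Proof using HM.
  intros H; destruct (TC1_ex x) as [s [c [Hs Hc]]].
  assert (Hx : x ∈ c) by (apply (proj1 (proj2 Hc)), Hs; auto).
  exists c; split; [apply Hc|split; auto].
  intros y Hy; apply (fixed_of_transitive c); auto; [apply Hc|].
  intros z Hz; apply H; exists s, c; auto.
Qed.

Lemma fixed_j (x : M) : fixed x -> j x = x.
Proof using HM.
  intros H; apply H; destruct (TC1_ex x) as [s [c [Hs Hc]]]; exists s, c; split; auto; split; auto.
  apply (proj1 (proj2 Hc)), Hs; auto.
Qed.

Lemma fixed_mem (x z : M) : fixed x -> z ∈ x -> fixed z.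
Proof using HM.
  intros Hx Hz; destruct (fixed_transitive x Hx) as [t [Ht [Hxt K]]]; apply K, (Ht x); auto.
Qed.

(** An automorphism that fixes every element of x fixes x by extensionality, and TC({x}) consists of
    x and the transitive closures of its elements. *)
Lemma fixed_closed (x : M) : (forall z, z ∈ x -> fixed z) -> fixed x.
Proof using HM Hj.
  pose proof (Mac_BST M HM) as HB.
  intros H.
  assert (Hjx : j x = x).
  { apply (ext HB); intros w; split; intros Hw.
    - destruct (proj2 (proj1 Hj) w) as [u <-]; apply (proj2 (proj2 Hj u x)) in Hw.
      rewrite (fixed_j u); auto.
    - rewrite <- (fixed_j w); auto; apply (proj1 (proj2 Hj w x)), Hw. }
  intros y [s [c [Hs [Hc Hy]]]].
  destruct (Mac_powerset M HM c) as [P HP].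
  (* This is {x} together with all TC({z}) for z in x, computed inside c; being transitive, it
     exhausts c. *)
  destruct (sep HB c (fun w => w = x \/ ∃ z ∈ x, ∀ d ∈ P, is_transitive M d -> z ∈ d -> w ∈ d))
    as [d Hd]; [dfn|].
  assert (xc : x ∈ c) by (apply (proj1 (proj2 Hc)), Hs; auto).
  assert (K : y ∈ d).
  { apply (proj2 (proj2 Hc) d); auto.
    - intros u Hu v Hv; apply Hd in Hu; destruct Hu as [Huc Hu]; apply Hd.
      split; [apply (proj1 Hc u); auto|right]; destruct Hu as [->|[z [Hz K]]].
      + exists v; split; auto.
      + exists z; split; auto; intros e He Het Hze; apply (Het u); auto.
    - intros z Hz; apply Hs in Hz; assert (z = x) by tauto; subst z; apply Hd; auto. }
  apply Hd in K; destruct K as [_ [->|[z [Hz K]]]]; auto.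
  destruct (fixed_transitive z (H z Hz)) as [t [Ht [Hzt Kt]]].
  destruct (sep HB c (fun w => w ∈ t)) as [e He]; [dfn|].
  assert (y ∈ e).
  { apply K.
    - apply HP; intros w Hw; apply He in Hw; tauto.
    - intros u Hu v Hv; apply He in Hu; apply He; split; [apply (proj1 Hc u)|apply (Ht u)]; tauto.
    - apply He; split; auto; apply (proj1 Hc x); auto. }
  apply He in H0; apply fixed_j, Kt; tauto.
Qed.

(* An automorphism fixes the collapse of a fixed relation, hence all its values. *)
Lemma fixed_collapse (p r v : M) : fixed v -> rel_on M r v -> wfrel M r v -> collapse M p r v ->
  forall i z, i ∈ v -> related M p i z -> fixed z.
Proof using HM Hj.
  pose proof (Mac_BST M HM) as HB.
  intros Hv Hr Hw Hp i z Hi Hz.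
  assert (Hfr : fixed r).
  { apply fixed_closed; intros q Hq; apply fixed_closed; intros s Hs; apply fixed_closed; intros u Hu.
    destruct (Hr q Hq) as [a [Ha [b [Hb [s1 [s2 [H1 [H2 H3]]]]]]]].
    assert (u = a \/ u = b).
    { apply H3 in Hs; destruct Hs; subst s; [apply H1 in Hu|apply H2 in Hu]; tauto. }
    destruct H as [E|E]; rewrite E; apply (fixed_mem v); auto. }
  assert (Hp' : collapse M (j p) r v).
  { rewrite <- (fixed_j r), <- (fixed_j v) by auto.
    apply (proj1 (abs_collapse j (automorphism_initial M j Hj) p r v)); auto. }
  assert (F : forall i z, i ∈ v -> related M p i z -> j z = z).
  { intros l y Hl Hy; apply (collapse_unique HB (j p) p r v l); auto.
    rewrite <- (fixed_j l) by (apply (fixed_mem v); auto).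
    apply (proj1 (abs_related j (automorphism_initial M j Hj) p l y)); auto. }
  destruct (range_ex HB p) as [R HR].
  destruct (sep HB R (fun z => ∃ i ∈ v, related M p i z)) as [t Ht]; [dfn|].
  apply (fixed_of_transitive t).
  - intros u Hu w Hwu; apply Ht in Hu; destruct Hu as [_ [l [Hl Hlu]]].
    destruct (proj2 Hp l Hl u Hlu) as [_ [A _]]; destruct (A w Hwu) as [m [Hm [_ Hmw]]].
    apply Ht; split; eauto.
  - apply Ht; split; eauto.
  - intros y Hy; apply Ht in Hy; destruct Hy as [_ [l [Hl Hly]]]; apply (F l); auto.
Qed.
End Fixed.

(** * Coding sets by relations on ordinals *)

Section OrdinalCodes.
Context {M : structure} (HM : Mac M) (HH : AxH M).
Implicit Types T k m x y z : M.

(** k is the ordinal that is the order type of the well-order R of T, and p is the isomorphism. *)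
Definition ordcode (T R p k : M) : Prop :=
  well_orders M R T /\ wfrel M R T /\ collapse M p R T /\
  (forall z, z ∈ k <-> ∃ i ∈ T, related M p i z).

Lemma ordcode_ex T : exists R p k, ordcode T R p k.
Proof using HM HH.
  pose proof (Mac_BST M HM) as HB.
  destruct (Mac_well_ordering M HM T) as [R HR].
  assert (Hw : wfrel M R T).
  { intros s Hs Hne; destruct HR as [_ [irr [trn [_ lst]]]].
    destruct (lst s Hs Hne) as [a [Ha K]]; exists a; split; auto; intros l Hl Hla.
    destruct (K l Hl) as [->|K']; [apply (irr l); auto|].
    apply (irr a); auto; apply (trn a) with (b := l); auto. }
  destruct (HH T) as [h Hh], (Hh R) as [p [_ Hp]]; auto; [exact (proj1 HR)|].
  destruct (range_ex HB p) as [Q HQ].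
  destruct (sep HB Q (fun z => ∃ i ∈ T, related M p i z)) as [k Hk]; [dfn|].
  exists R, p, k; split; [exact HR|split; [exact Hw|split; [exact Hp|]]]; intros z; split.
  - intros Hz; apply Hk in Hz; tauto.
  - intros [i [Hi Hz]]; apply Hk; split; eauto.
Qed.

Section Given.
Context (T R p k : M) (HT : is_transitive M T) (HO : ordcode T R p k).

Lemma oc_val i : i ∈ T -> exists z, z ∈ k /\ related M p i z.
Proof using HO.
  destruct HO as [_ [_ [[A _] K]]]; intros Hi; destruct (A i Hi) as [z Hz]; exists z; split; auto.
  apply K; eauto.
Qed.

Lemma oc_fun i z z' : i ∈ T -> related M p i z -> related M p i z' -> z = z'.
Proof using HO. intros Hi Hz Hz'; destruct HO as [_ [_ [[_ A] _]]]; apply (A i Hi z' Hz'); auto. Qed.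

Lemma oc_mem i i' z z' : i ∈ T -> i' ∈ T -> related M p i z -> related M p i' z' ->
  related M R i i' -> z ∈ z'.
Proof using HO.
  intros Hi Hi' Hz Hz' HR; destruct (proj2 (proj1 (proj2 (proj2 HO))) i' Hi' z' Hz') as [_ [_ A]].
  destruct (A i Hi HR) as [u [Hu Hiu]]; rewrite (oc_fun i z u); auto.
Qed.

Lemma oc_trans : is_transitive M k.
Proof using HO.
  intros u Hu w Hw; destruct HO as [_ [_ [[_ A] K]]]; apply K in Hu; destruct Hu as [i [Hi Hu]].
  destruct (A i Hi u Hu) as [_ [B _]]; destruct (B w Hw) as [l [Hl [_ Hlw]]]; apply K; eauto.
Qed.

Lemma oc_htrans m : m ∈ k -> is_transitive M m.
Proof using HO.
  intros Hm u Hu w Hw; pose proof HO as [HR [_ [[_ A] K]]]; apply K in Hm.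
  destruct Hm as [i [Hi Hm]]; destruct (A i Hi m Hm) as [_ [B _]].
  destruct (B u Hu) as [l [Hl [Hli Hlu]]]; destruct (A l Hl u Hlu) as [_ [B' _]].
  destruct (B' w Hw) as [n [Hn [Hnl Hnw]]]; apply (oc_mem n i); auto.
  destruct HR as [_ [_ [trn _]]]; apply (trn n) with (b := l); auto.
Qed.

Lemma oc_lin a b : a ∈ k -> b ∈ k -> a ∈ b \/ a = b \/ b ∈ a.
Proof using HO.
  intros Ha Hb; pose proof HO as [HR [_ [_ K]]]; apply K in Ha; apply K in Hb.
  destruct Ha as [i [Hi Ha]], Hb as [i' [Hi' Hb]]; destruct HR as [_ [_ [_ [tri _]]]].
  destruct (tri i Hi i' Hi') as [H|[H|H]].
  - left; apply (oc_mem i i'); auto.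
  - subst i'; right; left; apply (oc_fun i); auto.
  - right; right; apply (oc_mem i' i); auto.
Qed.

Lemma oc_inj i i' z : i ∈ T -> i' ∈ T -> related M p i z -> related M p i' z -> i = i'.
Proof using HM HO.
  pose proof (Mac_BST M HM) as HB.
  intros Hi Hi' Hz Hz'; destruct (proj1 HO) as [_ [_ [_ [tri _]]]].
  destruct (tri i Hi i' Hi') as [H|[H|H]]; auto; exfalso; apply (not_self HB z).
  - apply (oc_mem i i'); auto.
  - apply (oc_mem i' i); auto.
Qed.

(** Membership on T, transported along p, is a relation on the ordinal k whose collapse gives back
    T. It may be read on any larger m, so every large enough ordinal codes all elements of T. *)
Lemma oc_code m : subset M k m -> exists r, rel_on M r m /\ wfrel M r m /\
  forall s, collapse M s r m -> forall x, x ∈ T -> ∃ a ∈ m, related M s a x.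
Proof using HM HO HT.
  pose proof (Mac_BST M HM) as HB; intros Hkm.
  destruct (mkrel HB m m (fun a b => ∃ i ∈ T, ∃ i' ∈ T, related M p i a /\ related M p i' b /\ i ∈ i'))
    as [r [Hr1 Hr2]]; [dfn|].
  exists r; split; auto; split.
  - intros w Hw Hne.
    (* Elements of m that are not values of p are isolated in r, hence minimal. *)
    destruct (classic (exists a, a ∈ w /\ forall i, i ∈ T -> ~ related M p i a)) as [[a [Ha E]]|E].
    + exists a; split; auto; intros l Hl Hla; apply Hr2 in Hla.
      destruct Hla as [_ [_ [i [Hi [i' [Hi' [_ [H2 _]]]]]]]]; apply (E i' Hi' H2).
    + destruct (min_def HB T (fun i => ∃ a ∈ w, related M p i a)) as [i [Hi [[a [Ha Hia]] Hmin]]];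
        [dfn| |].
      * apply NNPP; intros N; apply Hne; intros a Ha; apply E; exists a; split; auto.
        intros i Hi Hia; apply N; exists i; split; eauto.
      * exists a; split; auto; intros l Hl Hla; apply Hr2 in Hla.
        destruct Hla as [_ [_ [i1 [Hi1 [i2 [Hi2 [H1 [H2 H3]]]]]]]].
        rewrite (oc_inj i2 i a) in H3; auto; apply (Hmin i1); eauto.
  - intros s [Stot Sval].
    assert (K : forall x, x ∈ T -> ∀ a ∈ m, related M p x a -> forall y, related M s a y -> y = x).
    { apply (mem_ind_in HB T (fun x => ∀ a ∈ m, related M p x a -> forall y, related M s a y -> y = x));
        [dfn|].
      intros x Hx IH a Ha Hxa y Hy; destruct (Sval a Ha y Hy) as [_ [A1 A2]].
      apply (ext HB); intros u; split; intros Hu.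
      - destruct (A1 u Hu) as [l [Hl [Hla Hlu]]]; apply Hr2 in Hla.
        destruct Hla as [_ [_ [i [Hi [i' [Hi' [H1 [H2 H3]]]]]]]].
        rewrite (oc_inj i' x a) in H3; auto.
        rewrite (IH i H3 Hi l Hl H1 u Hlu); auto.
      - assert (HuT : u ∈ T) by (apply (HT x); auto).
        destruct (oc_val u HuT) as [b [Hb Hub]].
        destruct (A2 b (Hkm b Hb)) as [w [Hw Hbw]].
        + apply Hr2; split; [auto|split; auto]; exists u; split; auto; exists x; auto.
        + rewrite <- (IH u Hu HuT b (Hkm b Hb) Hub w Hbw); auto. }
    intros x Hx; destruct (oc_val x Hx) as [a [Ha Hxa]]; exists a; split; auto.
    destruct (Stot a (Hkm a Ha)) as [y Hy]; rewrite <- (K x Hx a (Hkm a Ha) Hxa y Hy); auto.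
Qed.
End Given.
End OrdinalCodes.

(** * From the automorphism to MOST with powerset-bounded collection *)

Section Cut.
Context {M : structure} (HM : MOST M) (j : M -> M) (Hj : automorphism j).
Context {N : structure} (g : N -> M) (Hg : initial g).
Context (img : forall x, (exists b, g b = x) <-> fixed j x).

Lemma cut_closed x : (forall z, z ∈ x -> exists b, g b = z) -> exists b, g b = x.
Proof using HM Hj img.
  intros H; apply img, (fixed_closed (MOST_Mac M HM) j Hj); intros z Hz; apply img; auto.
Qed.

Lemma cut_subclosed : subclosed g.
Proof using HM Hg Hj img.
  intros a x Hx; apply cut_closed; intros z Hz; apply (in_tr g Hg a), Hx, Hz.
Qed.

Lemma cut_opair p a b : is_opair M p (g a) (g b) -> exists q, g q = p.
Proof using HM Hj img.
  intros [s [u [Hs [Hu Hp]]]]; apply cut_closed; intros z Hz; apply cut_closed; intros w Hw.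
  apply Hp in Hz; destruct Hz; subst z; [apply Hs in Hw|apply Hu in Hw]; destruct Hw; subst; eauto.
Qed.

Lemma cut_collapse p r v i z : rel_on M r (g v) -> wfrel M r (g v) -> collapse M p r (g v) ->
  i ∈ g v -> related M p i z -> exists b, g b = z.
Proof using HM Hj img.
  intros H1 H2 H3 Hi Hz; apply img.
  apply (fixed_collapse (MOST_Mac M HM) j Hj p r (g v)) with (i := i); auto; apply img; eauto.
Qed.

Lemma cut_MOST (om : N) : inductive_set om -> MOST N.
Proof using HM Hg Hj img.
  intros Hom; pose proof (MOST_Mac M HM) as HMac; pose proof (Mac_BST M HMac) as HB.
  pose proof (MOST_AxH M HM) as HH.
  assert (pow : forall a, exists p, forall z, z ∈ g p <-> subset M z (g a)).
  { intros a; destruct (Mac_powerset M HMac (g a)) as [P HP]; destruct (cut_closed P) as [p <-];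
      eauto; intros z Hz; apply HP in Hz; apply (cut_subclosed a z); auto. }
  apply Mac_AxH_MOST.
  - apply (good_Mac g Hg HMac); auto.
    + apply cut_subclosed.
    + intros a b; destruct (pair_ex HB (g a) (g b)) as [p Hp]; destruct (cut_closed p) as [q <-]; eauto.
      intros z Hz; apply Hp in Hz; destruct Hz; subst; eauto.
    + intros a; destruct (b_union M HB (g a)) as [u Hu]; destruct (cut_closed u) as [q <-]; eauto.
      intros z Hz; apply Hu in Hz; destruct Hz as [w [Hw Hz]].
      destruct (in_tr g Hg _ _ Hw) as [w' <-]; apply (in_tr g Hg w'); auto.
    + intros a; destruct (fixed_transitive HMac j (g a)) as [t [Ht [Hat K]]]; [apply img; eauto|].
      destruct (cut_closed t) as [t' <-]; [intros z Hz; apply img, K, Hz|].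
      exists t'; split; auto; intros z Hz; apply (Ht (g a)); auto.
    + exists om; apply (abs1 g Hg (fun X om => @inductive_set X om)); auto.
      unfold inductive_set; dfn.
  - apply (good_AxH g Hg); [apply cut_subclosed|].
    intros v; destruct (HH (g v)) as [h Hh], (values_ex M HB h) as [V HV].
    destruct (b_prod M HB (g v) (g v)) as [Q HQ], (Mac_powerset M HMac Q) as [PQ HPQ].
    destruct (Mac_powerset M HMac (g v)) as [Pv HPv].
    assert (wfE : forall r, wfrel M r (g v) <-> ∀ s ∈ Pv, ~ is_empty M s ->
      exists i, i ∈ s /\ forall l, l ∈ s -> ~ related M r l i).
    { intros r; split; intros K s Hs; apply K; apply HPv; auto. }
    (* C collects exactly the values of genuine collapses found in h; these are fixed, so C is in
       the cut. *)
    destruct (sep HB V (fun z => ∃ r ∈ PQ, ∃ p ∈ h, (∀ s ∈ Pv, ~ is_empty M s ->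
      exists i, i ∈ s /\ forall l, l ∈ s -> ~ related M r l i) /\ collapse M p r (g v) /\
      ∃ i ∈ g v, related M p i z)) as [C HC].
    { dapp; cbv beta; dapp; cbv beta; dapp; [dfn|]; dapp; [|dfn]; dx @D_collapse; dT. }
    destruct (cut_closed C) as [c <-].
    { intros z Hz; apply HC in Hz; destruct Hz as [_ [r [Hr [p [Hp [K1 [K2 [i [Hi Hz]]]]]]]]].
      apply (cut_collapse p r v i z); auto; [|apply wfE; auto].
      intros q Hq; apply HQ, (proj1 (HPQ r)); auto. }
    (* Members of h need not lie in the cut, but their restrictions to v × C do; the powerset of v ×
       C witnesses H. *)
    destruct (b_prod M HB (g v) (g c)) as [D HD].
    destruct (cut_closed D) as [d <-].
    { intros q Hq; apply HD in Hq; destruct Hq as [a [Ha [b [Hb Ho]]]].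
      destruct (in_tr g Hg _ _ Ha) as [a' <-], (in_tr g Hg _ _ Hb) as [b' <-].
      apply (cut_opair q a' b'); auto. }
    destruct (pow d) as [e He]; exists e; intros r Hr Hw.
    destruct (Hh r Hr Hw) as [p [Hp [P1 P2]]].
    assert (rQ : r ∈ PQ) by (apply HPQ; intros q Hq; apply HQ, Hr, Hq).
    destruct (mkrel HB (g v) (g c) (fun a b => related M p a b)) as [p' [K1 K2]]; [dfn|].
    assert (E : forall i z, i ∈ g v -> (related M p' i z <-> related M p i z)).
    { intros i z Hi; rewrite K2; split; [tauto|]; intros Hz; split; auto; split; auto.
      apply HC; split; [apply (HV p i); auto|]; exists r; split; auto; exists p; split; auto.
      split; [apply wfE; auto|]; split; [split; auto|eauto]. }
    exists p'; split; [apply He; intros q Hq; apply HD, K1, Hq|]; split.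
    + intros i Hi; destruct (P1 i Hi) as [z Hz]; exists z; apply E; auto.
    + intros i Hi x Hx; apply (E i x Hi) in Hx; destruct (P2 i Hi x Hx) as [A1 [A2 A3]]; split.
      * intros x' Hx'; apply (E i x' Hi) in Hx'; auto.
      * split.
        -- intros z Hz; destruct (A2 z Hz) as [l [Hl [Hli Hlz]]]; exists l; repeat split; auto.
           apply E; auto.
        -- intros l Hl Hli; destruct (A3 l Hl Hli) as [z [Hz Hlz]]; exists z; split; auto.
           apply E; auto.
Qed.

(** If the ordinal a were not included in the ordinal m, the least element of a outside m would be
    standard and include m, and so m would be standard. *)
Lemma cut_below (a m : M) : (exists b, g b = a) -> is_transitive M a ->
  (forall x, x ∈ a -> is_transitive M x) -> ~ (exists b, g b = m) -> is_transitive M m ->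
  (forall x y, x ∈ m -> y ∈ m -> x ∈ y \/ x = y \/ y ∈ x) -> subset M a m.
Proof using HM Hg Hj img.
  pose proof (Mac_BST M (MOST_Mac M HM)) as HB.
  intros [a' <-] Ha Hha Hm Hmt Hlin; apply NNPP; intros Hn.
  destruct (min_def HB (g a') (fun x => ~ x ∈ m)) as [b [Hb [Hbm Hmin]]]; [dfn| |].
  { apply NNPP; intros K; apply Hn; intros x Hx; apply NNPP; intros Hxm; apply K; eauto. }
  assert (bm : subset M b m).
  { intros x Hx; apply NNPP; apply (Hmin x Hx); apply (Ha b); auto. }
  apply Hm, cut_closed; intros z Hz.
  assert (mb : subset M m b).
  { apply NNPP; intros K.
    destruct (min_def HB m (fun x => ~ x ∈ b)) as [c [Hc [Hcb Hcmin]]]; [dfn| |].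
    { apply NNPP; intros K'; apply K; intros x Hx; apply NNPP; intros Hxm; apply K'; eauto. }
    assert (c = b); [|subst; auto].
    apply (ext HB); intros x; split; intros Hx.
    - apply NNPP; apply (Hcmin x Hx), (Hmt c); auto.
    - destruct (Hlin x c) as [|[E|E]]; auto.
      + subst x; contradiction.
      + case Hcb; apply (Hha b Hb x); auto. }
  destruct (in_tr g Hg _ _ Hb) as [b' <-]; apply (in_tr g Hg b'), mb, Hz.
Qed.

Context (Hnt : exists x, ~ exists b, g b = x).

(* A nonstandard ordinal k; the sets coded on standard m ∈ k are standard, while those coded
   on a nonstandard m ∈ k include all standard sets.  So if no standard set bounds the
   witnesses, the standard part of k is definable, contradicting that k has no least
   nonstandard element. *)
Lemma cut_collection : collection N Delta0P.
Proof using HM Hg Hj img Hnt.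
  intros p Hp rho w Hw; apply NNPP; intros Hno.
  pose proof (MOST_Mac M HM) as HMac; pose proof (Mac_BST M HMac) as HB.
  pose proof (MOST_AxH M HM) as HH.
  destruct Hnt as [x1 Hx1]; destruct (Mac_pairing M HMac x1 x1) as [s1 Hs1].
  destruct (Mac_transitive_containment M HMac s1) as [T0 [HT0 HsT]].
  assert (HxT : x1 ∈ T0) by (apply HsT, Hs1; auto).
  destruct (ordcode_ex HMac HH T0) as [R0 [p0 [k HO]]].
  destruct (HH k) as [h Hh], (values_ex M HB h) as [V HV].
  destruct (b_prod M HB k k) as [Q HQ], (Mac_powerset M HMac Q) as [PQ HPQ].
  destruct (Mac_powerset M HMac k) as [Pk HPk].
  assert (wfE : forall r, wfrel M r k <-> ∀ s ∈ Pk, ~ is_empty M s ->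
      exists i, i ∈ s /\ forall l, l ∈ s -> ~ related M r l i).
  { intros r; split; intros K s Hs; apply K; apply HPk; auto. }
  (* Otherwise the nonstandard x1 would be a value of the collapse of a relation on a standard set,
     hence fixed. *)
  assert (HkN : ~ exists b, g b = k).
  { intros [k' Ek]; destruct (oc_code HMac T0 R0 p0 k HT0 HO k) as [r [Hr [Hrw Hc]]]; [intros z; auto|].
    destruct (Hh r Hr Hrw) as [s [_ Hs]]; destruct (Hc s Hs x1 HxT) as [a [Ha Hax]].
    subst k; apply Hx1, (cut_collapse s r k' a x1); auto. }
  (* [Cod m z]: z is coded on m. The relation lives on m but is collapsed over all of k, so that the
     one set h serves every m in k. *)
  set (Cod := fun m z => ∃ r ∈ PQ, ∃ s ∈ h, rel_on M r m /\ (∀ s ∈ Pk, ~ is_empty M s ->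
      exists i, i ∈ s /\ forall l, l ∈ s -> ~ related M r l i) /\ collapse M s r k /\
      ∃ i ∈ m, related M s i z).
  assert (DCod : forall x0, Dfn (fam1 M x0) KD0 (fun _ e => Cod (e 1) (e 0))).
  { intros x0; unfold Cod; cbv beta; dapp; cbv beta; dapp; cbv beta; dapp; [dx @D_rel_on; dT|].
    dapp; [dfn|]; dapp; [|dfn]; dx @D_collapse; dT. }
  destruct (sep HB V (fun z => Cod k z)) as [Om HOm].
  { refine (@D_sub2 (fam1 M V) KD0 _ _ _ _ (fun _ => Cod) (DCod V)); dT. }
  assert (wf_up : forall r m, subset M m k -> rel_on M r m -> (wfrel M r m <-> wfrel M r k)).
  { intros r m Hmk Hr; split; intros H s Hs Hne.
    - destruct (classic (exists a, a ∈ s /\ ~ a ∈ m)) as [[a [Ha Ham]]|K].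
      + exists a; split; auto; intros l Hl [q [Hq Ho]].
        destruct (Hr q Hq) as [b [Hb [c [Hc Ho']]]]; destruct (opair_inj HB _ _ _ _ _ Ho Ho').
        subst; contradiction.
      + apply H; auto; intros a Ha; apply NNPP; intros Ham; apply K; eauto.
    - apply H; auto; intros z Hz; apply Hmk, Hs, Hz. }
  assert (coll_down : forall s r m, subset M m k -> rel_on M r m -> collapse M s r k ->
    collapse M s r m).
  { intros s r m Hmk Hr [A1 A2]; split; [intros i Hi; apply A1; auto|].
    intros i Hi x Hx; destruct (A2 i (Hmk i Hi) x Hx) as [B1 [B2 B3]]; split; auto; split.
    - intros z Hz; destruct (B2 z Hz) as [l [Hl [Hli Hlz]]]; exists l; split; auto.
      destruct Hli as [q [Hq Ho]]; destruct (Hr q Hq) as [b [Hb [c [Hc Ho']]]].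
      destruct (opair_inj HB _ _ _ _ _ Ho Ho'); subst; auto.
    - intros l Hl Hli; apply B3; auto. }
  assert (rPQ : forall r m, subset M m k -> rel_on M r m -> r ∈ PQ).
  { intros r m Hmk Hr; apply HPQ; intros q Hq; destruct (Hr q Hq) as [a [Ha [b [Hb Ho]]]].
    apply HQ; exists a; split; auto; exists b; auto. }
  pose proof (oc_trans T0 R0 p0 k HO) as kt.
  assert (mk : forall m, m ∈ k -> subset M m k) by (intros m Hm z Hz; apply (kt m); auto).
  assert (CodOm : forall m z, subset M m k -> Cod m z -> z ∈ Om).
  { intros m z Hm [r [Hr [s [Hs [K1 [K2 [K3 [i [Hi Hz]]]]]]]]]; apply HOm; split; [apply (HV s i); auto|].
    exists r; split; auto; exists s; split; auto; split; [|split; auto; split; eauto].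
    intros q Hq; apply HQ, (proj1 (HPQ r)); auto. }
  assert (Std : forall m z, m ∈ k -> (exists b, g b = m) -> Cod m z -> exists b, g b = z).
  { intros m z Hm [m' <-] [r [Hr [s [Hs [K1 [K2 [K3 [i [Hi Hz]]]]]]]]].
    apply (cut_collapse s r m' i z); auto; apply wf_up; auto; apply wfE; auto. }
  assert (Nst : forall m, subset M m k -> is_transitive M m -> ~ (exists b, g b = m) ->
    forall b, Cod m (g b)).
  { intros m Hm Hmt HmN b; destruct (fixed_transitive HMac j (g b)) as [t [Ht [Hbt K]]]; [apply img; eauto|].
    destruct (cut_closed t) as [t' <-]; [intros z Hz; apply img, K, Hz|].
    destruct (ordcode_ex HMac HH (g t')) as [R1 [p1 [k1 HO1]]].
    assert (Hk1 : exists b, g b = k1).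
    { apply cut_closed; intros z Hz; apply (proj2 (proj2 (proj2 HO1))) in Hz.
      destruct Hz as [i [Hi Hz]]; apply (cut_collapse p1 R1 t' i z); auto;
        [exact (proj1 (proj1 HO1))|exact (proj1 (proj2 HO1))|exact (proj1 (proj2 (proj2 HO1)))]. }
    assert (k1m : subset M k1 m).
    { apply cut_below; auto.
      - apply (oc_trans (g t') R1 p1 k1 HO1).
      - apply (oc_htrans (g t') R1 p1 k1 HO1).
      - intros x y Hx Hy; apply (oc_lin T0 R0 p0 k HO); auto. }
    destruct (oc_code HMac (g t') R1 p1 k1 Ht HO1 m k1m) as [r [Hr [Hrw Hc]]].
    destruct (Hh r) as [s [Hs Hsc]].
    { intros q Hq; destruct (Hr q Hq) as [a [Ha [c [Hcc Ho]]]]; exists a; split; auto; exists c; auto. }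
    { apply (wf_up r m); auto. }
    destruct (Hc s) with (x := g b) as [a [Ha Hax]]; auto.
    exists r; split; [apply (rPQ r m); auto|]; exists s; split; auto; split; auto; split.
    - apply wfE, (wf_up r m); auto.
    - split; eauto. }
  assert (NOm : forall b, g b ∈ Om).
  { intros b; apply (CodOm k); [intros z; auto|]; apply Nst; auto; intros z; auto. }
  assert (Omt : is_transitive M Om).
  { intros u Hu z Hz; apply HOm in Hu.
    destruct Hu as [_ [r [Hr [s [Hs [K1 [K2 [K3 [i [Hi Hu]]]]]]]]]].
    destruct (proj2 K3 i Hi u Hu) as [_ [A _]]; destruct (A z Hz) as [l [Hl [_ Hlz]]].
    apply (CodOm k); [intros y; auto|]; exists r; split; auto; exists s; split; auto.
    split; auto; split; auto; split; eauto. }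
  (* Om, the set of all sets coded on k, contains N as an initial part to whose elements it adds no
     subsets. Thus p means the same in N and in Om, and relativized to Om it is [Delta0] in M. *)
  set (SO := substructure M (fun x => x ∈ Om)).
  set (g' := fun b : N => exist (fun x => x ∈ Om) (g b) (NOm b) : SO).
  assert (Hg' : initial g').
  { constructor.
    - intros a b E; apply (in_inj g Hg); exact (f_equal (@proj1_sig _ _) E).
    - intros a b; apply (in_mem g Hg).
    - intros a [x Hx] Hxa; destruct (in_tr g Hg a x Hxa) as [b Hb]; exists b.
      apply subset_eq_compat; auto. }
  assert (Hsc : subclosed g').
  { intros a [x Hx] Hxa; destruct (cut_subclosed a x) as [b Hb].
    - intros z Hz; assert (HzO : z ∈ Om) by (apply (Omt x); auto).
      apply (Hxa (exist _ z HzO)), Hz.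
    - exists b; apply subset_eq_compat; auto. }
  set (ts := fun y x n => match n with 0 => Om | 1 => y | 2 => x | S (S (S n)) => g (rho n) end).
  assert (Abs : forall x y, sat (scons y (scons x rho)) p <-> sat (ts (g y) (g x)) (rel 0 p)).
  { intros x y; rewrite (sat_absolute_P g' Hg' p Hp (or_introl Hsc)).
    apply sat_rel; [reflexivity|]; intros [|[|n]]; reflexivity. }
  destruct (sep HB k (fun m => ~ ∀ x ∈ g w, ∃ y ∈ Om, Cod m y /\ sat (ts y x) (rel 0 p))) as [Z HZ].
  { dapp; dapp; cbv beta; dapp; cbv beta; dapp.
    - refine (@D_sub2 (fam1 M k) KD0 _ _ _ _ (fun _ => Cod) (DCod k)); dT.
    - apply (@D_ext (fam1 M k) KD0 _ (fun _ e => sat (fun n => match n with 0 => Om | 1 => e 0 | 2 => e 1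
        | S (S (S n)) => g (rho n) end) (rel 0 p))).
      { intros; apply sat_ext; intros [|[|[|n]]]; reflexivity. }
      apply (@D_subst (fam1 M k) KD0 (fun _ e => sat (fun n => e n) (rel 0 p))
        (fun n _ e => match n with 0 => Om | 1 => e 0 | 2 => e 1 | S (S (S n)) => g (rho n) end)).
      + apply (@D_sat (fam1 M k) KD0 _ (fun n => n)), rel_Delta0.
      + intros [|[|[|n]]]; dT. }
  (* A nonstandard m codes all of N and therefore suffices. If a standard m sufficed, the set of
     what it codes would be standard and bound the witnesses, contrary to [Hno]. *)
  assert (ZN : forall m, m ∈ Z <-> m ∈ k /\ exists b, g b = m).
  { intros m; rewrite HZ; split; intros [Hm K]; split; auto.
    - apply NNPP; intros HmN; apply K; intros x Hx; destruct (in_tr g Hg _ _ Hx) as [x' <-].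
      destruct (Hw x') as [y Hy]; [apply (in_mem g Hg), Hx|].
      exists (g y); split; auto; split; [apply Nst; auto|apply Abs, Hy].
      apply (oc_htrans T0 R0 p0 k HO); auto.
    - intros G; destruct (sep HB Om (fun z => Cod m z)) as [C HC].
      { refine (@D_sub2 (fam1 M Om) KD0 _ _ _ _ (fun _ => Cod) (DCod Om)); dT. }
      destruct (cut_closed C) as [c <-].
      { intros z Hz; apply HC in Hz; apply (Std m z); tauto. }
      apply Hno; exists c; intros x Hx; destruct (G (g x)) as [y [Hy [K1 K2]]]; [apply (in_mem g Hg), Hx|].
      destruct (Std m y Hm K K1) as [y' <-]; exists y'; split; [|apply Abs, K2].
      apply (in_mem g Hg), HC; auto. }
  (* Either a least nonstandard m, or k itself, would have only standard elements and so be
     standard. *)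
  destruct (classic (exists m, m ∈ k /\ ~ m ∈ Z)) as [K|K].
  - destruct (min_def HB k (fun m => ~ m ∈ Z)) as [m [Hm [HmZ Hmin]]]; [dfn|auto|].
    apply HmZ, ZN; split; auto; apply cut_closed; intros z Hz.
    assert (Hz' : z ∈ Z) by (apply NNPP, Hmin; auto; apply (kt m); auto).
    apply ZN in Hz'; tauto.
  - apply HkN, cut_closed; intros z Hz.
    assert (Hz' : z ∈ Z) by (apply NNPP; intros N0; apply K; eauto).
    apply ZN in Hz'; tauto.
Qed.
End Cut.

(** * Transitive sets as structures *)

Lemma tree_eq_refl t : tree_eq t t.
Proof. induction t as [A f IH]; simpl; split; intros a; exists a; auto. Qed.

Lemma tree_eq_sym s : forall t, tree_eq s t -> tree_eq t s.
Proof.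
  induction s as [A f IH]; intros [B h] [H1 H2]; split.
  - intros b; destruct (H2 b) as [a Ha]; exists a; auto.
  - intros a; destruct (H1 a) as [b Hb]; exists b; auto.
Qed.

Lemma tree_eq_trans s : forall t u, tree_eq s t -> tree_eq t u -> tree_eq s u.
Proof.
  induction s as [A f IH]; intros [B h] [C k] [H1 H2] [K1 K2]; split.
  - intros a; destruct (H1 a) as [b Hb], (K1 b) as [c Hc]; exists c; eauto.
  - intros c; destruct (K2 c) as [b Hb], (H2 b) as [a Ha]; exists a; eauto.
Qed.

Lemma zset_eq (x y : zset) : proj1_sig x = proj1_sig y -> x = y.
Proof. destruct x, y; simpl; intros; apply subset_eq_compat; auto. Qed.

Lemma zset_of_eq s t : zset_of s = zset_of t <-> tree_eq s t.
Proof.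
  split; intros H.
  - apply (f_equal (@proj1_sig _ _)) in H; simpl in H; rewrite H; apply tree_eq_refl.
  - apply zset_eq; simpl; apply functional_extensionality; intros u.
    apply propositional_extensionality; split; intros K.
    + apply tree_eq_trans with s; auto; apply tree_eq_sym; auto.
    + apply tree_eq_trans with t; auto.
Qed.

Lemma zset_rep (x : zset) : exists t, x = zset_of t.
Proof. destruct x as [c [t Ht]]; exists t; apply zset_eq; auto. Qed.

Lemma zmem_node (x : zset) A f : zmem x (zset_of (node A f)) <-> exists a, x = zset_of (f a).
Proof.
  destruct (zset_rep x) as [t ->]; split.
  - intros [s [u [H1 [H2 H3]]]]; simpl in *.
    destruct u as [B h]; destruct H3 as [b Hb], H2 as [_ H2]; destruct (H2 b) as [a Ha].
    exists a; apply zset_of_eq; apply tree_eq_trans with s; auto.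
    apply tree_eq_trans with (h b); auto; apply tree_eq_sym; auto.
  - intros [a Ha]; exists t, (node A f); split; [apply tree_eq_refl|split; [apply tree_eq_refl|]].
    exists a; apply zset_of_eq; auto.
Qed.

Lemma zmem_ind (P : zset -> Prop) : (forall x, (forall y, zmem y x -> P y) -> P x) -> forall x, P x.
Proof.
  intros H x; destruct (zset_rep x) as [t ->].
  induction t as [A f IH]; apply H; intros y Hy; apply zmem_node in Hy; destruct Hy as [a ->]; auto.
Qed.

Lemma zmem_succ x t : zmem x (zset_of (tree_succ t)) <-> zmem x (zset_of t) \/ x = zset_of t.
Proof.
  destruct t as [A f]; unfold tree_succ; rewrite !zmem_node; split.
  - intros [[a|] ->]; [left; exists a|right]; auto.
  - intros [[a ->]| ->]; [exists (Some a)|exists None]; auto.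
Qed.

Definition wf_structure (S : structure) : Prop :=
  forall P : S -> Prop, (forall a, (forall b, b ∈ a -> P b) -> P a) -> forall a, P a.

Section TransitiveSet.
Context (I : zset) (htrans : ztransitive I) (homega : zmem omega I).
Let S := in_structure I.

Lemma in_structure_wf : wf_structure S.
Proof using htrans.
  intros P H [x Hx]; revert Hx; induction x as [x IH] using zmem_ind; intros Hx.
  apply H; intros [y Hy] Hyx; apply IH; auto.
Qed.

Definition om_el : S := exist (fun y => zmem y I) omega homega.

Lemma nat_in n : zmem (zset_of (tree_nat n)) I.
Proof using htrans homega. apply (htrans omega); auto; apply zmem_node; eauto. Qed.

Definition nat_el n : S := exist (fun y => zmem y I) (zset_of (tree_nat n)) (nat_in n).

Lemma in_om (x : S) : x ∈ om_el <-> exists n, x = nat_el n.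
Proof using htrans homega.
  destruct x as [x Hx]; unfold om_el; simpl; unfold omega; rewrite zmem_node; split; intros [n E]; exists n.
  - apply subset_eq_compat; auto.
  - apply (f_equal (@proj1_sig _ _)) in E; auto.
Qed.

Lemma nat_el_0 : is_empty S (nat_el 0).
Proof using htrans homega. intros [y Hy] H; simpl in H; apply zmem_node in H; destruct H as [[] _]. Qed.

Lemma nat_el_S n : is_succ S (nat_el (Datatypes.S n)) (nat_el n).
Proof using htrans homega.
  intros [z Hz]; simpl; rewrite zmem_succ; split; intros [H|H]; auto; right.
  - apply subset_eq_compat; auto.
  - apply (f_equal (@proj1_sig _ _)) in H; auto.
Qed.

Lemma om_inductive : inductive_set om_el.
Proof using htrans homega.
  split.
  - exists (nat_el 0); split; [apply in_om; eauto|apply nat_el_0].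
  - intros y Hy; apply in_om in Hy; destruct Hy as [n ->]; exists (nat_el (Datatypes.S n)).
    split; [apply in_om; eauto|apply nat_el_S].
Qed.

Lemma om_num (HB : BST S) x : x ∈ om_el -> exists n, x = num HB n.
Proof using htrans homega.
  intros Hx; apply in_om in Hx; destruct Hx as [n ->]; exists n.
  induction n as [|n IH].
  - apply (empty_unique HB); [apply nat_el_0|apply num_0].
  - apply (succ_unique HB _ _ (nat_el n)); [apply nat_el_S|rewrite IH; apply num_S].
Qed.

Lemma automorphism_to_MOST (M : structure) (j : M -> M) : MOST M -> automorphism j ->
  ~ (forall x : M, j x = x) -> isomorphic (Ifix j) S ->
  MOST S /\ collection S Delta0P.
Proof using htrans homega.
  intros HM Hj Hn [f [[finj fsur] fmem]].
  pose proof (MOST_Mac M HM) as HMac.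
  set (g := fun b : S => proj1_sig (proj1_sig (constructive_indefinite_description _ (fsur b)))).
  assert (gf : forall x, g (f x) = proj1_sig x).
  { intros x; unfold g; destruct constructive_indefinite_description as [y Hy]; simpl.
    rewrite (finj _ _ Hy); auto. }
  assert (img : forall x, (exists b, g b = x) <-> fixed j x).
  { intros x; split.
    - intros [b <-]; destruct (fsur b) as [y <-]; rewrite gf; exact (proj2_sig y).
    - intros Hx; exists (f (exist _ x Hx)); rewrite gf; auto. }
  assert (Hg : initial g).
  { constructor.
    - intros a b; destruct (fsur a) as [x <-], (fsur b) as [y <-]; rewrite !gf; intros E.
      f_equal; destruct x, y; simpl in E; apply subset_eq_compat; auto.
    - intros a b; destruct (fsur a) as [x <-], (fsur b) as [y <-]; rewrite !gf.
      rewrite <- (fmem x y); reflexivity.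
    - intros a x Hx; apply img, (fixed_mem HMac j (g a)); auto; apply img; eauto. }
  split.
  - apply (cut_MOST HM j Hj g Hg img om_el om_inductive).
  - apply (cut_collection HM j Hj g Hg img).
    apply NNPP; intros K; apply Hn; intros x; apply (fixed_j HMac).
    apply img, NNPP; intros K'; apply K; exists x; auto.
Qed.
End TransitiveSet.

(** * Powerset-bounded separation *)

Lemma sub_initial (M : structure) (X : M) : is_transitive M X ->
  @initial (substructure M (fun x => x ∈ X)) M (fun x => proj1_sig x).
Proof.
  intros HX; constructor.
  - intros [a Ha] [b Hb] E; simpl in E; apply subset_eq_compat; auto.
  - intros a b; reflexivity.
  - intros [a Ha] x Hx; exists (exist _ x (HX a Ha x Hx)); auto.
Qed.

(** For a transitive t with the parameters in it, P(t) is transitive and closed under subsets of its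
    elements, so powerset-bounded formulas are absolute for it; relativized to P(t) they are
    [Delta0]. *)
Lemma Mac_separation_P (M : structure) : Mac M -> separation M Delta0P.
Proof.
  intros HM p Hp rho w; pose proof (Mac_BST M HM) as HB.
  destruct (finite_set_ex M HB rho (bnd p)) as [f Hf].
  destruct (adj_ex HB f w) as [f' Hf'], (union2_ex HB f' w) as [f2 Hf2].
  destruct (Mac_transitive_containment M HM f2) as [t [Ht Hft]], (Mac_powerset M HM t) as [X HX].
  assert (XT : is_transitive M X).
  { intros u Hu z Hz; apply HX in Hu; apply HX; intros y Hy; apply (Ht z); auto. }
  assert (tX : forall x, x ∈ t -> x ∈ X) by (intros x Hx; apply HX; intros y Hy; apply (Ht x); auto).
  set (SX := substructure M (fun x => x ∈ X)).
  assert (Hi := sub_initial M X XT).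
  assert (Hc : @subclosed SX M (fun x => proj1_sig x)).
  { intros [a Ha] x Hx; assert (Hx' : x ∈ X).
    { apply HX; intros z Hz; apply (proj1 (HX a)); auto. }
    exists (exist _ x Hx'); auto. }
  assert (HwX : w ∈ X) by (apply tX, Hft, Hf2; left; apply Hf'; auto).
  set (r' := fun n => if n <? bnd p then rho n else w).
  assert (Hr' : forall n, r' n ∈ X).
  { intros n; unfold r'; destruct (Nat.ltb_spec n (bnd p)); auto.
    apply tX, Hft, Hf2; left; apply Hf'; auto. }
  set (r := fun n => exist (fun x => x ∈ X) (r' n) (Hr' n) : SX).
  set (ts := fun x n => match n with 0 => X | 1 => x | S (S n) => r' n end).
  assert (E : forall x, x ∈ w -> (sat (scons x rho) p <-> sat (ts x) (rel 0 p))).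
  { intros x Hx; assert (HxX : x ∈ X) by (apply tX, Hft, Hf2; auto).
    rewrite <- (sat_rel M X p 0 (scons (exist _ x HxX) r) (ts x)).
    - rewrite (sat_absolute_P _ Hi p Hp (or_introl Hc)).
      apply sat_bnd; intros [|n] Hn; simpl; auto; unfold r'.
      destruct (Nat.ltb_spec n (bnd p)); auto; lia.
    - reflexivity.
    - intros [|n]; reflexivity. }
  destruct (sep HB w (fun x => sat (ts x) (rel 0 p))) as [y Hy].
  { apply (@D_ext (fam1 M w) KD0 _ (fun _ e => sat (fun n => match n with 0 => X | 1 => e 0
      | S (S n) => r' n end) (rel 0 p))).
    { intros; apply sat_ext; intros [|[|n]]; reflexivity. }
    apply (@D_subst (fam1 M w) KD0 (fun _ e => sat (fun n => e n) (rel 0 p))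
      (fun n _ e => match n with 0 => X | 1 => e 0 | S (S n) => r' n end)).
    - apply (@D_sat (fam1 M w) KD0 _ (fun n => n)), rel_Delta0.
    - intros [|[|n]]; dT. }
  exists y; intros x; rewrite Hy; split; intros [H1 H2]; split; auto; apply E; auto.
Qed.

(** * Models of Mac and H inside a power-admissible set *)

Section WfLemmas.
Context {M : structure} (HB : BST M).

Lemma wfrel_up (r m k : M) : subset M m k -> rel_on M r m -> wfrel M r m -> wfrel M r k.
Proof using HB.
  intros Hmk Hr H s Hs Hne.
  destruct (classic (exists a, a ∈ s /\ ~ a ∈ m)) as [[a [Ha Ham]]|K].
  - exists a; split; auto; intros l Hl [q [Hq Ho]].
    destruct (Hr q Hq) as [b [Hb [c [Hc Ho']]]]; destruct (opair_inj HB _ _ _ _ _ Ho Ho').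
    subst; contradiction.
  - apply H; auto; intros a Ha; apply NNPP; intros Ham; apply K; eauto.
Qed.

Lemma collapse_restrict (p p' r m k : M) : subset M m k -> rel_on M r m -> collapse M p r k ->
  (forall i z, i ∈ m -> (related M p' i z <-> related M p i z)) -> collapse M p' r m.
Proof using HB.
  intros Hmk Hr [A1 A2] E; split; [intros i Hi; destruct (A1 i) as [z Hz]; auto; exists z; apply E; auto|].
  intros i Hi x Hx; apply (E i x Hi) in Hx; destruct (A2 i (Hmk i Hi) x Hx) as [B1 [B2 B3]]; split.
  - intros x' Hx'; apply B1, (E i); auto.
  - split.
    + intros z Hz; destruct (B2 z Hz) as [l [Hl [Hli Hlz]]]; exists l.
      assert (l ∈ m).
      { destruct Hli as [q [Hq Ho]]; destruct (Hr q Hq) as [b [Hb [c [Hc Ho']]]].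
        destruct (opair_inj HB _ _ _ _ _ Ho Ho'); subst; auto. }
      split; auto; split; auto; apply E; auto.
    + intros l Hl Hli; destruct (B3 l) as [z [Hz Hlz]]; auto; exists z; split; auto; apply E; auto.
Qed.
End WfLemmas.

Section Chain.
Context {M : structure} (HM : MOST M) (HP : collection M Delta0P).
Let HMac := MOST_Mac M HM.
Let HB := Mac_BST M HMac.
Context (om : M) (Hom : inductive_set om) (std : forall x, x ∈ om -> exists n, x = num HB n).
Context (t0 : M) (Ht0 : is_transitive M t0) (Hot : om ∈ t0).

Definition Zval (b x : M) : Prop := exists r, rel_on M r b /\ wfrel M r b /\
  exists p, collapse M p r b /\ ∃ i ∈ b, related M p i x.

Definition Step (b z : M) : Prop := forall x, x ∈ z <-> subset M x b \/ Zval b x.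

(** [Step] in powerset-bounded form: the reservoir A supplies b × b and a set of collapses, and the
    other quantifiers range over subsets or elements of sets at hand. *)
Definition StepA (b z A : M) : Prop := ∃ h ∈ A, ∃ q ∈ A,
  (∀ p ∈ q, ∃ x ∈ b, ∃ y ∈ b, is_opair M p x y) /\ (∀ x ∈ b, ∀ y ∈ b, ∃ p ∈ q, is_opair M p x y) /\
  (forall r, subset M r q -> wfrel M r b -> ∃ p ∈ h, collapse M p r b) /\
  (∀ x ∈ z, subset M x b \/ exists r, subset M r q /\ wfrel M r b /\
     ∃ p ∈ h, collapse M p r b /\ ∃ i ∈ b, related M p i x) /\
  (forall x, subset M x b -> x ∈ z) /\
  (forall r, subset M r q -> wfrel M r b -> ∀ p ∈ h, collapse M p r b -> ∀ i ∈ b,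
     forall x, related M p i x -> x ∈ z).

Lemma StepA_Step b z A : StepA b z A -> Step b z.
Proof using HM.
  intros [h [_ [q [_ [Q1 [Q2 [H1 [H2 [H3 H4]]]]]]]]].
  assert (Q3 : forall r, subset M r q <-> rel_on M r b).
  { intros r; split; intros H p Hp.
    - apply Q1, H, Hp.
    - destruct (H p Hp) as [x [Hx [y [Hy Ho]]]]; destruct (Q2 x Hx y Hy) as [p' [Hp' Ho']].
      rewrite (opair_unique HB _ _ _ _ Ho Ho'); auto. }
  intros x; split; [intros Hx|intros [Hx|Hx]; auto].
  - destruct (H2 x Hx) as [|[r [Hr [Hw [p [Hp [Hc K]]]]]]]; auto; right; exists r.
    rewrite <- Q3; split; auto; split; auto; exists p; auto.
  - destruct Hx as [r [Hr [Hw [p [Hc [i [Hi Hx]]]]]]]; apply Q3 in Hr.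
    destruct (H1 r Hr Hw) as [p' [Hp' Hc']]; apply (H4 r Hr Hw p' Hp' Hc' i Hi).
    destruct (proj1 Hc' i Hi) as [x' Hx'].
    rewrite (collapse_unique HB p p' r b i x x'); auto.
Qed.

Lemma Step_unique b z z' : Step b z -> Step b z' -> z = z'.
Proof using HM. intros H H'; apply (ext HB); intros x; rewrite (H x), (H' x); tauto. Qed.

Lemma StepA_ex b : exists z A, StepA b z A.
Proof using HM.
  destruct (MOST_AxH M HM b) as [h Hh], (values_ex M HB h) as [V HV].
  destruct (b_prod M HB b b) as [q Hq], (Mac_powerset M HMac q) as [Q HQ].
  destruct (Mac_powerset M HMac b) as [Pb HPb], (union2_ex HB V Pb) as [V' HV'].
  assert (wfE : forall r, wfrel M r b <-> ∀ s ∈ Pb, ~ is_empty M s ->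
      exists i, i ∈ s /\ forall l, l ∈ s -> ~ related M r l i).
  { intros r; split; intros K s Hs; apply K; apply HPb; auto. }
  destruct (sep HB V' (fun x => subset M x b \/ ∃ r ∈ Q, (∀ s ∈ Pb, ~ is_empty M s ->
      exists i, i ∈ s /\ forall l, l ∈ s -> ~ related M r l i) /\
     ∃ p ∈ h, collapse M p r b /\ ∃ i ∈ b, related M p i x)) as [z Hz].
  { dapp; [dfn|]; dapp; cbv beta; dapp; [dfn|]; dapp; cbv beta; dapp; [dx @D_collapse; dT|dfn]. }
  destruct (pair_ex HB h q) as [A HA]; exists z, A, h; split; [apply HA; auto|].
  exists q; split; [apply HA; auto|]; repeat split.
  - intros p Hp; apply Hq, Hp.
  - intros x Hx y Hy; destruct (opair_ex HB x y) as [p Hp]; exists p; split; auto; apply Hq; eauto.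
  - intros r Hr Hw; apply Hh; auto; intros p Hp; apply Hq, Hr, Hp.
  - intros x Hx; apply Hz in Hx; destruct Hx as [_ [|[r [Hr [Hw K]]]]]; auto; right.
    exists r; split; [apply HQ; auto|]; split; auto; apply wfE; auto.
  - intros x Hx; apply Hz; split; auto; apply HV'; right; apply HPb; auto.
  - intros r Hr Hw p Hp Hc i Hi x Hx; apply Hz; split.
    + apply HV'; left; apply (HV p i); auto.
    + right; exists r; split; [apply HQ; auto|]; split; [apply wfE; auto|]; eauto 6.
Qed.

Lemma num_mem n l : l ∈ num HB n -> exists m, m < n /\ l = num HB m.
Proof using HM.
  induction n; intros H; [case (num_0 HB l H)|].
  apply (num_S HB n) in H; destruct H as [H| ->]; [|exists n; auto].
  destruct (IHn H) as [m [Hm E]]; exists m; split; auto.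
Qed.

Lemma chain_ex : exists (B : M) (bn : nat -> M), bn 0 = t0 /\
  (forall n, Step (bn n) (bn (S n))) /\ forall x, x ∈ B <-> exists n, x ∈ bn n.
Proof using HM HP Hom std.
  set (lt := fun l i : M => l ∈ i).
  set (Gm := fun F i z A : M => (is_empty M i /\ z = t0) \/
    ∃ k ∈ om, k ∈ i /\ is_succ M i k /\ exists b, related M F k b /\ StepA b z A).
  assert (Dlt : Dfn (fam1 M om) KD0 (fun _ e => lt (e 1) (e 0))) by (unfold lt; dfn).
  assert (DGm : Dfn (fam1 M om) KD0P (fun _ e => Gm (e 3) (e 2) (e 1) (e 0))).
  { unfold Gm, StepA; cbv beta; dapp; [dfn|]; dapp; cbv beta; do 2 (dapp; [dfn|]).
    dapp; cbv beta; dapp; cbv beta; dapp; cbv beta.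
    do 2 (dapp; [dfn|]); unfold wfrel; dapp; [|dapp; [|dapp; [dfn|]]].
    - dapp; cbv beta; dapp; [dfn|]; dapp; cbv beta; dx @D_collapse; dT.
    - dapp; cbv beta; dapp; [dfn|]; dapp; cbv beta; dapp; [dfn|]; dapp; cbv beta; dapp; [|dfn].
      dx @D_collapse; dT.
    - dapp; cbv beta; dapp; [dfn|]; dapp; cbv beta; dapp; [|dfn]; dx @D_collapse; dT. }
  assert (Hpred : forall i k, i ∈ om -> is_succ M i k -> k ∈ om /\ k ∈ i).
  { intros i k Hi Hs; split; [|apply Hs; auto].
    destruct (std i Hi) as [[|n] ->]; [case (num_0 HB k); apply Hs; auto|].
    rewrite (succ_inj HB k (num HB n) _ Hs (num_S HB n)); apply num_in, Hom. }
  destruct (recursion HB KD0P (Mac_separation_P M HMac) HP om lt Gm) as [F [A [HF Hdom]]]; auto.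
  - intros F F' i x A Hi Hag [H|[k [Hk [Hki [Hs [b [Hb K]]]]]]]; [left; auto|right].
    exists k; split; auto; split; auto; split; auto; exists b; split; auto; apply Hag; auto.
  - intros F i x A A' HA [H|[k [Hk [Hki [Hs [b [Hb [h [Hh [q [Hq K]]]]]]]]]]]; [left; auto|right].
    exists k; split; auto; split; auto; split; auto; exists b; split; auto.
    exists h; split; auto; exists q; split; auto.
  - intros F i x x' A A' Hi Hfun [[H1 H2]|[k [Hk [Hki [Hs [b [Hb K]]]]]]]
      [[H1' H2']|[k' [Hk' [Hki' [Hs' [b' [Hb' K']]]]]]].
    + congruence.
    + case (H1 k' Hki').
    + case (H1' k Hki).
    + rewrite (succ_inj HB _ _ _ Hs' Hs) in Hb'; rewrite (Hfun _ _ _ Hb' Hb) in K'.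
      apply (Step_unique b); eapply StepA_Step; eauto.
  - intros F i Hi Hd Hfun; destruct (std i Hi) as [[|n] ->].
    + exists t0, t0; left; split; auto; apply num_0.
    + assert (Hn : num HB n ∈ om) by (apply num_in, Hom).
      assert (Hni : num HB n ∈ num HB (S n)) by (apply num_S; auto).
      destruct (Hd _ Hn Hni) as [b Hb], (StepA_ex b) as [z [A HA]]; exists z, A; right.
      exists (num HB n); split; auto; split; auto; split; [apply num_S|eauto].
  - intros s Hs Hne; destruct (b_found M HB s Hne) as [i [Hi K]]; exists i; split; auto.
    intros l Hl Hli; apply (K l Hli Hl).
  (* Here ω is standard, so external induction replaces a separation principle for the class of i
     that have attempts. *)
  - intros H i Hi; destruct (std i Hi) as [n ->]; clear Hi.
    induction n as [n IH] using (well_founded_induction lt_wf).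
    apply H; [apply num_in, Hom|]; intros l Hl Hln.
    destruct (num_mem n l Hln) as [m [Hm ->]]; auto.
  - assert (Hb : forall n, exists b, related M F (num HB n) b) by (intros; apply Hdom, num_in, Hom).
    set (bn := fun n => proj1_sig (constructive_indefinite_description _ (Hb n))).
    assert (Hbn : forall n, related M F (num HB n) (bn n)).
    { intros n; unfold bn; destruct constructive_indefinite_description; auto. }
    assert (Ffun : forall i b b', related M F i b -> related M F i b' -> b = b').
    { intros i b b' H1 H2; symmetry; apply (HF _ _ H1); auto. }
    destruct (range_ex HB F) as [R HR].
    destruct (sep HB R (fun b => ∃ i ∈ om, related M F i b)) as [R' HR']; [dfn|].
    destruct (b_union M HB R') as [B HBu].
    exists B, bn; split; [|split].
    + destruct (HF _ _ (Hbn 0)) as [_ [_ [_ [[_ H]|[k [_ [Hk _]]]]]]]; auto.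
      case (num_0 HB k Hk).
    + intros n; destruct (HF _ _ (Hbn (S n))) as [_ [_ [_ [[H _]|[k [_ [_ [Hs [b [Hb' K]]]]]]]]]].
      * case (H (num HB n)); apply num_S; auto.
      * apply StepA_Step in K; rewrite (succ_inj HB _ _ _ Hs (num_S HB n)) in Hb'.
        rewrite (Ffun _ _ _ (Hbn n) Hb'); auto.
    + intros x; split; intros H; [apply HBu in H; revert H|apply HBu; revert H].
      * intros [b [Hb' Hx]]; apply HR' in Hb'; destruct Hb' as [_ [i [Hi Hib]]].
        destruct (std i Hi) as [n ->]; exists n; rewrite (Ffun _ _ _ (Hbn n) Hib); auto.
      * intros [n Hx]; exists (bn n); split; auto; apply HR'; split; [eauto|].
        exists (num HB n); split; auto; apply num_in, Hom.
Qed.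

(** Each level of the chain contains all subsets of the previous one and all values of collapses
    over it; the union of ω levels absorbs powersets, pairs and witnesses for H. *)
Lemma inner_model : exists B : M, is_transitive M B /\ subset M t0 B /\
  subclosed (fun x : substructure M (fun x => x ∈ B) => proj1_sig x) /\
  Mac (substructure M (fun x => x ∈ B)) /\ AxH (substructure M (fun x => x ∈ B)).
Proof using HM HP Hom std Ht0 Hot.
  destruct chain_ex as [B [bn [b0 [bS HBB]]]].
  assert (bt : forall n, is_transitive M (bn n)).
  { induction n; [rewrite b0; auto|]; intros x Hx y Hy; apply bS in Hx; apply bS.
    destruct Hx as [Hx|[r [Hr [Hw [p [Hc [i [Hi Hx]]]]]]]].
    - left; intros z Hz; apply (IHn y); auto.
    - right; exists r; split; auto; split; auto; exists p; split; auto.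
      destruct (proj2 Hc i Hi x Hx) as [_ [A _]]; destruct (A y Hy) as [l [Hl [_ Hly]]]; eauto. }
  assert (bsub : forall n x, subset M x (bn n) -> x ∈ bn (S n)) by (intros n x Hx; apply bS; auto).
  assert (bmon1 : forall n, subset M (bn n) (bn (S n))).
  { intros n x Hx; apply bsub; intros y Hy; apply (bt n x); auto. }
  assert (bmon : forall n m, n <= m -> subset M (bn n) (bn m)).
  { intros n m H; induction H; intros x Hx; auto; apply bmon1, IHle, Hx. }
  assert (inB : forall n x, x ∈ bn n -> x ∈ B) by (intros n x Hx; apply HBB; eauto).
  assert (BT : is_transitive M B).
  { intros x Hx y Hy; apply HBB in Hx; destruct Hx as [n Hx]; apply (inB n), (bt n x); auto. }
  set (SB := substructure M (fun x => x ∈ B)).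
  set (i := fun x : SB => proj1_sig x).
  assert (Hi : initial i) by (apply sub_initial; auto).
  assert (lift : forall x, x ∈ B -> exists b, i b = x) by (intros x Hx; exists (exist _ x Hx); auto).
  assert (Hc : subclosed i).
  { intros [a Ha] x Hx; apply lift; simpl in Hx; apply HBB in Ha; destruct Ha as [n Ha].
    apply (inB (S n)), bsub; intros z Hz; apply (bt n a); auto. }
  assert (t0B : subset M t0 B) by (intros x Hx; apply (inB 0); rewrite b0; auto).
  exists B; split; auto; split; auto; split; auto; split.
  - apply (good_Mac i Hi HMac); auto.
    + intros [a Ha] [b Hb]; destruct (pair_ex HB a b) as [p Hp].
      destruct (lift p) as [p' <-]; [|exists p'; auto].
      apply HBB in Ha; apply HBB in Hb; destruct Ha as [n Ha], Hb as [m Hb].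
      apply (inB (S (n + m))), bsub; intros z Hz; apply Hp in Hz; destruct Hz; subst.
      * apply (bmon n (n + m)); auto; lia.
      * apply (bmon m (n + m)); auto; lia.
    + intros [a Ha]; destruct (b_union M HB a) as [u Hu].
      destruct (lift u) as [u' <-]; [|exists u'; auto].
      apply HBB in Ha; destruct Ha as [n Ha]; apply (inB (S n)), bsub; intros z Hz.
      apply Hu in Hz; destruct Hz as [w [Hw Hz]]; apply (bt n w); auto; apply (bt n a); auto.
    + intros [a Ha]; destruct (Mac_powerset M HMac a) as [u Hu].
      destruct (lift u) as [u' <-]; [|exists u'; auto].
      apply HBB in Ha; destruct Ha as [n Ha]; apply (inB (S (S n))), bsub; intros z Hz.
      apply bsub; apply Hu in Hz; intros y Hy; apply (bt n a); auto.
    + intros [a Ha]; apply HBB in Ha as Ha'; destruct Ha' as [n Ha'].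
      destruct (lift (bn n)) as [t Ht]; [apply (inB (S n)), bsub; intros z; auto|].
      exists t; rewrite Ht; split; auto; intros z Hz; apply (bt n a); auto.
    + destruct (lift om) as [o Ho]; [apply t0B; auto|]; exists o; rewrite Ho; auto.
  - apply (good_AxH i Hi Hc); intros [v Hv]; apply HBB in Hv as Hv'; destruct Hv' as [n Hv'].
    (* The values of the collapse are in level n+1, pairs of such elements in level n+3, so the
       restricted collapse is in level n+4, which serves as h. *)
    destruct (lift (bn (S (S (S (S n)))))) as [h Hh]; [apply (inB (S (S (S (S (S n)))))), bsub; intros z; auto|].
    exists h; rewrite Hh; simpl; intros r Hr Hw.
    assert (vb : subset M v (bn n)) by (intros z Hz; apply (bt n v); auto).
    assert (Hr' : rel_on M r (bn n)).
    { intros q Hq; destruct (Hr q Hq) as [a [Ha [b [Hb Ho]]]]; exists a; split; auto; exists b; auto. }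
    assert (Hw' : wfrel M r (bn n)) by (apply (wfrel_up HB r v); auto).
    destruct (MOST_AxH M HM (bn n)) as [h0 Hh0], (Hh0 r Hr' Hw') as [p [_ Hp]].
    destruct (mkrel HB v (bn (S n)) (fun a b => related M p a b)) as [p' [K1 K2]]; [dfn|].
    exists p'; split.
    + apply bsub; intros q Hq; destruct (K1 q Hq) as [a [Ha [b [Hb [s [u [Hs [Hu Hq']]]]]]]].
      apply bsub; intros w Hw2; apply bsub; intros z Hz.
      assert (Ha' : a ∈ bn (S n)) by (apply bmon1, vb, Ha).
      apply Hq' in Hw2; destruct Hw2; subst w; [apply Hs in Hz|apply Hu in Hz]; destruct Hz; subst; auto.
    + apply (collapse_restrict HB p p' r v (bn n)); auto.
      intros l z Hl; rewrite K2; split; [tauto|]; intros Hz; split; auto; split; auto.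
      apply bS; right; exists r; split; auto; split; auto; exists p; split; eauto.
Qed.
End Chain.

(** * Ranked types of sequences *)

Section Props.
Context (X : structure).
Implicit Types om B W D L T : X.

Definition upd om (f' f i u : X) : Prop :=
  (∀ k ∈ om, ~ k = i -> (forall x, related X f' k x -> related X f k x) /\
    (forall x, related X f k x -> related X f' k x)) /\
  related X f' i u /\ (forall x, related X f' i x -> x = u).

(** In N the set W consists of all functions from ω to B. This cannot be said by a bounded formula,
    so only the closure properties listed here are carried to X. *)
Definition Wprop om B W : Prop :=
  (∃ f ∈ W, f = f) /\
  (∀ f ∈ W, ∀ i ∈ om, exists x, related X f i x /\ x ∈ B /\ forall x', related X f i x' -> x' = x) /\
  (∀ f ∈ W, ∀ i ∈ om, ∀ u ∈ B, ∃ f' ∈ W, upd om f' f i u) /\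
  (∀ f ∈ W, ∀ f' ∈ W, (∀ i ∈ om, forall x, related X f i x -> related X f' i x) -> f = f').

(* [D] is an algebra of subsets of [W] that contains the extension of every first-order
   formula over [B]; its last clause therefore yields full separation in [B]. *)
Definition Dprop om B W D : Prop :=
  (∀ i ∈ om, ∀ k ∈ om, ∃ R ∈ D, ∀ f ∈ W,
    (f ∈ R <-> exists x, related X f i x /\ exists y, related X f k y /\ x ∈ y)) /\
  (∀ i ∈ om, ∀ k ∈ om, ∃ R ∈ D, ∀ f ∈ W,
    (f ∈ R <-> exists x, related X f i x /\ related X f k x)) /\
  (∀ R ∈ D, ∀ R' ∈ D, ∃ R2 ∈ D, ∀ f ∈ W, (f ∈ R2 <-> ~ (f ∈ R /\ f ∈ R'))) /\
  (∀ R ∈ D, ∀ i ∈ om, ∃ R2 ∈ D, ∀ f ∈ W,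
    (f ∈ R2 <-> ∃ f' ∈ W, f' ∈ R /\ ∃ u ∈ B, upd om f' f i u)) /\
  (∀ R ∈ D, ∀ f ∈ W, ∀ i ∈ om, ∀ w ∈ B, ∃ z ∈ B, (∀ u ∈ z, u ∈ w) /\
    ∀ u ∈ w, (u ∈ z <-> ∃ f' ∈ W, upd om f' f i u /\ f' ∈ R)).

Definition Lprop L : Prop := ∀ y ∈ L, is_transitive X y /\ subset X y L.

Definition rel3 T (y f z : X) : Prop := exists q, is_opair X q y f /\ related X T q z.

(** The leading om tells these entries from the pairs of indices that record membership, since om is
    not an element of itself. *)
Definition Lab om (p w i z : X) : Prop :=
  exists p1, is_opair X p om p1 /\ exists p2, is_opair X p1 w p2 /\ is_opair X p2 i z.

(* z = {<i,k> : f(i) ∈ f(k)} ∪ {<om,<w,<i,T(w,f[i:=u])>>> : w ∈ y, u ∈ B} *)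
Definition Tval om B W T (y f z : X) : Prop :=
  (∀ p ∈ z, (∃ i ∈ om, ∃ k ∈ om, is_opair X p i k /\
      exists x, related X f i x /\ exists x', related X f k x' /\ x ∈ x') \/
    ∃ w ∈ y, ∃ i ∈ om, ∃ f' ∈ W, (∃ u ∈ B, upd om f' f i u) /\
      exists z', rel3 T w f' z' /\ Lab om p w i z') /\
  (∀ i ∈ om, ∀ k ∈ om, forall x, related X f i x -> forall x', related X f k x' -> x ∈ x' ->
    ∃ p ∈ z, is_opair X p i k) /\
  (∀ w ∈ y, ∀ i ∈ om, ∀ u ∈ B, ∀ f' ∈ W, upd om f' f i u -> forall z', rel3 T w f' z' ->
    ∃ p ∈ z, Lab om p w i z').

Definition Tprop om B W L T : Prop :=
  (∀ y ∈ L, ∀ f ∈ W, exists z, rel3 T y f z /\ z = z) /\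
  (∀ y ∈ L, ∀ f ∈ W, forall z, rel3 T y f z -> forall z', rel3 T y f z' -> z' = z) /\
  (∀ y ∈ L, ∀ f ∈ W, forall z, rel3 T y f z -> Tval om B W T y f z).
End Props.

Section PropsDfn.
Context {G : fam} {k : kind} (t0 t1 t2 t3 t4 t5 t6 : forall j, (nat -> fS G j) -> fS G j).
Context (P : forall j, (nat -> fS G j) -> fS G j -> Prop).
Hypothesis (H0 : IsT G t0) (H1 : IsT G t1) (H2 : IsT G t2) (H3 : IsT G t3) (H4 : IsT G t4).
Hypothesis (H5 : IsT G t5) (H6 : IsT G t6).
Hypothesis (HP : Dfn G k (fun j e => P j (fun i => e (S i)) (e 0))).

Lemma D_ex_rel3 : Dfn G k (fun j e => exists z, rel3 (fS G j) (t0 j e) (t1 j e) (t2 j e) z /\ P j e z).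
Proof using H0 H1 H2 HP.
  apply (D_ext _ (fun j e => exists q z, related (fS G j) (t0 j e) q z /\
    (is_opair (fS G j) q (t1 j e) (t2 j e) /\ P j e z))).
  - intros j e; unfold rel3; split.
    + intros [z [[q [Hq Hz]] Hp]]; exists q, z; auto.
    + intros [q [z [Hz [Hq Hp]]]]; exists z; split; auto; exists q; auto.
  - apply (@D_ex_related G k); [dT|]; apply D_and; [dfn|].
    apply (D_ren _ (fun i => match i with 0 => 0 | S i => S (S i) end) HP).
Qed.

Lemma D_all_rel3 : Dfn G k (fun j e => forall z, rel3 (fS G j) (t0 j e) (t1 j e) (t2 j e) z -> P j e z).
Proof using H0 H1 H2 HP.
  apply (D_ext _ (fun j e => forall q z, related (fS G j) (t0 j e) q z ->
    (is_opair (fS G j) q (t1 j e) (t2 j e) -> P j e z))).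
  - intros j e; unfold rel3; split.
    + intros H q z Hz Hq; apply H; exists q; auto.
    + intros H z [q [Hq Hz]]; apply (H q z); auto.
  - apply (@D_all_related G k); [dT|]; apply D_imp; [dfn|].
    apply (D_ren _ (fun i => match i with 0 => 0 | S i => S (S i) end) HP).
Qed.

Lemma D_upd : Dfn G k (fun j e => upd (fS G j) (t0 j e) (t1 j e) (t2 j e) (t3 j e) (t4 j e)).
Proof using H0 H1 H2 H3 H4. unfold upd; dfn. Qed.

Lemma D_Lab : Dfn G k (fun j e => Lab (fS G j) (t0 j e) (t1 j e) (t2 j e) (t3 j e) (t4 j e)).
Proof using H0 H1 H2 H3 H4. unfold Lab; dfn. Qed.
End PropsDfn.

Ltac dfn_hook ::=
  lazymatch goal with |- Dfn ?G ?k _ => first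
  [ apply (@D_upd G k); dT | apply (@D_Lab G k); dT
  | apply (@D_ex_rel3 G k); [dT|dT|dT|] | apply (@D_all_rel3 G k); [dT|dT|dT|]
  | apply (@D_collapse G k); dT | apply (@D_rel_on G k); dT | apply (@D_dom G k); dT ]
  end.

Section PropsDfn2.
Context {G : fam} {k : kind} (t0 t1 t2 t3 t4 t5 t6 : forall j, (nat -> fS G j) -> fS G j).
Hypothesis (H0 : IsT G t0) (H1 : IsT G t1) (H2 : IsT G t2) (H3 : IsT G t3) (H4 : IsT G t4).
Hypothesis (H5 : IsT G t5) (H6 : IsT G t6).

Lemma D_Wprop : Dfn G k (fun j e => Wprop (fS G j) (t0 j e) (t1 j e) (t2 j e)).
Proof using H0 H1 H2. unfold Wprop; dfn. Qed.

Lemma D_Dprop : Dfn G k (fun j e => Dprop (fS G j) (t0 j e) (t1 j e) (t2 j e) (t3 j e)).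
Proof using H0 H1 H2 H3. unfold Dprop; dfn. Qed.

Lemma D_Lprop : Dfn G k (fun j e => Lprop (fS G j) (t0 j e)).
Proof using H0. unfold Lprop; dfn. Qed.

Lemma D_Tval : Dfn G k (fun j e =>
  Tval (fS G j) (t0 j e) (t1 j e) (t2 j e) (t3 j e) (t4 j e) (t5 j e) (t6 j e)).
Proof using H0 H1 H2 H3 H4 H5 H6. unfold Tval; dfn. Qed.

Lemma D_Tprop : Dfn G k (fun j e =>
  Tprop (fS G j) (t0 j e) (t1 j e) (t2 j e) (t3 j e) (t4 j e)).
Proof using H0 H1 H2 H3 H4. unfold Tprop, Tval; dfn. Qed.
End PropsDfn2.

(** Mac + H without the separation scheme is a single sentence; separation in B will come from
    [Dprop]. *)
Definition MacF (X : structure) : Prop :=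
  extensionality X /\ pairing X /\ emptyset X /\ union X /\ infinity X /\ powerset X /\
  transitive_containment X /\ set_foundation X /\ well_ordering X /\ AxH X.

Lemma MacF_sentence : exists al, forall (X : structure) (pt : X), MacF X <-> sat (fun _ => pt) al.
Proof.
  assert (D : Dfn famU KFO (fun j e => MacF (fS famU j))).
  { unfold MacF, extensionality, pairing, emptyset, union, infinity, powerset,
      transitive_containment, set_foundation, well_ordering, well_orders, AxH, AxHrel, wfrel.
    repeat (apply (@D_and famU KFO)); dfn. }
  destruct D as [al [r [_ [C E]]]]; exists al; intros X pt.
  rewrite (E (existT _ X pt) (fun _ => pt)); apply sat_ext; intros n.
  destruct (even_odd_cases n) as [m [->| ->]]; rewrite ?comb_even, ?comb_odd; auto.
  apply (C (existT _ X pt)).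
Qed.

Definition al : formula := proj1_sig (constructive_indefinite_description _ MacF_sentence).

Lemma al_spec (X : structure) (pt : X) : MacF X <-> sat (fun _ => pt) al.
Proof. unfold al; destruct constructive_indefinite_description as [a Ha]; apply Ha. Qed.

Definition P0 (X : structure) (om B W D L T : X) : Prop :=
  is_transitive X B /\ om ∈ B /\
  sat (fun n => match n with 0 => B | _ => om end) (rel 0 al) /\
  Wprop X om B W /\ Dprop X om B W D /\ Lprop X L /\ Tprop X om B W L T.

Lemma D_P0 : Dfn famU KD0 (fun j e => P0 (fS famU j) (e 0) (e 1) (e 2) (e 3) (e 4) (e 5)).
Proof.
  unfold P0; dapp; [dfn|]; dapp; [dfn|]; dapp.
  - apply (@D_ext famU KD0 _ (fun j e => sat (fun n => e (match n with 0 => 1 | _ => 0 end)) (rel 0 al))).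
    + intros; apply sat_ext; intros [|n]; reflexivity.
    + apply (@D_sat famU KD0), rel_Delta0.
  - dapp; [dx @D_Wprop; dT|]; dapp; [dx @D_Dprop; dT|]; dapp; [dx @D_Lprop; dT|].
    dx @D_Tprop; dT.
Qed.

Lemma P0_sub (X : structure) (om B : X) : om ∈ B ->
  (sat (fun n => match n with 0 => B | _ => om end) (rel 0 al) <->
   MacF (substructure X (fun x => x ∈ B))).
Proof.
  intros H; rewrite (al_spec _ (exist _ om H : substructure X (fun x => x ∈ B))).
  symmetry; apply sat_rel; [reflexivity|intros n; reflexivity].
Qed.

Section Existence.
Context {M : structure} (HM : MOST M).
Let HMac := MOST_Mac M HM.
Let HB := Mac_BST M HMac.
Context (om : M).

Lemma Lab_unique p p' w i z : Lab M om p w i z -> Lab M om p' w i z -> p = p'.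
Proof using HM.
  intros [p1 [H1 [p2 [H2 H3]]]] [p1' [H1' [p2' [H2' H3']]]].
  rewrite (opair_unique HB _ _ _ _ H3' H3) in H2'; rewrite (opair_unique HB _ _ _ _ H2' H2) in H1'.
  apply (opair_unique HB _ _ _ _ H1 H1').
Qed.

Lemma Lab_ex w i z : exists p, Lab M om p w i z.
Proof using HM.
  destruct (opair_ex HB i z) as [p2 H2], (opair_ex HB w p2) as [p1 H1], (opair_ex HB om p1) as [p H].
  exists p, p1; split; auto; exists p2; auto.
Qed.

Context (B W L : M) (HW : Wprop M om B W) (HL : Lprop M L).

Lemma Tval_sub F y f z z' : Tval M om B W F y f z -> Tval M om B W F y f z' -> subset M z z'.
Proof using HM.
  intros [A1 [A2 A3]] [B1 [B2 B3]] p Hp.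
  destruct (A1 p Hp) as [[i [Hi [k [Hk [Ho [x [Hx [x' [Hx' K]]]]]]]]]|
    [w [Hw [i [Hi [f' [Hf' [[u [Hu Hup]] [z1 [Hz1 Hl]]]]]]]]]].
  - destruct (B2 i Hi k Hk x Hx x' Hx' K) as [p' [Hp' Ho']].
    rewrite (opair_unique HB _ _ _ _ Ho Ho'); auto.
  - destruct (B3 w Hw i Hi u Hu f' Hf' Hup z1 Hz1) as [p' [Hp' Hl']].
    rewrite (Lab_unique _ _ _ _ _ Hl Hl'); auto.
Qed.

Lemma Tval_agree F F' y f z :
  (forall w f' z', w ∈ y -> f' ∈ W -> (rel3 M F w f' z' <-> rel3 M F' w f' z')) ->
  Tval M om B W F y f z -> Tval M om B W F' y f z.
Proof using.
  intros E [A1 [A2 A3]]; split; [|split; auto].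
  - intros p Hp; destruct (A1 p Hp) as [H|[w [Hw [i [Hi [f' [Hf' [Hup [z1 [Hz1 Hl]]]]]]]]]]; auto.
    right; exists w; split; auto; exists i; split; auto; exists f'; split; auto; split; auto.
    exists z1; split; auto; apply E; auto.
  - intros w Hw i Hi u Hu f' Hf' Hup z' Hz'; apply (A3 w Hw i Hi u Hu f' Hf' Hup), E; auto.
Qed.

Lemma Tval_ex F y f : exists z, Tval M om B W F y f z.
Proof using HM.
  destruct (range_ex HB F) as [R HR].
  destruct (b_prod M HB om om) as [Q0 HQ0], (b_prod M HB om R) as [Q1 HQ1].
  destruct (b_prod M HB y Q1) as [Q2 HQ2], (pair_ex HB om om) as [so Hso], (b_prod M HB so Q2) as [Q3 HQ3].
  destruct (union2_ex HB Q0 Q3) as [Q HQ].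
  destruct (sep HB Q (fun p => (∃ i ∈ om, ∃ k ∈ om, is_opair M p i k /\
      exists x, related M f i x /\ exists x', related M f k x' /\ x ∈ x') \/
    ∃ w ∈ y, ∃ i ∈ om, ∃ f' ∈ W, (∃ u ∈ B, upd M om f' f i u) /\
      exists z', rel3 M F w f' z' /\ Lab M om p w i z')) as [z Hz]; [dfn|].
  exists z; split; [|split].
  - intros p Hp; apply Hz in Hp; tauto.
  - intros i Hi k Hk x Hx x' Hx' K; destruct (opair_ex HB i k) as [p Hp]; exists p; split; auto.
    apply Hz; split; [apply HQ; left; apply HQ0; eauto|left].
    exists i; split; auto; exists k; split; auto; split; auto; exists x; split; auto; exists x'; auto.
  - intros w Hw i Hi u Hu f' Hf' Hup z' Hz'; destruct (Lab_ex w i z') as [p Hp]; exists p; split; auto.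
    apply Hz; split.
    + apply HQ; right; destruct Hp as [p1 [H1 [p2 [H2 H3]]]]; apply HQ3.
      exists om; split; [apply Hso; auto|]; exists p1; split; auto; apply HQ2.
      exists w; split; auto; exists p2; split; auto; apply HQ1.
      exists i; split; auto; exists z'; split; auto; destruct Hz' as [q [_ Hz']]; apply (HR q); auto.
    + right; exists w; split; auto; exists i; split; auto; exists f'; split; auto.
      split; [exists u; auto|]; exists z'; auto.
Qed.

Lemma types_ex : exists T, Tprop M om B W L T.
Proof using HM HL.
  destruct (b_prod M HB L W) as [d Hd].
  set (lt := fun q' q : M => ∃ y ∈ L, ∃ f ∈ W, is_opair M q y f /\
    ∃ w ∈ L, ∃ f' ∈ W, is_opair M q' w f' /\ w ∈ y).
  set (Gm := fun F q z A : M => ∃ y ∈ L, ∃ f ∈ W, is_opair M q y f /\ Tval M om B W F y f z).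
  assert (Dlt : Dfn (fam1 M d) KD0 (fun _ e => lt (e 1) (e 0))) by (unfold lt; dfn).
  assert (DGm : Dfn (fam1 M d) KD0 (fun _ e => Gm (e 3) (e 2) (e 1) (e 0))).
  { unfold Gm; cbv beta; dapp; cbv beta; dapp; cbv beta; dapp; [dfn|]; dx @D_Tval; dT. }
  assert (agr : forall F F' y f q, y ∈ L -> f ∈ W -> is_opair M q y f ->
    (forall l z, l ∈ d -> lt l q -> (related M F l z <-> related M F' l z)) ->
    forall w f' z', w ∈ y -> f' ∈ W -> (rel3 M F w f' z' <-> rel3 M F' w f' z')).
  { intros F F' y f q Hy Hf Hq H w f' z' Hw Hf'.
    assert (HwL : w ∈ L) by (apply (HL y Hy); auto).
    split; intros [q' [Hq' Hr]]; exists q'; split; auto; apply (H q' z'); auto.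
    1, 3: apply Hd; exists w; split; auto; exists f'; auto.
    1, 2: exists y; split; auto; exists f; split; auto; split; auto; exists w; split; auto;
      exists f'; auto. }
  assert (wf : forall s, subset M s d -> ~ is_empty M s ->
    exists i, i ∈ s /\ forall l, l ∈ s -> ~ lt l i).
  { intros s Hs Hne.
    destruct (min_def HB L (fun y => ∃ f ∈ W, ∃ q ∈ s, is_opair M q y f))
      as [y [Hy [[f [Hf [q [Hq Ho]]]] Hmin]]]; [dfn| |].
    - apply NNPP; intros K; apply Hne; intros q Hq; apply K.
      destruct (proj1 (Hd q) (Hs q Hq)) as [y [Hy [f [Hf Ho]]]]; exists y; split; auto.
      exists f; split; auto; exists q; auto.
    - exists q; split; auto; intros l Hl [y' [_ [f1 [_ [Ho1 [w [Hw [f' [Hf' [Ho' Hwy]]]]]]]]]].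
      destruct (opair_inj HB _ _ _ _ _ Ho Ho1); subst y' f1.
      apply (Hmin w); auto; exists f'; split; auto; exists l; auto. }
  destruct (recursion HB KD0 (b_sep M HB) (MOST_collection M HM) d lt Gm) as [F [A [HF Hdom]]]; auto.
  - intros F F' q z A Hq Hag [y [Hy [f [Hf [Ho K]]]]]; exists y; split; auto; exists f; split; auto.
    split; auto; apply (Tval_agree F); auto; apply (agr F F' y f q); auto.
  - intros F q z z' A A' Hq _ [y [Hy [f [Hf [Ho K]]]]] [y' [Hy' [f' [Hf' [Ho' K']]]]].
    destruct (opair_inj HB _ _ _ _ _ Ho Ho'); subst y' f'.
    apply (ext HB); intros p; split; eapply Tval_sub; eauto.
  - intros F q Hq _ _; apply Hd in Hq; destruct Hq as [y [Hy [f [Hf Ho]]]].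
    destruct (Tval_ex F y f) as [z Hz]; exists z, z, y; split; auto; exists f; auto.
  - apply (sigma1_induction M HB (MOST_separation M HM) d lt) with (Q := fun i u => exists F, F ∈ u /\
      exists A, A ∈ u /\ att d lt Gm F A /\ exists x, related M F i x); auto.
    + intros i; apply att_at_sigma; auto.
    + apply D_att_sigma; auto.
  - exists F; split; [|split].
    + intros y Hy f Hf; destruct (opair_ex HB y f) as [q Hq].
      destruct (Hdom q) as [z Hz]; [apply Hd; eauto|]; exists z; split; auto; exists q; auto.
    + intros y Hy f Hf z [q [Hq Hz]] z' [q' [Hq' Hz']].
      rewrite (opair_unique HB _ _ _ _ Hq' Hq) in Hz'; apply (HF _ _ Hz); auto.
    + intros y Hy f Hf z [q [Hq Hz]]; destruct (HF _ _ Hz) as [_ [_ [_ [y' [_ [f' [_ [Ho K]]]]]]]].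
      destruct (opair_inj HB _ _ _ _ _ Hq Ho); subst; auto.
Qed.
End Existence.

(** The freedom in a is what makes the initial condition of the generic construction good: B grows
    beyond any set while L escapes it. *)
Lemma P0_ex (M : structure) (HM : MOST M) (HP : collection M Delta0P) (om : M)
  (Hom : inductive_set om)
  (std : forall x, x ∈ om -> exists n, x = num (Mac_BST M (MOST_Mac M HM)) n) (a : M) :
  exists B W D L T, P0 M om B W D L T /\ subset M a B /\ ~ L ∈ a.
Proof.
  pose proof (MOST_Mac M HM) as HMac; pose proof (Mac_BST M HMac) as HB.
  destruct (adj_ex HB a om) as [a' Ha'], (Mac_transitive_containment M HMac a') as [t0 [Ht0 Hat]].
  assert (Hot : om ∈ t0) by (apply Hat, Ha'; auto).
  assert (at0 : subset M a t0) by (intros z Hz; apply Hat, Ha'; auto).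
  destruct (inner_model HM HP om Hom std t0 Ht0 Hot) as [B [BT [t0B [Bsub [BM BH]]]]].
  assert (HoB : om ∈ B) by auto.
  assert (subB : forall x w, w ∈ B -> subset M x w -> x ∈ B).
  { intros x w Hw Hx; destruct (Bsub (exist _ w Hw) x) as [[b Hb] <-]; auto. }
  destruct (functions_ex HB (Mac_powerset M HMac) om B) as [W [Q [HQ HW]]].
  destruct (Mac_powerset M HMac W) as [D HD].
  assert (Wv : forall f i, f ∈ W -> i ∈ om -> exists x, x ∈ B /\ related M f i x)
    by (intros f i; apply (U_val om B W Q HW)).
  assert (Wf : forall f i x y, f ∈ W -> related M f i x -> related M f i y -> x = y)
    by (intros f i x y; apply (U_fun HB om B W Q HQ HW)).
  assert (HWp : Wprop M om B W).
  { split; [|split; [|split]].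
    - destruct (mkfun HB om B W Q HQ HW (fun i x => x = om)) as [f [Hf _]]; [dfn|eauto|congruence|eauto].
    - intros f Hf i Hi; destruct (Wv f i Hf Hi) as [x [Hx Hr]]; exists x; split; auto; split; auto.
      intros x' Hx'; apply (Wf f i); auto.
    - intros f Hf i Hi u Hu.
      destruct (mkfun HB om B W Q HQ HW (fun k x => (k = i /\ x = u) \/ (~ k = i /\ related M f k x)))
        as [f' [Hf' K]].
      + dfn.
      + intros k Hk; destruct (classic (k = i)); [exists u; auto|].
        destruct (Wv f k Hf Hk) as [x [? ?]]; exists x; auto.
      + intros k x y [[? ?]|[? H1]] [[? ?]|[? H2]]; subst; auto; try contradiction.
        apply (Wf f k); auto.
      + exists f'; split; auto; split; [|split; auto].
        * intros k Hk Hki; destruct (Wv f k Hf Hk) as [y [Hy Hky]].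
          assert (R1 : related M f' k y) by (apply K; auto).
          split; intros x Hx; [rewrite (Wf f' k x y)|rewrite (Wf f k x y)]; auto.
        * intros x Hx; apply (Wf f' i); auto.
    - intros f Hf f' Hf' K; apply (U_ext HB om B W Q HQ HW); auto; intros i Hi.
      destruct (Wv f i Hf Hi) as [x [_ Hx]]; exists x; auto. }
  assert (HDp : Dprop M om B W D).
  { assert (mk : forall P : M -> Prop, Dfn (fam1 M W) KD0 (fun _ e => P (e 0)) ->
      ∃ R ∈ D, ∀ f ∈ W, (f ∈ R <-> P f)).
    { intros P HPd; destruct (sep HB W P HPd) as [R HR]; exists R; split.
      - apply HD; intros f Hf; apply HR in Hf; tauto.
      - intros f Hf; rewrite HR; tauto. }
    split; [|split; [|split; [|split]]].
    - intros i Hi k Hk; apply mk; dfn.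
    - intros i Hi k Hk; apply mk; dfn.
    - intros R HR R' HR'; apply (mk (fun f => ~ (f ∈ R /\ f ∈ R'))); dfn.
    - intros R HR i Hi; apply (mk (fun f => ∃ f' ∈ W, f' ∈ R /\ ∃ u ∈ B, upd M om f' f i u)); dfn.
    - intros R HR f Hf i Hi w Hw.
      destruct (sep HB w (fun u => ∃ f' ∈ W, upd M om f' f i u /\ f' ∈ R)) as [z Hz]; [dfn|].
      exists z; split; [apply (subB z w); auto; intros u Hu; apply Hz in Hu; tauto|].
      split; [intros u Hu; apply Hz in Hu; tauto|]; intros u Hu; rewrite Hz; tauto. }
  (* L is the set of ordinals in t0. *)
  destruct (sep HB t0 (fun x => is_transitive M x /\ ∀ y ∈ x, is_transitive M y)) as [L HL]; [dfn|].
  assert (HLp : Lprop M L).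
  { intros y Hy; apply HL in Hy; destruct Hy as [Hyt [Hy1 Hy2]]; split; auto.
    intros z Hz; apply HL; split; [apply (Ht0 y); auto|]; split; auto.
    intros w Hw; apply Hy2, (Hy1 z); auto. }
  destruct (types_ex HM om B W L HLp) as [T HT].
  exists B, W, D, L, T; split; [|split].
  - split; auto; split; auto; split; [|split; auto; split; auto; split; auto].
    apply P0_sub; auto.
    split; [apply BM|split; [apply BM|split; [apply BM|split; [apply BM|split; [apply BM|split;
      [apply BM|split; [apply BM|split; [apply BM|split; [apply BM|auto]]]]]]]]].
  - intros z Hz; auto.
  (* Burali-Forti: if L were in a, and hence in t0, it would be an element of itself. *)
  - intros HLa; apply (not_self HB L), HL; split; auto; split.
    + intros y Hy z Hz; apply (HLp y Hy); auto.
    + intros y Hy; apply (HLp y Hy).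
Qed.

(** * The generic end extension *)

Lemma LS_def (M : structure) (HM : Mac M) (om Pom s q v h x0 : M) (Hx0 : x0 ∈ s) (P : M -> Prop) :
  hbound M om Pom s q v h ->
  Dfn (famC M (fun x => x ∈ s) x0 Hx0) KD0 (fun _ e => P (e 0)) ->
  (exists y, P y) -> exists y, P y /\ ∃ f ∈ h, ∃ i ∈ v, related M f i y.
Proof.
  intros Hb HD [y Hy].
  destruct (Dfn_bind (G := famC M (fun x => x ∈ s) x0 Hx0) (fun _ _ x => P x) HD) as [p [r [Gp [C E]]]].
  specialize (E tt (fun _ => x0)); simpl in E.
  destruct (loewenheim_skolem M HM om Pom s q v h Hb p Gp (comb (fun _ => x0) (r tt)))
    with (y0 := y) as [z [Hz K]].
  - intros i; destruct (even_odd_cases i) as [m [->| ->]]; rewrite ?comb_even, ?comb_odd; auto.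
    apply (C tt).
  - apply E, Hy.
  - exists z; split; auto; apply E, Hz.
Qed.

Section Generic.
Context {N : structure} (HN : MOST N) (HP : collection N Delta0P).
Let HMac := MOST_Mac N HN.
Let HB := Mac_BST N HMac.
Context (om : N) (Hom : inductive_set om) (en : nat -> N) (Hen : forall x, exists n, en n = x).

(* A condition is a bounded formula about the constants c_0, c_1, ... and all elements of N.
   It is good if its solutions go with arbitrarily large a ⊆ c_0 and with the designated
   constants outside a. *)
Definition at_a (a : N) (Dl : list nat) (c : nat -> N) : Prop :=
  (forall x, x ∈ a -> x ∈ c 0) /\ forall i, In i Dl -> ~ c i ∈ a.

Definition Good (P : (nat -> N) -> Prop) (Dl : list nat) : Prop :=
  forall a, exists c, P c /\ at_a a Dl c.

Lemma at_a_mono a a' Dl Dl' c : subset N a a' -> incl Dl Dl' -> at_a a' Dl' c -> at_a a Dl c.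
Proof using. intros H1 H2 [H3 H4]; split; [auto|]; intros i Hi Hc; apply (H4 i); auto. Qed.

(** Failure of goodness is an ideal: two sets defeating P1 and P2 have a union that defeats both.
    Deciding a formula rests on this. *)
Lemma Good_or (P P1 P2 : (nat -> N) -> Prop) Dl : (forall c, P c -> P1 c \/ P2 c) ->
  Good P Dl -> Good P1 Dl \/ Good P2 Dl.
Proof using HN.
  intros H HG; apply NNPP; intros K; apply not_or_and in K; destruct K as [K1 K2].
  apply not_all_ex_not in K1; apply not_all_ex_not in K2; destruct K1 as [a1 K1], K2 as [a2 K2].
  destruct (union2_ex HB a1 a2) as [a Ha]; destruct (HG a) as [c [Hc Hat]].
  destruct (H c Hc) as [Hc'|Hc']; [apply K1|apply K2]; exists c; split; auto;
    apply (at_a_mono _ a Dl Dl); auto; try (intros x; auto; fail); intros x Hx; apply Ha; auto.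
Qed.

Section Pigeonhole.
Context (p : formula) (Hp : Delta0 p) (Dl : list nat) (k : nat).

Definition Sol (a b : N) (c : nat -> N) : Prop := sat (comb c en) p /\ c k = b /\ at_a a Dl c.

(** Above the index k and all indices occurring in p or Dl: a solution is a tuple of length K and
    fits into a set. *)
Let K := S (bnd p + k + fold_right Nat.add 0 Dl).

Lemma in_Dl_bound i : In i Dl -> i < K.
Proof using.
  intros H; assert (i <= fold_right Nat.add 0 Dl); [|unfold K; lia].
  induction Dl as [|x l IH]; simpl in *; [contradiction|].
  destruct H as [->|H]; [lia|apply IH in H; lia].
Qed.

Lemma Sol_ext a b c c' : (forall i, i < K -> c i = c' i) -> Sol a b c -> Sol a b c'.
Proof using.
  intros E [H1 [H2 [H3 H4]]]; split; [|split; [|split]].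
  - eapply sat_bnd; [|exact H1]; intros i Hi; destruct (even_odd_cases i) as [m [->| ->]];
      rewrite ?comb_even, ?comb_odd; auto; symmetry; apply E; unfold K; lia.
  - rewrite <- E; auto; unfold K; lia.
  - intros x Hx; rewrite <- E; auto; unfold K; lia.
  - intros i Hi; rewrite <- E; auto; apply in_Dl_bound; auto.
Qed.

Definition SolIn (t a b : N) : Prop := exists c, (forall i, i < K -> c i ∈ t) /\ Sol a b c.

Lemma D_SolIn (C : N -> Prop) x0 (Hx0 : C x0) : (forall i, i < K -> C (en i)) ->
  Dfn (famC N C x0 Hx0) KD0 (fun _ e => SolIn (e 0) (e 1) (e 2)).
Proof using Hp.
  intros HC; set (G := famC N C x0 Hx0).
  set (en' := fun i => if i <? K then en i else x0).
  assert (HE : forall c, sat (comb c en) p <-> sat (comb c en') p).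
  { intros c; apply sat_bnd; intros i Hi; destruct (even_odd_cases i) as [m [->| ->]];
      rewrite ?comb_even, ?comb_odd; auto; unfold en'.
    destruct (Nat.ltb_spec m K); auto; unfold K in *; lia. }
  assert (Dsat : Dfn G KD0 (fun _ e => sat (comb e en') p)).
  { apply (@D_subst G KD0 (fun _ e => sat (fun n => e n) p) (fun n _ e => comb e en' n)).
    - apply (@D_sat G KD0 _ (fun n => n)); auto.
    - intros n; destruct (even_odd_cases n) as [m [->| ->]].
      + left; exists m; intros; apply comb_even.
      + right; exists (fun _ => en' m); split; [|intros; apply comb_odd].
        intros j0; unfold en'; simpl; destruct (Nat.ltb_spec m K); auto. }
  (* Once the K-tuple is put in front of the environment, t, a and b stand at the indices K, K+1 and
     K+2. *)
  assert (Dl' : forall l, Dfn G KD0 (fun _ e => forall i, In i l -> ~ e i ∈ e (S K))).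
  { induction l as [|i l IH].
    - apply (@D_ext G KD0 _ (fun _ e => e 0 = e 0)); [|dfn].
      intros j e; simpl; split; auto; intros; contradiction.
    - apply (@D_ext G KD0 _ (fun _ e => ~ e i ∈ e (S K) /\ forall i, In i l -> ~ e i ∈ e (S K)));
        [|dapp; [dfn|exact IH]].
      intros j e; simpl; split; [intros H; split; auto|].
      intros [H1 H2] i' [<-|H]; auto. }
  eapply (@D_ext G KD0); [|apply (@D_EX G KD0 K (fun _ _ e => e 0) (fun _ _ _ y => y = y)
    (fun _ e => sat (comb e en') p /\ e k = e (S (S K)) /\ (forall x, x ∈ e (S K) -> x ∈ e 0) /\
      forall i, In i Dl -> ~ e i ∈ e (S K)))].
  - intros j e; unfold SolIn; split.
    + intros [c [H1 H2]]; exists c; split; [intros; split; auto|].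
      assert (E : forall i, i < K -> c i = pre K c e i).
      { intros i Hi; unfold pre; destruct (Nat.ltb_spec i K); auto; lia. }
      assert (E1 : pre K c e (S K) = e 1).
      { unfold pre; destruct (Nat.ltb_spec (S K) K); [lia|]; f_equal; lia. }
      assert (E2 : pre K c e (S (S K)) = e 2).
      { unfold pre; destruct (Nat.ltb_spec (S (S K)) K); [lia|]; f_equal; lia. }
      apply (Sol_ext _ _ _ _ E) in H2; destruct H2 as [S1 [S2 [S3 S4]]].
      rewrite <- E2 in S2; rewrite <- E1 in S3, S4.
      split; [exact (proj1 (HE _) S1)|split; [exact S2|split; [exact S3|exact S4]]].
    + intros [c [H1 [S1 [S2 [S3 S4]]]]]; exists c; split; [intros; apply H1; auto|].
      assert (E : forall i, i < K -> pre K c e i = c i).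
      { intros i Hi; unfold pre; destruct (Nat.ltb_spec i K); auto; lia. }
      assert (E1 : pre K c e (S K) = e 1).
      { unfold pre; destruct (Nat.ltb_spec (S K) K); [lia|]; f_equal; lia. }
      assert (E2 : pre K c e (S (S K)) = e 2).
      { unfold pre; destruct (Nat.ltb_spec (S (S K)) K); [lia|]; f_equal; lia. }
      apply (Sol_ext _ _ _ _ E); rewrite <- E1, <- E2.
      split; [exact (proj2 (HE _) S1)|split; [exact S2|split; [exact S3|exact S4]]].
  - intros; dT.
  - intros; dfn.
  - dapp; [exact Dsat|]; dapp; [dfn|]; dapp; [dfn|apply Dl'].
Qed.

(* By Löwenheim–Skolem, "no solution for (a,b)" is witnessed by a set; so failure for every
   b ∈ w can be collected into a single a. *)
Lemma pigeonhole w : (forall b, b ∈ w -> ~ Good (fun c => sat (comb c en) p /\ c k = b) Dl) ->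
  exists a, forall b, b ∈ w -> forall c, ~ Sol a b c.
Proof using HN HP Hom Hp.
  intros H.
  destruct (Mac_powerset N HMac om) as [Pom HPom].
  destruct (finite_set_ex N HB en K) as [pr Hpr].
  (* X is a certificate that (a,b) has no solution: it holds the data of [hbound] for some s with a,
     b and the constants of p, and V includes all values of the functions in h. By Löwenheim-Skolem,
     some t in V would contain a solution if there were any. *)
  set (Psi := fun b X : N => ∃ a ∈ X, ∃ s ∈ X, ∃ q ∈ X, ∃ v ∈ X, ∃ h ∈ X, ∃ q2 ∈ X, ∃ V ∈ X,
    (a ∈ s /\ b ∈ s /\ subset N pr s /\ subset N om s /\ is_transitive N s) /\
    ((∀ p ∈ q, ∃ A ∈ Pom, ∃ x ∈ s, is_opair N p A x) /\
     (∀ A ∈ Pom, ∀ x ∈ s, ∃ p ∈ q, is_opair N p A x)) /\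
    (forall z, subset N z q -> z ∈ v) /\
    (∀ x ∈ v, ∀ y ∈ v, ∃ p ∈ q2, is_opair N p x y) /\
    (forall r, subset N r q2 -> rel_on N r v ->
      (forall s, subset N s v -> ~ is_empty N s -> exists i, i ∈ s /\ forall l, l ∈ s -> ~ related N r l i) ->
      ∃ f ∈ h, collapse N f r v) /\
    (∀ f ∈ h, ∀ i ∈ v, forall y, related N f i y -> y ∈ V) /\
    ∀ t ∈ V, ~ SolIn t a b).
  destruct (coll_def N KD0P HP w Psi) as [C HC].
  - unfold Psi; do 7 (dapp; cbv beta).
    do 6 (dapp; [dfn|]).
    dapp; cbv beta; dapp; apply D_kind.
    refine (@D_sub3 (fam1 N w) KD0 _ _ _ _ _ _ (fun _ b a t => SolIn t a b) _); try dT.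
    apply (D_SolIn (fun _ => True)); auto.
  - intros b Hb; destruct (not_all_ex_not _ _ (H b Hb)) as [a Ha].
    destruct (adj_ex HB pr a) as [x1 Hx1], (adj_ex HB x1 b) as [x2 Hx2].
    destruct (hbound_ex N HMac (MOST_AxH N HN) om x2 Hom) as [Pom' [s [q [v [h [[B1 B2 B3 B4 B5 B6 B7] Hs]]]]]].
    assert (Pom' = Pom) by (apply (ext HB); intros z; rewrite B2, HPom; tauto); subst Pom'.
    destruct (b_prod N HB v v) as [q2 Hq2], (values_ex N HB h) as [V HV].
    destruct (finite_set_ex N HB (fun n => match n with 0 => a | 1 => s | 2 => q | 3 => v | 4 => h
      | 5 => q2 | _ => V end) 7) as [X HX].
    exists X.
    exists a; split; [apply (HX 0); lia|]; exists s; split; [apply (HX 1); lia|].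
    exists q; split; [apply (HX 2); lia|]; exists v; split; [apply (HX 3); lia|].
    exists h; split; [apply (HX 4); lia|]; exists q2; split; [apply (HX 5); lia|].
    exists V; split; [apply (HX 6); lia|].
    split; [|split; [|split; [|split; [|split; [|split]]]]].
    + split; [apply Hs, Hx2; left; apply Hx1; auto|split; [apply Hs, Hx2; auto|split; [|split; auto]]].
      intros z Hz; apply Hs, Hx2; left; apply Hx1; auto.
    + split; [intros z Hz; apply B5; auto|].
      intros A HA x Hx; destruct (opair_ex HB A x) as [z Hz]; exists z; split; auto; apply B5; eauto.
    + auto.
    + intros x Hx y Hy; destruct (opair_ex HB x y) as [z Hz]; exists z; split; auto; apply Hq2; eauto.
    + intros r _ Hr Hw; apply B7; auto.
    + intros f Hf i Hi y Hy; apply (HV f i); auto.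
    + intros t _ [c [_ [S1 [S2 S3]]]]; apply Ha; exists c; auto.
  (* The union of the union of C includes the a of every certificate, and solutions for a larger set
     are solutions for a smaller one. *)
  - destruct (b_union N HB C) as [U HU], (b_union N HB U) as [a0 Ha0]; exists a0.
    intros b Hb c [S1 [S2 S3]].
    destruct (HC b Hb) as [X [HX [a [Ha [s [_ [q [_ [v [_ [h [_ [q2 [_ [V [_ Hh]]]]]]]]]]]]]]]].
    destruct Hh as [[I1 [I2 [I3 [I4 I5]]]] [[Q1 Q2] [Q3 [Q4 [Q5 [Q6 Q7]]]]]].
    assert (Hbd : hbound N om Pom s q v h).
    { constructor; auto.
      - intros z; split; [apply Q1|]; intros [A [HA [x [Hx Ho]]]].
        destruct (Q2 A HA x Hx) as [z' [Hz' Ho']]; rewrite (opair_unique HB _ _ _ _ Ho Ho'); auto.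
      - intros r Hr Hw; apply Q5; auto; intros z Hz; destruct (Hr z Hz) as [x [Hx [y [Hy Ho]]]].
        destruct (Q4 x Hx y Hy) as [z' [Hz' Ho']]; rewrite (opair_unique HB _ _ _ _ Ho Ho'); auto. }
    destruct (LS_def N HMac om Pom s q v h b I2 (fun t => SolIn t a b) Hbd) as [t [Ht [f [Hf [i [Hi Hr]]]]]].
    + refine (@D_sub3 (famC N (fun x => x ∈ s) b I2) KD0 _ _ _ _ _ _ (fun _ b a t => SolIn t a b) _);
        try dT; try (right; eexists; split; [|intros; reflexivity]; intros; simpl; auto; fail).
      apply D_SolIn; intros n Hn; apply I3; auto.
    + destruct (finite_set_ex N HB c K) as [t Ht]; exists t, c; split; auto.
      split; auto; split; auto; apply (at_a_mono a a0 Dl Dl); auto; [|intros n; auto].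
      intros z Hz; apply Ha0; exists a; split; auto; apply HU; eauto.
    + apply (Q7 t); auto; apply (Q6 f Hf i Hi); auto.
Qed.
End Pigeonhole.
End Generic.

(** * Countability of formulas *)

Fixpoint fcode (p : formula) : nat :=
  match p with
  | fMem i j => to_nat (0, to_nat (i, j))
  | fEq i j => to_nat (1, to_nat (i, j))
  | fNot p => to_nat (2, fcode p)
  | fAnd p q => to_nat (3, to_nat (fcode p, fcode q))
  | fOr p q => to_nat (4, to_nat (fcode p, fcode q))
  | fImp p q => to_nat (5, to_nat (fcode p, fcode q))
  | fAll p => to_nat (6, fcode p)
  | fEx p => to_nat (7, fcode p)
  end.

Lemma to_nat_inj p q : to_nat p = to_nat q -> p = q.
Proof. intros H; rewrite <- (cancel_of_to p), <- (cancel_of_to q), H; reflexivity. Qed.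

Lemma fcode_inj p : forall q, fcode p = fcode q -> p = q.
Proof.
  induction p; intros q H; destruct q; cbn [fcode] in H; apply to_nat_inj in H;
    pose proof (f_equal fst H) as H1; pose proof (f_equal snd H) as H2; cbn [fst snd] in H1, H2;
    try discriminate H1; try (f_equal; auto; fail); apply to_nat_inj in H2;
    pose proof (f_equal fst H2) as H3; pose proof (f_equal snd H2) as H4; cbn [fst snd] in H3, H4;
    f_equal; auto.
Qed.

Lemma formulas_countable : exists fml : nat -> formula, forall p, exists n, fml n = p.
Proof.
  exists (fun n => epsilon (inhabits (fEq 0 0)) (fun p => fcode p = n)); intros p; exists (fcode p).
  apply fcode_inj, epsilon_spec; exists p; reflexivity.
Qed.

(** * A generic sequence of conditions *)

Section Chain.
Context {N : structure} (HN : MOST N) (HP : collection N Delta0P).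
Let HMac := MOST_Mac N HN.
Let HB := Mac_BST N HMac.
Context (om : N) (Hom : inductive_set om) (en : nat -> N) (Hen : forall x, exists n, en n = x).

Let cond : Type := (formula * list nat)%type.
Definition ok (s : cond) : Prop := Delta0 (fst s) /\ Good (fun c => sat (comb c en) (fst s)) (snd s).
Definition forces (s : cond) (Q : (nat -> N) -> Prop) : Prop :=
  forall c, sat (comb c en) (fst s) -> Q (comb c en).
Definition refines (s s' : cond) : Prop :=
  (forall Q, forces s Q -> forces s' Q) /\ incl (snd s) (snd s').

Lemma refines_refl s : refines s s.
Proof using. split; auto; intros i; auto. Qed.

Lemma refines_trans s1 s2 s3 : refines s1 s2 -> refines s2 s3 -> refines s1 s3.
Proof using. intros [H1 H2] [H3 H4]; split; auto; intros i; auto. Qed.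

Lemma refines_and fm l p l' : incl l l' -> refines (fm, l) (fAnd fm p, l').
Proof using. intros H; split; auto; intros Q HQ c [Hc _]; apply HQ, Hc. Qed.

Lemma decide_step s p : ok s -> Delta0 p -> exists s', ok s' /\ refines s s' /\
  (forces s' (fun e => sat e p) \/ forces s' (fun e => ~ sat e p)).
Proof using HN.
  destruct s as [fm l]; intros [H1 H2] Hp.
  destruct (Good_or HN (fun c => sat (comb c en) fm) (fun c => sat (comb c en) (fAnd fm p))
    (fun c => sat (comb c en) (fAnd fm (fNot p))) l) as [H|H]; auto.
  - intros c Hc; simpl; tauto.
  - exists (fAnd fm p, l); split; [split; auto; constructor; auto|split].
    + apply refines_and; intros i; auto.
    + left; intros c [_ Hc]; auto.
  - exists (fAnd fm (fNot p), l); split; [split; auto; repeat constructor; auto|split].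
    + apply refines_and; intros i; auto.
    + right; intros c [_ Hc]; auto.
Qed.

Definition cset (c : nat -> N) (j : nat) (y : N) : nat -> N := fun i => if Nat.eqb i j then y else c i.

Lemma cset_eq c j y : cset c j y j = y.
Proof using. unfold cset; rewrite Nat.eqb_refl; reflexivity. Qed.

Lemma cset_neq c j y i : i <> j -> cset c j y i = c i.
Proof using. intros H; unfold cset; apply Nat.eqb_neq in H; rewrite H; reflexivity. Qed.

Lemma cset_comb c j y n : n < 2 * j -> comb (cset c j y) en n = comb c en n.
Proof using.
  intros H; destruct (even_odd_cases n) as [m [->| ->]]; rewrite ?comb_even, ?comb_odd; auto.
  apply cset_neq; lia.
Qed.

Lemma cset_sat c j y p : bnd p <= 2 * j -> (sat (comb (cset c j y) en) p <-> sat (comb c en) p).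
Proof using. intros H; apply sat_bnd; intros i Hi; apply cset_comb; lia. Qed.

Lemma cset_at a l c j y : (forall i, In i l -> i < j) -> 0 < j -> at_a a l c -> at_a a l (cset c j y).
Proof using.
  intros Hl Hj [H1 H2]; split.
  - intros x Hx; rewrite cset_neq; auto; lia.
  - intros i Hi; rewrite cset_neq; auto; specialize (Hl i Hi); lia.
Qed.

Lemma list_fresh (l : list nat) : exists k, forall i, In i l -> i < k.
Proof using.
  induction l as [|x l [k IH]]; [exists 0; intros i []|].
  exists (S (k + x)); intros i [<-|H]; [lia|specialize (IH i H); lia].
Qed.

Lemma witness_step s p : ok s -> Delta0 p -> forces s (fun e => exists y, sat (scons y e) p) ->
  exists s', ok s' /\ refines s s' /\ exists j, forces s' (fun e => sat (scons (e (2 * j)) e) p).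
Proof using.
  destruct s as [fm l]; intros [H1 H2] Hp Hw; simpl in *.
  (* A fresh constant takes the witness: j lies above every index in use and is not 0, so neither
     the condition nor its goodness notices the change. *)
  destruct (list_fresh l) as [k Hk]; set (j := S (bnd fm + bnd p + k)).
  set (q := ren (scons (2 * j) (fun n => n)) p).
  assert (Eq : forall e : nat -> N, sat e q <-> sat (scons (e (2 * j)) e) p).
  { intros e; unfold q; rewrite sat_ren; apply sat_ext; intros [|n]; reflexivity. }
  exists (fAnd fm q, l); split; [split|split].
  - constructor; auto; apply (Gam_ren KD0); auto.
  - intros a; destruct (H2 a) as [c [Hc Ha]]; destruct (Hw c Hc) as [y Hy].
    exists (cset c j y); simpl; split; [split|].
    + apply cset_sat; auto; unfold j; lia.
    + apply Eq; rewrite comb_even, cset_eq; eapply sat_bnd; [|exact Hy].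
      intros [|i] Hi; simpl; auto; apply cset_comb; unfold j; lia.
    + apply cset_at; auto; [|unfold j; lia]; intros i Hi; specialize (Hk i Hi); unfold j; lia.
  - apply refines_and; intros i; auto.
  - exists j; intros c [_ Hc]; apply Eq, Hc.
Qed.

(* Either the constant k is interpreted by an element of N, or it gets a designated element:
   this keeps N closed under subclasses that are sets of the generic model. *)
Lemma standard_step s k : ok s -> exists s', ok s' /\ refines s s' /\
  ((exists m, forces s' (fun e => e (2 * k) = e (S (2 * m)))) \/
   exists j, In j (snd s') /\ forces s' (fun e => e (2 * j) ∈ e (2 * k))).
Proof using HN HP Hom Hen.
  destruct s as [fm l]; intros [H1 H2]; simpl in *.
  destruct (classic (exists b, Good (fun c => sat (comb c en) fm /\ c k = b) l)) as [[b Hb]|Hno].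
  - destruct (Hen b) as [m <-].
    assert (E : forall c, sat (comb c en) (fEq (2 * k) (S (2 * m))) <-> c k = en m).
    { intros c; unfold sat; rewrite comb_even, comb_odd; tauto. }
    exists (fAnd fm (fEq (2 * k) (S (2 * m))), l); split; [split|split].
    + repeat constructor; auto.
    + intros a; destruct (Hb a) as [c [[Hc Hk] Ha]]; exists c; split; auto; split; auto; apply E; auto.
    + apply refines_and; intros i; auto.
    + left; exists m; intros c [_ Hc]; exact Hc.
  - destruct (list_fresh l) as [k0 Hk0]; set (j := S (bnd fm + k + k0)).
    exists (fAnd fm (fMem (2 * j) (2 * k)), j :: l); split; [split|split].
    + repeat constructor; auto.
    (* If no value of constant k is good, the pigeonhole principle for w = P(a) gives a solution
       whose value is not a subset of a; an element outside a becomes the value of the fresh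
       designated constant. *)
    + intros a; destruct (Mac_powerset N HMac a) as [w Hw].
      destruct (pigeonhole HN HP om Hom en fm H1 l k w) as [a' Ha'].
      { intros b _ HG; apply Hno; exists b; exact HG. }
      destruct (union2_ex HB a a') as [u Hu]; destruct (H2 u) as [c [Hc Ha]].
      assert (Hy : exists y, y ∈ c k /\ ~ y ∈ a).
      { apply NNPP; intros K; apply (Ha' (c k)) with c.
        - apply Hw; intros y Hy; apply NNPP; intros Hn; apply K; eauto.
        - split; auto; split; auto; apply (at_a_mono a' u l l); auto; [|intros i; auto].
          intros z Hz; apply Hu; auto. }
      destruct Hy as [y [Hy1 Hy2]]; exists (cset c j y); cbn [fst snd]; split; [split|].
      * apply cset_sat; auto; unfold j; lia.
      * unfold sat; rewrite !comb_even, cset_eq, cset_neq; auto; unfold j; lia.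
      * destruct (cset_at a l c j y) as [A1 A2].
        { intros i Hi; specialize (Hk0 i Hi); unfold j; lia. }
        { unfold j; lia. }
        { apply (at_a_mono a u l l); auto; [|intros i; auto]; intros z Hz; apply Hu; auto. }
        split; auto; intros i [<-|Hi]; auto; rewrite cset_eq; auto.
    + apply refines_and; intros i Hi; right; auto.
    + right; exists j; split; [left; auto|]; intros c [_ Hc]; exact Hc.
Qed.

(** Unbounded existential formulas cannot be decided. They get witnesses only when true under every
    assignment in N, which yields the ∀∃ axioms of the generic model. *)
Definition handled (p : formula) (k : nat) (s : cond) : Prop :=
  (Delta0 p -> forces s (fun e => sat e p) \/ forces s (fun e => ~ sat e p)) /\
  (forall q, p = fEx q -> Delta0 q -> (forall e : nat -> N, sat e p) \/ Delta0 p ->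
    forces s (fun e => ~ sat e p) \/ exists j, forces s (fun e => sat (scons (e (2 * j)) e) q)) /\
  ((exists m, forces s (fun e => e (2 * k) = e (S (2 * m)))) \/
   exists j, In j (snd s) /\ forces s (fun e => e (2 * j) ∈ e (2 * k))).

Lemma handle_step s p k : ok s -> exists s', ok s' /\ refines s s' /\ handled p k s'.
Proof using HN HP Hom Hen.
  intros H0.
  assert (S1 : exists s1, ok s1 /\ refines s s1 /\
    (Delta0 p -> forces s1 (fun e => sat e p) \/ forces s1 (fun e => ~ sat e p))).
  { destruct (classic (Delta0 p)) as [Hp|Hp].
    - destruct (decide_step s p H0 Hp) as [s1 [A [B C]]]; eauto.
    - exists s; split; [|split]; auto using refines_refl; tauto. }
  destruct S1 as [s1 [O1 [R1 D1]]].
  assert (S2 : exists s2, ok s2 /\ refines s1 s2 /\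
    (forall q, p = fEx q -> Delta0 q -> (forall e : nat -> N, sat e p) \/ Delta0 p ->
    forces s2 (fun e => ~ sat e p) \/ exists j, forces s2 (fun e => sat (scons (e (2 * j)) e) q))).
  { destruct (classic (exists q, p = fEx q /\ Delta0 q /\ forces s1 (fun e => sat e p))) as [K|K].
    - destruct K as [q [-> [Hq Hf]]]; destruct (witness_step s1 q O1 Hq Hf) as [s2 [A [B C]]].
      exists s2; split; [|split]; auto; intros q' E _ _; injection E as <-; auto.
    - exists s1; split; [|split]; auto using refines_refl.
      intros q Hq Hd [Ha|Ha]; [destruct K; exists q; split; [|split]; auto; intros c _; apply Ha|].
      destruct (D1 Ha) as [Hf|Hf]; auto; destruct K; exists q; auto. }
  destruct S2 as [s2 [O2 [R2 D2]]].
  destruct (standard_step s2 k O2) as [s3 [O3 [R3 D3]]].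
  exists s3; split; auto; split; [eapply refines_trans; eauto; eapply refines_trans; eauto|].
  destruct R2 as [R2 _], R3 as [R3 _]; split; [|split]; auto.
  - intros Hp; destruct (D1 Hp); auto.
  - intros q E Hq Ha; destruct (D2 q E Hq Ha) as [H|[j H]]; auto; right; exists j; auto.
Qed.

Lemma generic_chain (s0 : cond) : ok s0 -> exists st : nat -> cond,
  st 0 = s0 /\ (forall n, ok (st n)) /\ (forall n m, n <= m -> refines (st n) (st m)) /\
  forall p k, exists n, handled p k (st n).
Proof using HN HP Hom Hen.
  intros H0; destruct formulas_countable as [fml Hfml].
  set (step := fun (n : nat) (s : {s | ok s}) =>
    let (a, b) := of_nat n in
    let d := constructive_indefinite_description _ (handle_step (proj1_sig s) (fml a) b (proj2_sig s)) in
    exist ok (proj1_sig d) (proj1 (proj2_sig d))).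
  set (ch := fix ch n := match n with 0 => exist ok s0 H0 | S n => step n (ch n) end).
  assert (Hs : forall n, refines (proj1_sig (ch n)) (proj1_sig (ch (S n))) /\
    handled (fml (fst (of_nat n))) (snd (of_nat n)) (proj1_sig (ch (S n)))).
  { intros n; simpl; unfold step; destruct (of_nat n) as [a b]; simpl.
    destruct constructive_indefinite_description as [s [A [B C]]]; simpl; auto. }
  exists (fun n => proj1_sig (ch n)); split; [reflexivity|split; [intros n; apply (proj2_sig (ch n))|split]].
  - induction 1 as [|m _ IH]; [apply refines_refl|].
    eapply refines_trans; [exact IH|apply Hs].
  - intros p k; destruct (Hfml p) as [a <-]; exists (S (to_nat (a, k))).
    destruct (Hs (to_nat (a, k))) as [_ H]; rewrite cancel_of_to in H; exact H.
Qed.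
End Chain.

(** * The model given by a generic sequence *)

Section GenericModel.
Context {N : structure} (HN : MOST N).
Let HB := Mac_BST N (MOST_Mac N HN).
Context (en : nat -> N) (Hen : forall x, exists n, en n = x).
Context (st : nat -> formula * list nat) (Hok : forall n, ok en (st n)).
Context (Href : forall n m, n <= m -> refines en (st n) (st m)).
Context (Hall : forall p k, exists n, handled en p k (st n)).

Definition forced (Q : (nat -> N) -> Prop) : Prop := exists n, forces en (st n) Q.

Lemma forced_imp (Q Q' : (nat -> N) -> Prop) : (forall e, Q e -> Q' e) -> forced Q -> forced Q'.
Proof using. intros H [n Hn]; exists n; intros c Hc; apply H, Hn, Hc. Qed.

Lemma forced_iff (Q Q' : (nat -> N) -> Prop) : (forall e, Q e <-> Q' e) -> (forced Q <-> forced Q').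
Proof using. intros H; split; apply forced_imp; intros e; apply H. Qed.

Lemma forced_and Q Q' : forced (fun e => Q e /\ Q' e) <-> forced Q /\ forced Q'.
Proof using Href.
  split; [intros H; split; revert H; apply forced_imp; tauto|].
  intros [[n Hn] [m Hm]]; exists (n + m); intros c Hc.
  destruct (Href n (n + m)) as [R1 _]; [lia|]; destruct (Href m (n + m)) as [R2 _]; [lia|].
  split; [apply (R1 _ Hn)|apply (R2 _ Hm)]; auto.
Qed.

Lemma forced_true (Q : (nat -> N) -> Prop) : (forall e, Q e) -> forced Q.
Proof using. intros H; exists 0; intros c _; apply H. Qed.

Lemma forced_consistent (Q : (nat -> N) -> Prop) : forced Q -> exists c, Q (comb c en).
Proof using Hok.
  intros [n Hn]; destruct (Hok n) as [_ G]; destruct (G (en 0)) as [c [Hc _]]; eauto.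
Qed.

Lemma forced_not p (f : nat -> nat) : Delta0 p ->
  (forced (fun e => ~ sat (fun i => e (f i)) p) <-> ~ forced (fun e => sat (fun i => e (f i)) p)).
Proof using Hok Href Hall.
  intros Hp; split.
  - intros H1 H2; destruct (forced_consistent _ (proj2 (forced_and _ _) (conj H1 H2))) as [c Hc]; tauto.
  - intros H; destruct (Hall (ren f p) 0) as [n [Hd _]].
    destruct (Hd (Gam_ren KD0 p Hp f)) as [K|K].
    + destruct H; exists n; intros c Hc; apply sat_ren, K, Hc.
    + exists n; intros c Hc; rewrite <- sat_ren; apply (K c Hc).
Qed.

Lemma forced_ex p (f : nat -> nat) : Delta0 p -> Delta0 (fEx p) \/ (forall e : nat -> N, sat e (fEx p)) ->
  forced (fun e => exists y, sat (scons y (fun i => e (f i))) p) ->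
  exists m, forced (fun e => sat (fun i => e (scons m f i)) p).
Proof using Hok Href Hall.
  intros Hp Ha HT; destruct (Hall (ren f (fEx p)) 0) as [n [_ [Hw _]]].
  destruct (Hw (ren (up f) p)) as [K|[j K]]; auto.
  - apply (Gam_ren KD0); auto.
  - destruct Ha as [Ha|Ha]; [right; apply (Gam_ren KD0 _ Ha)|left; intros e; apply sat_ren, Ha].
  - assert (K' : forced (fun e => ~ sat e (ren f (fEx p)))) by (exists n; exact K).
    destruct (forced_consistent _ (proj2 (forced_and _ _) (conj HT K'))) as [c [H1 H2]].
    destruct H2; apply sat_ren; exact H1.
  - exists (2 * j), n; intros c Hc; specialize (K c Hc); rewrite sat_ren in K.
    eapply sat_ext; [|exact K]; intros [|i]; reflexivity.
Qed.

(** The model is a quotient of the constants by forced equality; each class is represented by its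
    least index. *)
Definition point (m : nat) : Prop := forall k, k < m -> ~ forced (fun e => e k = e m).
Definition M0 : structure :=
  Structure {m | point m} (fun x y => forced (fun e => e (proj1_sig x) ∈ e (proj1_sig y))).

Lemma cls_ex m : exists x : M0, forced (fun e => e (proj1_sig x) = e m).
Proof using Href.
  induction m as [m IH] using lt_wf_ind.
  destruct (classic (point m)) as [H|H].
  - exists (exist _ m H); apply forced_true; auto.
  - apply not_all_ex_not in H; destruct H as [k H]; apply imply_to_and in H; destruct H as [Hk H].
    apply NNPP in H; destruct (IH k Hk) as [x Hx]; exists x.
    generalize (proj2 (forced_and _ _) (conj H Hx)); apply forced_imp; intros e [-> ->]; auto.
Qed.

Definition cls (m : nat) : M0 := proj1_sig (constructive_indefinite_description _ (cls_ex m)).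

Lemma cls_spec m : forced (fun e => e (proj1_sig (cls m)) = e m).
Proof using. unfold cls; destruct constructive_indefinite_description; auto. Qed.

Lemma cls_eq m k : cls m = cls k <-> forced (fun e => e m = e k).
Proof using.
  pose proof (cls_spec m) as Hm; pose proof (cls_spec k) as Hk; split.
  - intros E; rewrite E in Hm; generalize (proj2 (forced_and _ _) (conj Hm Hk)).
    apply forced_imp; intros e [H1 H2]; congruence.
  - intros H; generalize (proj2 (forced_and _ _) (conj H (proj2 (forced_and _ _) (conj Hm Hk)))).
    destruct (cls m) as [x Px], (cls k) as [y Py]; simpl; intros K.
    assert (E : x = y); [|subst y; f_equal; apply proof_irrelevance].
    destruct (Nat.lt_trichotomy x y) as [L|[E|L]]; auto; exfalso.
    + apply (Py x L); revert K; apply forced_imp; intros e [H1 [H2 H3]]; congruence.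
    + apply (Px y L); revert K; apply forced_imp; intros e [H1 [H2 H3]]; congruence.
Qed.

Lemma cls_mem m k : cls m ∈ cls k <-> forced (fun e => e m ∈ e k).
Proof using.
  pose proof (cls_spec m) as Hm; pose proof (cls_spec k) as Hk; simpl; split; intros H;
    generalize (proj2 (forced_and _ _) (conj H (proj2 (forced_and _ _) (conj Hm Hk)))); apply forced_imp;
    intros e [H1 [H2 H3]]; congruence.
Qed.

Lemma cls_surj (x : M0) : exists m, x = cls m.
Proof using.
  exists (proj1_sig x); pose proof (cls_spec (proj1_sig x)) as H.
  destruct (cls (proj1_sig x)) as [y Py], x as [x Px]; simpl in *.
  assert (E : x = y); [|subst y; f_equal; apply proof_irrelevance].
  destruct (Nat.lt_trichotomy x y) as [L|[E|L]]; auto; exfalso.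
  - apply (Py x L); revert H; apply forced_imp; auto.
  - apply (Px y L); auto.
Qed.

Lemma cls_scons m (f : nat -> nat) n : cls (scons m f n) = scons (cls m) (fun i => cls (f i)) n.
Proof using. destruct n; reflexivity. Qed.

(** An analogue of Łoś's theorem: deciding formulas settles the connectives, providing witnesses
    settles bounded quantifiers. *)
Lemma truth p : Delta0 p -> forall f : nat -> nat,
  sat (fun i => cls (f i)) p <-> forced (fun e => sat (fun i => e (f i)) p).
Proof using Hok Hall.
  assert (HE : forall q m f, sat (scons (cls m) (fun i => cls (f i))) q <->
    sat (fun i => cls (scons m f i)) q) by (intros; apply sat_ext; intros; symmetry; apply cls_scons).
  assert (HE' : forall q m f (e : nat -> N), sat (scons (e m) (fun i => e (f i))) q <->
    sat (fun i => e (scons m f i)) q) by (intros; apply sat_ext; intros [|]; reflexivity).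
  intros Hp; induction Hp as [a b|a b|p Hp IH|p q Hp IHp Hq IHq|p q Hp IHp Hq IHq|p q Hp IHp Hq IHq
    |y p Hp IH|y p Hp IH]; intros f; cbn [sat].
  - apply cls_mem.
  - apply cls_eq.
  - rewrite IH, <- forced_not; auto; tauto.
  - rewrite forced_and, IHp, IHq; tauto.
  - pose proof (forced_not (fOr p q) f (Delta0_or p q Hp Hq)) as H; cbn [sat] in H.
    rewrite IHp, IHq; split.
    + intros [K|K]; revert K; apply forced_imp; auto.
    + intros K; apply NNPP; intros K'; apply not_or_and in K'.
      rewrite <- !forced_not, <- forced_and in K'; auto; revert K; apply H; revert K'; apply forced_imp; tauto.
  - pose proof (forced_not (fImp p q) f (Delta0_imp p q Hp Hq)) as H; cbn [sat] in H.
    rewrite IHp, IHq; split.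
    + intros K; apply NNPP; intros K'; rewrite <- H in K'.
      assert (K1 : forced (fun e => sat (fun i => e (f i)) p))
        by (revert K'; apply forced_imp; intros e He; apply NNPP; tauto).
      generalize (K K1); apply forced_not; auto; revert K'; apply forced_imp; tauto.
    + intros K K1; generalize (proj2 (forced_and _ _) (conj K K1)); apply forced_imp; tauto.
  - split.
    + intros K; apply NNPP; intros K'.
      apply (forced_not (fAllIn y p) f (Delta0_all y p Hp)) in K'.
      destruct (forced_ex (fAnd (fMem 0 (S y)) (fNot p)) f) as [m Hm].
      * repeat constructor; auto.
      * left; apply (Delta0_ex y (fNot p)); constructor; auto.
      * revert K'; apply forced_imp; intros e He; cbn in He.
        apply not_all_ex_not in He; destruct He as [a Ha]; exists a; cbn; tauto.
      * cbn in Hm; apply forced_and in Hm; destruct Hm as [H1 H2]; apply forced_not in H2; auto.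
        apply H2, IH, HE, K; apply cls_mem; auto.
    + intros K a Ha; destruct (cls_surj a) as [m ->].
      rewrite HE, IH; apply (cls_mem m (f y)) in Ha.
      generalize (proj2 (forced_and _ _) (conj K Ha)); apply forced_imp; intros e [H1 H2].
      apply HE'; apply H1; exact H2.
  - split.
    + intros [a [Ha K]]; destruct (cls_surj a) as [m ->].
      rewrite HE, IH in K; apply (cls_mem m (f y)) in Ha.
      generalize (proj2 (forced_and _ _) (conj K Ha)); apply forced_imp; intros e [H1 H2].
      exists (e m); split; [exact H2|apply HE'; exact H1].
    + intros K; destruct (forced_ex (fAnd (fMem 0 (S y)) p) f) as [m Hm].
      * repeat constructor; auto.
      * left; apply (Delta0_ex y p); auto.
      * exact K.
      * cbn in Hm; apply forced_and in Hm; destruct Hm as [H1 H2]; exists (cls m); split.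
        -- apply (proj2 (cls_mem m (f y))); auto.
        -- apply HE, IH, H2.
Qed.

Lemma truthU (P : forall j : fJ famU, (nat -> fS famU j) -> Prop) : Dfn famU KD0 P ->
  forall k f, P (existT _ M0 (cls k)) (fun n => cls (f n)) <->
    forced (fun e => P (existT _ N (e k)) (fun n => e (f n))).
Proof using Hok Hall.
  intros [p [r [Hp [C E]]]] k f; rewrite E.
  rewrite (sat_ext M0 p _ (fun i => cls (comb f (fun _ => k) i))).
  - rewrite truth; auto; apply forced_iff; intros e; rewrite E; apply sat_ext; intros n.
    destruct (even_odd_cases n) as [m [->| ->]]; rewrite ?comb_even, ?comb_odd; auto.
    rewrite (C (existT _ N (e k)) m); reflexivity.
  - intros n; destruct (even_odd_cases n) as [m [->| ->]]; rewrite ?comb_even, ?comb_odd; auto.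
    rewrite (C (existT _ M0 (cls k)) m); reflexivity.
Qed.

Lemma env_cls (e : nat -> M0) : exists f, e = fun n => cls (f n).
Proof using Href.
  exists (fun n => proj1_sig (e n)); apply functional_extensionality; intros n.
  destruct (cls_surj (e n)) as [m E]; rewrite E; symmetry; apply cls_eq, cls_spec.
Qed.

Lemma transfer_all (P : forall j : fJ famU, (nat -> fS famU j) -> Prop) : Dfn famU KD0 P ->
  (forall x e, P (existT _ N x) e) -> forall x e, P (existT _ M0 x) e.
Proof using Hok Hall Href.
  intros HD H x e; destruct (cls_surj x) as [k ->], (env_cls e) as [f ->].
  apply truthU; auto; apply forced_true; auto.
Qed.

(** The existential formula is not bounded, but it holds in N under all assignments, so the
    construction has provided a witness for it. *)
Lemma transfer_all_ex (P : forall j : fJ famU, (nat -> fS famU j) -> Prop) : Dfn famU KD0 P ->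
  (forall x e, exists y, P (existT _ N x) (scons y e)) ->
  forall x e, exists y, P (existT _ M0 x) (scons y e).
Proof using Hok Hall Href.
  intros HD H x e; destruct (cls_surj x) as [k ->], (env_cls e) as [f ->].
  destruct (Dfn_bind (G := famU) (k := KD0) (fun j e y => P j (scons y e))) as [p [r [Hp [C E]]]].
  { revert HD; apply (@D_ext famU KD0); intros; rewrite scons_eta; tauto. }
  set (q := ren (up (comb (fun i => 2 * i) (fun _ => 1))) p).
  assert (Eq : forall (X : structure) (e : nat -> X) y, sat (scons y e) q <->
    P (existT _ X (e 1)) (scons y (fun i => e (2 * i)))).
  { intros X e y; unfold q; rewrite sat_ren, E; apply sat_ext; intros [|n]; [reflexivity|].
    simpl up; unfold scons; destruct (even_odd_cases n) as [m [->| ->]];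
      rewrite ?comb_even, ?comb_odd; auto.
    rewrite (C (existT _ X (e 1)) m); reflexivity. }
  destruct (forced_ex q (comb f (fun _ => k))) as [m Hm].
  - apply (Gam_ren KD0); auto.
  - right; intros e; destruct (H (e 1) (fun i => e (2 * i))) as [y Hy]; exists y; apply Eq, Hy.
  - apply forced_true; intros e; destruct (H (e k) (fun i => e (f i))) as [y Hy]; exists y.
    apply Eq; change (P (existT _ N (e k)) (scons y (fun i => e (comb f (fun _ => k) (2 * i))))).
    replace (fun i => e (comb f (fun _ => k) (2 * i))) with (fun i => e (f i)); auto.
    apply functional_extensionality; intros i; rewrite comb_even; reflexivity.
  - exists (cls m); apply truth in Hm; [|apply (Gam_ren KD0); auto].
    rewrite (sat_ext _ _ _ (scons (cls m) (fun i => cls (comb f (fun _ => k) i)))) in Hm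
      by (intros; apply cls_scons).
    apply Eq in Hm.
    change (P (existT _ M0 (cls k)) (scons (cls m) (fun i => cls (comb f (fun _ => k) (2 * i))))) in Hm.
    replace (fun n => cls (f n)) with (fun i => cls (comb f (fun _ => k) (2 * i))); auto.
    apply functional_extensionality; intros i; rewrite comb_even; reflexivity.
Qed.

Lemma M0_BST : BST M0.
Proof using HN Hok Hall Href.
  pose proof (cls 0) as pt.
  constructor.
  - intros x y H.
    apply (transfer_all (fun j e => ((∀ z ∈ e 0, z ∈ e 1) /\ ∀ z ∈ e 1, z ∈ e 0) -> e 0 = e 1))
      with (x := pt) (e := scons x (fun _ => y)); [dfn| |split; intros z Hz; apply H; auto].
    intros pt0 e [H1 H2]; cbn in e; apply (ext HB); intros z; split; auto.
  - intros a b; apply (transfer_all_ex (fun j e => is_upair (fS famU j) (e 0) (e 1) (e 2)))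
      with (x := pt) (e := scons a (fun _ => b)); [dfn|].
    intros pt0 e; exact (b_pair N HB (e 0) (e 1)).
  - apply (transfer_all_ex (fun j e => is_empty (fS famU j) (e 0)))
      with (x := pt) (e := fun _ => pt); [dfn|].
    intros pt0 e; exact (b_empty N HB).
  - intros x; destruct (transfer_all_ex (fun j e =>
      (∀ z ∈ e 0, ∃ w ∈ e 1, z ∈ w) /\ ∀ w ∈ e 1, ∀ z ∈ w, z ∈ e 0))
      with (x := pt) (e := fun _ : nat => x) as [y [H1 H2]]; [dfn| |].
    + intros pt0 e; cbn in e; destruct (b_union N HB (e 0)) as [u Hu]; exists u; simpl; split.
      * intros z Hz; apply Hu, Hz.
      * intros w Hw z Hz; apply Hu; eauto.
    + exists y; intros z; split; [apply H1|intros [w [Hw Hz]]; apply (H2 w Hw z Hz)].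
  - intros a b; destruct (transfer_all_ex (fun j e =>
      (∀ z ∈ e 0, ∃ x ∈ e 1, ∃ y ∈ e 2, is_opair (fS famU j) z x y) /\
      ∀ x ∈ e 1, ∀ y ∈ e 2, ∃ z ∈ e 0, is_opair (fS famU j) z x y))
      with (x := pt) (e := scons a (fun _ : nat => b)) as [y [H1 H2]]; [dfn| |].
    + intros pt0 e; cbn in e; destruct (b_prod N HB (e 0) (e 1)) as [u Hu]; exists u; simpl; split.
      * intros z Hz; apply Hu, Hz.
      * intros x Hx y Hy; destruct (opair_ex HB x y) as [z Hz]; exists z; split; auto; apply Hu; eauto.
    + exists y; intros z; split; [apply H1|intros [u [Hu [v [Hv Hz]]]]].
      destruct (H2 u Hu v Hv) as [z' [Hz' Ho]]; simpl in *.
      assert (z = z'); [|subst; auto].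
      apply (transfer_all (fun j e => is_opair (fS famU j) (e 0) (e 2) (e 3) ->
        is_opair (fS famU j) (e 1) (e 2) (e 3) -> e 0 = e 1))
        with (x := pt) (e := scons z (scons z' (scons u (fun _ => v)))); [dfn| |exact Hz|exact Ho].
      intros pt0 e; exact (opair_unique HB (e 0) (e 1) (e 2) (e 3)).
  - intros p Hp rho w; destruct (transfer_all_ex (fun j e =>
      (∀ x ∈ e 0, x ∈ e 1 /\ sat (scons x (fun i => e (S (S i)))) p) /\
      ∀ x ∈ e 1, sat (scons x (fun i => e (S (S i)))) p -> x ∈ e 0))
      with (x := pt) (e := scons w rho) as [y [H1 H2]].
    + assert (D : Dfn famU KD0 (fun j e => sat (scons (e 0) (fun i => e (S (S (S i))))) p)).
      { apply (D_ext _ (fun j e => sat (fun i => e (match i with 0 => 0 | S i => S (S (S i)) end)) p)).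
        - intros; apply sat_ext; intros [|n]; reflexivity.
        - apply (@D_sat famU KD0); auto. }
      dapp; dapp; dapp; try dfn; exact D.
    + intros pt0 e; cbn in e; destruct (b_sep N HB p Hp (fun i => e (S i)) (e 0)) as [u Hu]; exists u; simpl; split.
      * intros x Hx; apply Hu; auto.
      * intros x Hx Hs; apply Hu; auto.
    + exists y; intros x; split; [apply H1|intros [Hx Hs]; apply H2; auto].
  - intros x Hx; apply (transfer_all (fun j e => ~ is_empty (fS famU j) (e 0) ->
      ∃ y ∈ e 0, ∀ z ∈ y, ~ z ∈ e 0)) with (x := pt) (e := fun _ => x); [dfn| |exact Hx].
    intros pt0 e; exact (b_found N HB (e 0)).
Qed.

Definition emb (b : N) : M0 := cls (S (2 * proj1_sig (constructive_indefinite_description _ (Hen b)))).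

Lemma emb_en m : emb (en m) = cls (S (2 * m)).
Proof using Hen.
  unfold emb; destruct constructive_indefinite_description as [k Hk]; simpl proj1_sig; apply cls_eq.
  exists 0; intros c _; rewrite !comb_odd; auto.
Qed.

Lemma forced_odd m k : forced (fun e => e (S (2 * m)) ∈ e (S (2 * k))) <-> en m ∈ en k.
Proof using Hok.
  split.
  - intros H; destruct (forced_consistent _ H) as [c Hc]; rewrite !comb_odd in Hc; auto.
  - intros H; exists 0; intros c _; rewrite !comb_odd; auto.
Qed.

(** Equality with b would be forced by some condition; goodness of a later one for a = {b} keeps the
    designated constant away from b. *)
Lemma designated n j b : In j (snd (st n)) -> cls (2 * j) <> emb b.
Proof using HN Hok Href.
  intros Hj E; destruct (Hen b) as [m Hm]; rewrite <- Hm, emb_en in E; apply cls_eq in E.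
  destruct E as [n' E]; destruct (pair_ex HB b b) as [a Ha].
  destruct (Hok (n + n')) as [_ G]; destruct (G a) as [c [Hc [_ Hd]]].
  destruct (Href n (n + n')) as [_ R1]; [lia|]; destruct (Href n' (n + n')) as [R2 _]; [lia|].
  apply (Hd j); [apply R1; auto|]; specialize (R2 _ E c Hc); cbv beta in R2.
  rewrite comb_even, comb_odd in R2; apply Ha; left; congruence.
Qed.

Lemma emb_mem a b : a ∈ b <-> emb a ∈ emb b.
Proof using Hok.
  destruct (Hen a) as [m <-], (Hen b) as [k <-]; rewrite !emb_en, cls_mem, forced_odd; tauto.
Qed.

Lemma standard_or m : (exists b, emb b = cls m) \/ exists y : M0, y ∈ cls m /\ forall b, emb b <> y.
Proof using HN Hok Hall Href.
  destruct (even_odd_cases m) as [k [->| ->]]; [|left; exists (en k); apply emb_en].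
  destruct (Hall (fEq 0 0) k) as [n [_ [_ [[m Hm]|[j [Hj Hm]]]]]].
  - left; exists (en m); rewrite emb_en; symmetry; apply cls_eq; exists n; exact Hm.
  - right; exists (cls (2 * j)); split; [apply cls_mem; exists n; exact Hm|].
    intros b E; symmetry in E; revert E; apply (designated n); auto.
Qed.

Lemma emb_closed (x : M0) : (forall z, z ∈ x -> exists b, emb b = z) -> exists b, emb b = x.
Proof using HN Hok Hall Href.
  intros H; destruct (cls_surj x) as [m ->]; destruct (standard_or m) as [K|[y [Hy Hn]]]; auto.
  destruct (H y Hy) as [b Hb]; case (Hn b Hb).
Qed.

(* An element of b that is not in N would contain a designated element, which avoids ∪b. *)
Lemma emb_initial : initial emb.
Proof using HN Hok Hall Href.
  constructor; [| apply emb_mem|].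
  - intros a b H; destruct (Hen a) as [m <-], (Hen b) as [k <-]; rewrite !emb_en in H.
    apply cls_eq, forced_consistent in H; destruct H as [c Hc]; rewrite !comb_odd in Hc; auto.
  - intros b x Hx; destruct (cls_surj x) as [m ->].
    destruct (even_odd_cases m) as [k [->| ->]]; [|exists (en k); apply emb_en].
    destruct (Hall (fEq 0 0) k) as [n [_ [_ [[m Hm]|[j [Hj Hm]]]]]].
    { exists (en m); rewrite emb_en; symmetry; apply cls_eq; exists n; exact Hm. }
    exfalso; destruct (Hen b) as [m Hmb]; rewrite <- Hmb, emb_en, cls_mem in Hx; destruct Hx as [n' Hx].
    destruct (b_union N HB b) as [a Ha].
    destruct (Hok (n + n')) as [_ G]; destruct (G a) as [c [Hc [_ Hd]]].
    destruct (Href n (n + n')) as [R1 R1']; [lia|]; destruct (Href n' (n + n')) as [R2 _]; [lia|].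
    specialize (R1 _ Hm c Hc); specialize (R2 _ Hx c Hc); cbv beta in R1, R2.
    apply (Hd j); [apply R1'; auto|]; apply Ha; rewrite !comb_even, ?comb_odd in *; exists (c k).
    rewrite <- Hmb; auto.
Qed.

Lemma emb_bounded b : emb b ∈ cls 0.
Proof using HN Hok Hall Href.
  destruct (Hen b) as [m Hm]; rewrite <- Hm, emb_en, cls_mem.
  apply NNPP; intros K; apply (forced_not (fMem 0 1) (fun i => match i with 0 => S (2 * m) | _ => 0 end)) in K;
    [|constructor].
  destruct K as [n K]; destruct (pair_ex HB b b) as [a Ha], (Hok n) as [_ G]; destruct (G a) as [c [Hc [Hd _]]].
  apply (K c Hc); cbn [sat]; rewrite comb_odd; apply Hd, Ha; auto.
Qed.
End GenericModel.

Lemma generic_model (N : structure) (HN : MOST N) (HP : collection N Delta0P) (om : N)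
  (Hom : inductive_set om) (en : nat -> N) :
  (forall x, exists n, en n = x) ->
  (forall x, x ∈ om -> exists n, x = num (Mac_BST N (MOST_Mac N HN)) n) ->
  exists (M : structure) (i : N -> M) (en' : nat -> M) (B W D L T : M),
    (forall x, exists n, en' n = x) /\ BST M /\ initial i /\
    (forall x, (forall z, z ∈ x -> exists b, i b = z) -> exists b, i b = x) /\
    P0 M (i om) B W D L T /\ (forall b, i b ∈ B) /\ forall b, i b <> L.
Proof.
  intros Hen std.
  destruct (Hen om) as [mo Hmo].
  (* Variable 0 of [P0] is om, named by an odd index; the constants c_0, ..., c_4 are B, W, D, L and
     T. Thus N is included in B because goodness puts every a inside c_0. *)
  set (f0 := scons (S (2 * mo)) (fun i => 2 * i)).
  destruct D_P0 as [p [r [Gp [C E]]]].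
  set (fm0 := ren (comb f0 (fun _ => 1)) p).
  assert (E0 : forall c, sat (comb c en) fm0 <-> P0 N om (c 0) (c 1) (c 2) (c 3) (c 4)).
  { intros c; unfold fm0; rewrite sat_ren.
    rewrite (E (existT _ N (en 0)) (scons om c)); apply sat_ext; intros n.
    destruct (even_odd_cases n) as [m [->| ->]]; rewrite ?comb_even, ?comb_odd.
    - destruct m as [|m]; unfold f0, scons; rewrite ?comb_even, ?comb_odd; auto.
    - rewrite (C (existT _ N (en 0)) m); reflexivity. }
  (* Constant 3, which is L, is designated from the start and hence nonstandard. *)
  destruct (generic_chain HN HP om Hom en Hen (fm0, cons 3 nil)) as [st [S0 [Hok [Href Hall]]]].
  { split; [apply (Gam_ren KD0); auto|]; intros a; simpl fst; simpl snd.
    destruct (P0_ex N HN HP om Hom std a) as [B [W [D [L [T [H1 [H2 H3]]]]]]].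
    exists (fun n => match n with 0 => B | 1 => W | 2 => D | 3 => L | _ => T end).
    rewrite E0; split; auto; split; auto; intros i [<-|[]]; auto. }
  exists (M0 en st), (emb en Hen st Href), (cls en st Href).
  exists (cls en st Href (2 * 0)), (cls en st Href (2 * 1)), (cls en st Href (2 * 2)),
    (cls en st Href (2 * 3)), (cls en st Href (2 * 4)).
  split; [|split; [|split; [|split; [|split; [|split]]]]].
  - intros x; destruct (cls_surj en st Href x) as [m ->]; eauto.
  - apply (M0_BST HN); auto.
  - apply (emb_initial HN); auto.
  - apply (emb_closed HN); auto.
  - rewrite <- Hmo, emb_en.
    apply (truthU en st Hok Href Hall _ D_P0 1 f0).
    exists 0; intros c Hc; rewrite S0 in Hc; apply E0 in Hc.
    unfold f0, scons; cbn beta; rewrite !comb_even, comb_odd, Hmo; exact Hc.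
  - apply (emb_bounded HN); auto.
  - intros b Hb; symmetry in Hb; revert Hb; apply (designated HN en Hen st Hok Href 0).
    rewrite S0; left; reflexivity.
Qed.

(** * Back and forth *)

Lemma request_chain {A Q : Type} (en : nat -> Q) (Hen : forall q, exists n, en n = q)
  (Gd : list A -> Prop) (Rq : Q -> list A -> Prop) :
  Gd nil -> (forall q l, Gd l -> exists l', Gd l' /\ incl l l' /\ Rq q l') ->
  exists st : nat -> list A, (forall n, Gd (st n)) /\ (forall n m, n <= m -> incl (st n) (st m)) /\
    forall q, exists n, Rq q (st n).
Proof.
  intros H0 Hs.
  set (step := fun q (l : {l | Gd l}) =>
    let d := constructive_indefinite_description _ (Hs q (proj1_sig l) (proj2_sig l)) in
    exist Gd (proj1_sig d) (proj1 (proj2_sig d))).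
  set (ch := fix ch n := match n with 0 => exist Gd nil H0 | S n => step (en n) (ch n) end).
  assert (K : forall n, incl (proj1_sig (ch n)) (proj1_sig (ch (S n))) /\ Rq (en n) (proj1_sig (ch (S n)))).
  { intros n; simpl; unfold step; destruct constructive_indefinite_description as [l [a [b c]]]; simpl; auto. }
  exists (fun n => proj1_sig (ch n)); split; [intros n; apply (proj2_sig (ch n))|split].
  - induction 1 as [|m _ IH]; [intros x; auto|]; intros x Hx; apply K, IH, Hx.
  - intros q; destruct (Hen q) as [n <-]; exists (S n); apply K.
Qed.

Section BackForth.
Context {N X : structure} (HN : MOST N) (wfN : wf_structure N) (i : N -> X) (Hi : initial i).
Context (closed : forall x : X, (forall z, z ∈ x -> exists b, i b = z) -> exists b, i b = x).
Context (HB : BST X) (om : N) (Hom : inductive_set om).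
Let HBN := Mac_BST N (MOST_Mac N HN).
Context (std : forall x, x ∈ om -> exists n, x = num HBN n).
Context (B W D L T : X) (HP0 : P0 X (i om) B W D L T).
Context (HBi : forall b, i b ∈ B) (HLi : forall b, i b <> L).

Let o := i om.
Let nn n := i (num HBN n).
Let trB : is_transitive X B := proj1 HP0.
Let HWp : Wprop X o B W := proj1 (proj2 (proj2 (proj2 HP0))).
Let HDp : Dprop X o B W D := proj1 (proj2 (proj2 (proj2 (proj2 HP0)))).
Let HLp : Lprop X L := proj1 (proj2 (proj2 (proj2 (proj2 (proj2 HP0))))).
Let HTp : Tprop X o B W L T := proj2 (proj2 (proj2 (proj2 (proj2 (proj2 HP0))))).

Definition stdd (x : X) : Prop := exists b, i b = x.

Lemma in_o x : x ∈ o <-> exists n, x = nn n.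
Proof using Hi Hom std.
  split.
  - intros H; destruct (in_tr i Hi _ _ H) as [b <-]; apply (in_mem i Hi) in H.
    destruct (std b H) as [n ->]; exists n; reflexivity.
  - intros [n ->]; apply (in_mem i Hi), num_in, Hom.
Qed.

Lemma nn_in n : nn n ∈ o.
Proof using Hi Hom std. apply in_o; eauto. Qed.

Lemma nn_inj n m : nn n = nn m -> n = m.
Proof using Hi. intros H; apply (num_inj HBN), (in_inj i Hi), H. Qed.

Definition ap (f : X) (n : nat) : X := epsilon (inhabits f) (fun x => related X f (nn n) x).

Lemma ap_rel f n x : f ∈ W -> (related X f (nn n) x <-> x = ap f n).
Proof using HP0 Hi Hom std.
  intros Hf; destruct (proj1 (proj2 HWp) f Hf (nn n) (nn_in n)) as [x0 [H1 [H2 H3]]].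
  assert (K : related X f (nn n) (ap f n)) 
    by exact (epsilon_spec (inhabits f) (fun x => related X f (nn n) x) (ex_intro _ x0 H1)).
  split; [intros H; rewrite (H3 _ H), (H3 _ K); auto|intros ->; auto].
Qed.

Lemma ap_B f n : f ∈ W -> ap f n ∈ B.
Proof using HP0 Hi Hom std.
  intros Hf; destruct (proj1 (proj2 HWp) f Hf (nn n) (nn_in n)) as [x0 [H1 [H2 H3]]].
  apply (ap_rel f n x0 Hf) in H1; subst; auto.
Qed.

Definition setf (f' f : X) (n : nat) (u : X) : Prop :=
  ap f' n = u /\ forall k, k <> n -> ap f' k = ap f k.

Lemma upd_setf f' f n u : f ∈ W -> f' ∈ W -> (upd X o f' f (nn n) u <-> setf f' f n u).
Proof using HP0 Hi Hom std.
  intros Hf Hf'; unfold upd, setf; split.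
  - intros [H1 [H2 H3]]; split; [symmetry; apply (ap_rel f' n u Hf'), H2|].
    intros k Hk; apply (ap_rel f k _ Hf); apply (H1 (nn k) (nn_in k)).
    + intros E; apply Hk, nn_inj, E.
    + apply ap_rel; auto.
  - intros [H1 H2]; split; [|split].
    + intros x Hx Hn; apply in_o in Hx; destruct Hx as [k ->].
      assert (k <> n) by congruence.
      split; intros x; rewrite !ap_rel, H2; auto.
    + apply ap_rel; auto.
    + intros x; rewrite ap_rel, H1; auto.
Qed.

Lemma setf_ex f n u : f ∈ W -> u ∈ B -> exists f', f' ∈ W /\ setf f' f n u.
Proof using HP0 Hi Hom std.
  intros Hf Hu; destruct (proj1 (proj2 (proj2 HWp)) f Hf (nn n) (nn_in n) u Hu) as [f' [Hf' H]].
  exists f'; split; auto; apply upd_setf; auto.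
Qed.

Lemma finite_ap (rho : nat -> X) k : (forall n, rho n ∈ B) ->
  exists f, f ∈ W /\ forall n, n < k -> ap f n = rho n.
Proof using HP0 Hi Hom std.
  intros Hr; induction k as [|k [f [Hf IH]]].
  - destruct (proj1 HWp) as [f [Hf _]]; exists f; split; auto; intros; lia.
  - destruct (setf_ex f k (rho k) Hf (Hr k)) as [f' [Hf' [H1 H2]]]; exists f'; split; auto.
    intros n Hn; destruct (Nat.eq_dec n k) as [->|E]; auto; rewrite H2; auto; apply IH; lia.
Qed.

Definition BM : structure := substructure X (fun x => x ∈ B).

Definition rep (P : X -> Prop) : Prop := exists R, R ∈ D /\ forall f, f ∈ W -> (f ∈ R <-> P f).

Lemma rep_nand P Q : rep P -> rep Q -> rep (fun f => ~ (P f /\ Q f)).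
Proof using HP0.
  intros [R [HR H1]] [R' [HR' H2]].
  destruct (proj1 (proj2 (proj2 HDp)) R HR R' HR') as [R2 [HR2 H3]]; exists R2; split; auto.
  intros f Hf; rewrite (H3 f Hf), H1, H2; tauto.
Qed.

Lemma rep_ext (P Q : X -> Prop) : (forall f, f ∈ W -> (P f <-> Q f)) -> rep P -> rep Q.
Proof using.
  intros H [R [HR K]]; exists R; split; auto; intros f Hf; rewrite (K f Hf); auto.
Qed.

Lemma rep_not P : rep P -> rep (fun f => ~ P f).
Proof using HP0. intros H; apply (rep_ext (fun f => ~ (P f /\ P f))); [tauto|apply rep_nand; auto]. Qed.

Lemma rep_and P Q : rep P -> rep Q -> rep (fun f => P f /\ Q f).
Proof using HP0.
  intros H1 H2; apply (rep_ext (fun f => ~ ~ (P f /\ Q f))); [|apply rep_not, rep_nand; auto].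
  intros; split; [apply NNPP|tauto].
Qed.

Definition bm (x : X) : BM :=
  match excluded_middle_informative (x ∈ B) with
  | left H => exist _ x H
  | right _ => exist _ (i om) (HBi om)
  end.

Lemma bm_val x : x ∈ B -> proj1_sig (bm x) = x.
Proof using. intros H; unfold bm; destruct excluded_middle_informative; [auto|contradiction]. Qed.

Lemma bm_exist x (H : x ∈ B) : bm x = exist (fun x => x ∈ B) x H.
Proof using. unfold bm; destruct excluded_middle_informative; [apply subset_eq_compat; auto|contradiction]. Qed.

(* [l] tells at which coordinate of f the variables are stored; all coordinates from [m] on are free. *)
Lemma rep_sat p : forall (l : nat -> nat) m, (forall n, l n < m) ->
  rep (fun f => sat (fun n => bm (ap f (l n))) p).
Proof using HP0 Hi Hom std.
  assert (Hset : forall l m f f' u q, (forall n, l n < m) -> setf f' f m u ->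
    (sat (fun n => bm (ap f' (scons m l n))) q <-> sat (scons (bm u) (fun n => bm (ap f (l n)))) q)).
  { intros l m f f' u q Hl [H1 H2]; apply sat_ext; intros [|n]; cbn [scons]; [rewrite H1; auto|].
    rewrite H2; auto; specialize (Hl n); lia. }
  assert (Hscons : forall l m, (forall n, l n < m) -> forall n, scons m l n < S m).
  { intros l m Hl [|n]; simpl; [lia|specialize (Hl n); lia]. }
  assert (Hex : forall q, (forall (l : nat -> nat) m, (forall n, l n < m) ->
      rep (fun f => sat (fun n => bm (ap f (l n))) q)) ->
    forall l m, (forall n, l n < m) -> rep (fun f => sat (fun n => bm (ap f (l n))) (fEx q))).
  { intros q IH l m Hl; destruct (IH (scons m l) (S m) (Hscons l m Hl)) as [R [HR K]].
    destruct (proj1 (proj2 (proj2 (proj2 HDp))) R HR (nn m) (nn_in m)) as [R2 [HR2 K2]].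
    exists R2; split; auto; intros f Hf; rewrite (K2 f Hf); split.
    - intros [f' [H1 [H2 [u [Hu H3]]]]]; apply upd_setf in H3; auto; apply K in H2; auto.
      exists (bm u); eapply Hset; eauto.
    - intros [[u Hu] Hs]; destruct (setf_ex f m u Hf Hu) as [f' [Hf' H3]]; exists f'.
      split; auto; split; [|exists u; split; auto; apply upd_setf; auto].
      apply K; auto; eapply Hset; eauto; rewrite (bm_exist u Hu); exact Hs. }
  induction p as [a b|a b|p IH|p IHp q IHq|p IHp q IHq|p IHp q IHq|p IH|p IH]; intros l m Hl.
  - destruct (proj1 HDp (nn (l a)) (nn_in _) (nn (l b)) (nn_in _)) as [R [HR K]].
    exists R; split; auto; intros f Hf; rewrite (K f Hf); cbn; rewrite !bm_val by (apply ap_B; auto); split.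
    + intros [x [Hx [y [Hy E]]]]; apply ap_rel in Hx; auto; apply ap_rel in Hy; auto; subst; auto.
    + intros H; exists (ap f (l a)); split; [apply ap_rel; auto|]; exists (ap f (l b)).
      split; [apply ap_rel; auto|auto].
  - destruct (proj1 (proj2 HDp) (nn (l a)) (nn_in _) (nn (l b)) (nn_in _)) as [R [HR K]].
    exists R; split; auto; intros f Hf; rewrite (K f Hf); cbn; split.
    + intros [x [Hx Hy]]; apply ap_rel in Hx; auto; apply ap_rel in Hy; auto; congruence.
    + intros H; apply (f_equal (@proj1_sig _ _)) in H; rewrite !bm_val in H by (apply ap_B; auto).
      exists (ap f (l a)); split; apply ap_rel; auto.
  - apply rep_not, (IH l m Hl).
  - apply (rep_and _ _ (IHp l m Hl) (IHq l m Hl)).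
  - eapply rep_ext; [|apply (rep_nand _ _ (rep_not _ (IHp l m Hl)) (rep_not _ (IHq l m Hl)))].
    intros f Hf; cbn; split; [intros H; apply NNPP|]; tauto.
  - eapply rep_ext; [|apply (rep_nand _ _ (IHp l m Hl) (rep_not _ (IHq l m Hl)))].
    intros f Hf; cbn; split; [intros H K; apply NNPP|]; tauto.
  - eapply rep_ext; [|apply (rep_not _ (Hex (fNot p) (fun l m Hl => rep_not _ (IH l m Hl)) l m Hl))].
    intros f Hf; cbn; split.
    + intros H a; apply NNPP; intros K; apply H; eauto.
    + intros H [a K]; auto.
  - apply (Hex p IH l m Hl).
Qed.

Lemma BM_separation : separation BM (fun _ => True).
Proof using HP0 Hi Hom std HBi.
  intros p _ rho [w Hw]; set (k := S (bnd p)).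
  destruct (finite_ap (fun n => proj1_sig (rho n)) k) as [f [Hf Hr]]; [intros n; apply (proj2_sig (rho n))|].
  (* Parameters are stored below coordinate k, the separation variable at k, and coordinates from
     k+1 on are free for quantifiers; irrelevant variables read coordinate 0. *)
  set (l := fun n => match n with 0 => k | S n => if n <? k then n else 0 end).
  destruct (rep_sat p l (S k)) as [R [HR K]].
  { intros [|n]; unfold l; [lia|]; destruct (Nat.ltb_spec n k); lia. }
  destruct (proj2 (proj2 (proj2 (proj2 HDp))) R HR f Hf (nn k) (nn_in k) w Hw) as [z [Hz [H1 H2]]].
  exists (exist _ z Hz); intros [x Hx]; cbn.
  assert (E : forall f', setf f' f k x -> (sat (fun n => bm (ap f' (l n))) p <->
     sat (M := BM) (scons (exist _ x Hx) rho) p)).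
  { intros f' [Hs1 Hs2]; apply sat_bnd; intros [|n] Hn; cbn [scons]; unfold l.
    - rewrite Hs1; apply bm_exist.
    - assert (n < k) by (unfold k; lia).
      destruct (Nat.ltb_spec n k); [|lia]; rewrite Hs2, Hr; auto; [|lia].
      destruct (rho n) as [y Hy]; apply bm_exist. }
  split.
  - intros Hxz; split; auto; apply (H2 x (H1 x Hxz)) in Hxz.
    destruct Hxz as [f' [Hf' [Hu HR']]]; apply upd_setf in Hu; auto; apply K in HR'; auto.
    apply (E f'); auto.
  - intros [Hxw Hs]; apply (H2 x Hxw); destruct (setf_ex f k x Hf Hx) as [f' [Hf' Hset]].
    exists f'; split; auto; split; [apply upd_setf; auto|]; apply K; auto.
    apply (E f'); auto.
Qed.

Lemma BM_MOST : MOST BM.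
Proof using HP0 Hi Hom std HBi.
  destruct (proj1 (P0_sub X o B (HBi om)) (proj1 (proj2 (proj2 HP0))))
    as [A1 [A2 [A3 [A4 [A5 [A6 [A7 [A8 [A9 A10]]]]]]]]].
  apply Mac_AxH_MOST; auto; constructor; auto.
  intros p _; apply BM_separation; exact Logic.I.
Qed.

Definition eqT (y f g : X) : Prop :=
  y ∈ L /\ f ∈ W /\ g ∈ W /\ exists z, rel3 X T y f z /\ rel3 X T y g z.

Lemma eqT_sym y f g : eqT y f g -> eqT y g f.
Proof using. intros [H1 [H2 [H3 [z [H4 H5]]]]]; split; auto; split; auto; split; auto; eauto. Qed.

Lemma eqT_refl y f : y ∈ L -> f ∈ W -> eqT y f f.
Proof using HP0.
  intros Hy Hf; destruct (proj1 HTp y Hy f Hf) as [z [Hz _]].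
  split; auto; split; auto; split; auto; eauto.
Qed.

Lemma Lab_inj p w k z w' k' z' : Lab X o p w k z -> Lab X o p w' k' z' -> w = w' /\ k = k' /\ z = z'.
Proof using HB.
  intros [p1 [H1 [p2 [H2 H3]]]] [p1' [H1' [p2' [H2' H3']]]].
  destruct (opair_inj HB _ _ _ _ _ H1 H1') as [_ <-].
  destruct (opair_inj HB _ _ _ _ _ H2 H2') as [<- <-].
  destruct (opair_inj HB _ _ _ _ _ H3 H3') as [<- <-]; auto.
Qed.

Lemma Lab_atom p w k z a b : Lab X o p w k z -> is_opair X p a b -> ~ a ∈ o.
Proof using HB.
  intros [p1 [H1 _]] H Ha; destruct (opair_inj HB _ _ _ _ _ H1 H) as [<- _].
  apply (not_self HB _ Ha).
Qed.

(** The label made of w, n and the type of f' belongs to the common type of f and g, and its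
    presence in the type of g names a matching extension. *)
Lemma eqT_forth y f g w n u f' : eqT y f g -> w ∈ y -> u ∈ B -> f' ∈ W -> setf f' f n u ->
  exists v g', v ∈ B /\ setf g' g n v /\ eqT w f' g'.
Proof using HB HP0 Hi Hom std.
  intros [Hy [Hf [Hg [z [Hz1 Hz2]]]]] Hw Hu Hf' Hs.
  assert (HwL : w ∈ L) by (apply (proj2 (HLp y Hy)); auto).
  destruct (proj1 HTp w HwL f' Hf') as [z' [Hz' _]].
  destruct (proj2 (proj2 HTp) y Hy f Hf z Hz1) as [_ [_ T3]].
  destruct (proj2 (proj2 HTp) y Hy g Hg z Hz2) as [T1 _].
  destruct (T3 w Hw (nn n) (nn_in n) u Hu f' Hf') with (z' := z') as [p [Hp HLab]]; auto.
  { apply upd_setf; auto. }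
  destruct (T1 p Hp) as [[a [Ha [b [_ [Ho _]]]]]|[w2 [Hw2 [k [Hk [g' [Hg' [[v [Hv Hup]] [z2 [Hz2' HLab2]]]]]]]]]].
  - case (Lab_atom _ _ _ _ _ _ HLab Ho Ha).
  - destruct (Lab_inj _ _ _ _ _ _ _ HLab HLab2) as [<- [<- <-]].
    exists v, g'; split; auto; split; [apply upd_setf; auto|].
    split; auto; split; auto; split; auto; eauto.
Qed.

Lemma eqT_mem1 y f g n m : eqT y f g -> ap f n ∈ ap f m -> ap g n ∈ ap g m.
Proof using HB HP0 Hi Hom std.
  intros [Hy [Hf [Hg [z [Hz1 Hz2]]]]] H.
  destruct (proj2 (proj2 HTp) y Hy f Hf z Hz1) as [_ [T2 _]].
  destruct (proj2 (proj2 HTp) y Hy g Hg z Hz2) as [T1 _].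
  destruct (T2 (nn n) (nn_in n) (nn m) (nn_in m) (ap f n)) with (x' := ap f m) as [p [Hp Ho]]; auto;
    try (apply ap_rel; auto; fail).
  destruct (T1 p Hp) as [[a [Ha [b [Hb [Ho' [x [Hx [x' [Hx' E]]]]]]]]]|[w [_ [k [_ [g' [_ [_ [z2 [_ HLab]]]]]]]]]].
  - destruct (opair_inj HB _ _ _ _ _ Ho Ho') as [<- <-]; apply ap_rel in Hx; auto.
    apply ap_rel in Hx'; auto; subst; auto.
  - case (Lab_atom _ _ _ _ _ _ HLab Ho (nn_in n)).
Qed.

Lemma eqT_mem y f g n m : eqT y f g -> (ap f n ∈ ap f m <-> ap g n ∈ ap g m).
Proof using HB HP0 Hi Hom std.
  intros H; split; [apply (eqT_mem1 y f g)|apply (eqT_mem1 y g f)]; auto using eqT_sym.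
Qed.

(** Types record membership only. Equality is recovered at the price of one level: an element in the
    difference on one side would have to be answered on the other. *)
Lemma eqT_sub y f g w n m : eqT y f g -> w ∈ y -> ap f n = ap f m -> subset X (ap g n) (ap g m).
Proof using HB HP0 Hi Hom std.
  intros H Hw E x Hx; pose proof H as [_ [Hf [Hg _]]]; set (k := S (n + m)).
  assert (HxB : x ∈ B) by (apply (trB (ap g n)); auto; apply ap_B; auto).
  destruct (setf_ex g k x Hg HxB) as [g' [Hg' Hs]].
  destruct (eqT_forth y g f w k x g') as [v [f' [Hv [Hs' H']]]]; auto using eqT_sym.
  pose proof (eqT_mem w g' f' k n H') as E1; pose proof (eqT_mem w g' f' k m H') as E2.
  destruct Hs as [S1 S2], Hs' as [S3 S4].
  rewrite (S2 n), (S4 n) in E1 by (unfold k; lia); rewrite (S2 m), (S4 m) in E2 by (unfold k; lia).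
  rewrite S1 in E1, E2; apply E2; rewrite <- E; apply E1; auto.
Qed.

Lemma eqT_eq y f g w n m : eqT y f g -> w ∈ y -> (ap f n = ap f m <-> ap g n = ap g m).
Proof using HB HP0 Hi Hom std.
  intros H Hw; split; intros E; apply (ext HB); intros x; split; intros Hx.
  - apply (eqT_sub y f g w n m); auto.
  - apply (eqT_sub y f g w m n); auto.
  - apply (eqT_sub y g f w n m); auto using eqT_sym.
  - apply (eqT_sub y g f w m n); auto using eqT_sym.
Qed.

(** This keeps the back-and-forth going: below a nonstandard level there is always another one. *)
Lemma nonstd_mem x : ~ stdd x -> exists z, z ∈ x /\ ~ stdd z.
Proof using closed.
  intros H; apply NNPP; intros K; apply H, closed; intros z Hz; apply NNPP; intros Hn; apply K; eauto.
Qed.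

Lemma std_mem x z : stdd x -> z ∈ x -> stdd z.
Proof using Hi. intros [b <-] H; apply (in_tr i Hi b z H). Qed.

Lemma std_opair p a b : is_opair X p a b -> stdd a -> stdd b -> stdd p.
Proof using HB HN Hi.
  intros H [a' <-] [b' <-]; destruct (opair_ex HBN a' b') as [q Hq]; exists q.
  apply (abs_opair i Hi) in Hq; apply (opair_unique HB _ _ _ _ Hq H).
Qed.

Lemma std_Lab p w k z : Lab X o p w k z -> stdd w -> stdd k -> stdd z -> stdd p.
Proof using HB HN Hi.
  intros [p1 [H1 [p2 [H2 H3]]]] Hw Hk Hz.
  apply (std_opair _ _ _ H1); [exists om; reflexivity|].
  apply (std_opair _ _ _ H2 Hw), (std_opair _ _ _ H3 Hk Hz).
Qed.

(** Induction along the well-foundedness of N: whatever f is, the elements of the type are built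
    from standard indices, levels and earlier types, and a set of standard sets is standard. *)
Lemma std_type b : i b ∈ L -> forall f z, f ∈ W -> rel3 X T (i b) f z -> stdd z.
Proof using HB HN Hi Hom HP0 closed std wfN.
  revert b; refine (wfN (fun b => i b ∈ L -> forall f z, f ∈ W -> rel3 X T (i b) f z -> stdd z) _).
  intros b IH HbL f z Hf Hz; apply closed; intros p Hp.
  destruct (proj2 (proj2 HTp) (i b) HbL f Hf z Hz) as [T1 _].
  destruct (T1 p Hp) as [[a [Ha [c [Hc [Ho _]]]]]|[w [Hw [k [Hk [g' [Hg' [_ [z2 [Hz2 HLab]]]]]]]]]].
  - apply (std_opair _ _ _ Ho); [apply (std_mem o)|apply (std_mem o)]; auto; exists om; reflexivity.
  - destruct (in_tr i Hi _ _ Hw) as [c <-]; apply (std_Lab _ _ _ _ HLab).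
    + exists c; reflexivity.
    + apply (std_mem o); auto; exists om; reflexivity.
    + apply (IH c) with g'; auto; [apply (in_mem i Hi), Hw|apply (proj2 (HLp _ HbL)); auto].
Qed.

Lemma setf_unique f f1 f2 n u : f1 ∈ W -> f2 ∈ W -> setf f1 f n u -> setf f2 f n u -> f1 = f2.
Proof using HP0 Hi Hom std.
  intros H1 H2 [S1 S2] [S3 S4]; apply (proj2 (proj2 (proj2 HWp))); auto.
  intros k Hk x; apply in_o in Hk; destruct Hk as [m ->]; rewrite !ap_rel; auto; intros ->.
  destruct (Nat.eq_dec m n) as [->|E]; [congruence|rewrite S2, S4; auto].
Qed.

(** * Moving an element of a transitive set that has nonstandard elements *)

Section Move.
Context (f : X) (Hf : f ∈ W) (n : nat) (c : X) (HcB : c ∈ B) (Hc : is_transitive X c).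

(* [z] is the type of f[n:=u] at level [w] *)
Definition tyu (w u z : X) : Prop :=
  ∃ f' ∈ W, upd X o f' f (nn n) u /\ exists z', rel3 X T w f' z' /\ z' = z.

Definition typ_inj (w : X) : Prop := ∀ u1 ∈ c, ∀ u2 ∈ c, ∀ f1 ∈ W, upd X o f1 f (nn n) u1 ->
  ∀ f2 ∈ W, upd X o f2 f (nn n) u2 -> forall z1, rel3 X T w f1 z1 -> forall z2, rel3 X T w f2 z2 ->
  z1 = z2 -> u1 = u2.

Lemma std_not_inj b z : i b ∈ L -> z ∈ c -> ~ stdd z -> ~ typ_inj (i b).
Proof using HB HN Hi Hom HP0 closed std wfN Hf HcB Hc.
  intros HbL Hz Hns Hinj; apply Hns.
  assert (cB : forall u, u ∈ c -> u ∈ B) by (intros u Hu; apply (trB c); auto).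
  assert (ty_fun : forall u a a', tyu (i b) u a -> tyu (i b) u a' -> a = a').
  { intros u a a' [f1 [H1 [U1 [z1 [R1 <-]]]]] [f2 [H2 [U2 [z2 [R2 <-]]]]].
    apply upd_setf in U1, U2; auto; rewrite (setf_unique f f1 f2 n u) in R1; auto.
    apply (proj1 (proj2 HTp) (i b) HbL f2 H2 z2 R2 z1 R1). }
  assert (ty_inj : forall u u' a, u ∈ c -> u' ∈ c -> tyu (i b) u a -> tyu (i b) u' a -> u = u').
  { intros u u' a Hu Hu' [f1 [H1 [U1 [z1 [R1 <-]]]]] [f2 [H2 [U2 [z2 [R2 E]]]]].
    apply (Hinj u Hu u' Hu' f1 H1 U1 f2 H2 U2 z1 R1 z2 R2); auto. }
  assert (ty_std : forall u a, tyu (i b) u a -> stdd a).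
  { intros u a [f1 [H1 [U1 [z1 [R1 <-]]]]]; apply (std_type b HbL f1); auto. }
  destruct (range_ex HB T) as [R HR].
  destruct (sep HB R (fun a => ∃ u ∈ c, tyu (i b) u a)) as [Th HTh]; [unfold tyu; dfn|].
  assert (ty_ex : forall u, u ∈ c -> exists a, a ∈ Th /\ tyu (i b) u a).
  { intros u Hu; destruct (setf_ex f n u Hf (cB u Hu)) as [f1 [H1 S1]].
    destruct (proj1 HTp (i b) HbL f1 H1) as [a [Ha _]].
    assert (K : tyu (i b) u a) by (exists f1; split; auto; split; [apply upd_setf; auto|eauto]).
    exists a; split; auto; apply HTh; split; eauto.
    destruct Ha as [q [_ Hq]]; apply (HR q a Hq). }
  destruct (mkrel HB Th Th (fun a a' => ∃ u ∈ c, ∃ u' ∈ c, u ∈ u' /\ tyu (i b) u a /\ tyu (i b) u' a'))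
    as [r [Hr1 Hr2]]; [unfold tyu; dfn|].
  assert (Hw : wfrel X r Th).
  { intros s Hs Hne; destruct (min_def HB c (fun u => ∃ a ∈ s, tyu (i b) u a)) as [u [Hu [[a [Ha Hua]] K]]].
    - unfold tyu; dfn.
    - apply NNPP; intros K; apply Hne; intros a Ha; apply K.
      destruct (proj1 (HTh a) (Hs a Ha)) as [_ [u [Hu Hua]]]; exists u; split; auto; exists a; auto.
    - exists a; split; auto; intros l Hl Hr.
      apply Hr2 in Hr; destruct Hr as [_ [_ [v [Hv [v' [Hv' [Hvv [Hvl Hva]]]]]]]].
      rewrite (ty_inj v' u a) in Hvv; auto; apply (K v Hvv Hv); exists l; auto. }
  (* The set of types, and likewise the relation that copies membership of c to it, has only
     standard elements. So both come from N, where H provides the collapse. *)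
  destruct (closed Th) as [Th0 ETh].
  { intros a Ha; apply HTh in Ha; destruct Ha as [_ [u [Hu Hua]]]; apply (ty_std u a Hua). }
  assert (sTh : forall a, a ∈ Th -> stdd a).
  { intros a Ha; apply (std_mem Th); auto; exists Th0; auto. }
  destruct (closed r) as [r0 Er].
  { intros q Hq; destruct (Hr1 q Hq) as [a [Ha [a' [Ha' Ho]]]]; apply (std_opair _ _ _ Ho); auto. }
  assert (Hsub : subclosed i).
  { intros a x Hx; apply closed; intros u Hu; apply (in_tr i Hi a); auto. }
  destruct (MOST_AxH N HN Th0) as [h Hh]; destruct (Hh r0) as [p0 [_ Hp0]].
  { apply (abs_rel_on i Hi); rewrite Er, ETh; exact Hr1. }
  { apply (abs_wfrel i Hi); auto; rewrite Er, ETh; exact Hw. }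
  apply (abs_collapse i Hi) in Hp0; rewrite Er, ETh in Hp0; destruct Hp0 as [C1 C2].
  (* The collapse sends each type back to the element of c that has it, so z is a value of a
     standard function. *)
  assert (Key : forall u, u ∈ c -> ∀ a ∈ Th, tyu (i b) u a -> related X (i p0) a u).
  { apply (mem_ind_in HB c (fun u => ∀ a ∈ Th, tyu (i b) u a -> related X (i p0) a u));
      [unfold tyu; dfn|].
    intros u Hu IH a Ha Hua; destruct (C1 a Ha) as [x Hx]; destruct (C2 a Ha x Hx) as [_ [C3 C4]].
    assert (E : x = u); [|subst x; auto].
    apply (ext HB); intros v; split; intros Hv.
    - destruct (C3 v Hv) as [l [Hl [Hla Hlv]]]; apply Hr2 in Hla.
      destruct Hla as [_ [_ [v1 [Hv1 [v' [Hv' [Hvv [Hvl Hva]]]]]]]].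
      rewrite (ty_inj v' u a) in Hvv; auto.
      rewrite (proj1 (C2 l Hl v1 (IH v1 Hvv Hv1 l Hl Hvl)) v Hlv); auto.
    - assert (Hvc : v ∈ c) by (apply (Hc u); auto).
      destruct (ty_ex v Hvc) as [l [Hl Hvl]].
      destruct (C4 l Hl) as [x' [Hx' Hlx]].
      + apply Hr2; split; auto; split; auto; exists v; split; auto; exists u; auto.
      + rewrite <- (proj1 (C2 l Hl v (IH v Hv Hvc l Hl Hvl)) x' Hlx); auto. }
  destruct (ty_ex z Hz) as [a [Ha Hza]]; destruct (Key z Hz a Ha Hza) as [q [Hq Ho]].
  destruct (is_opair_union _ _ _ _ Ho) as [u [Hu [_ Hzu]]].
  apply (std_mem u); auto; apply (std_mem q); auto; apply (std_mem (i p0)); auto; exists p0; auto.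
Qed.

(** Overspill: otherwise injectivity would define the nonstandard elements of y, and a minimal one
    would have only standard elements, hence be standard. *)
Lemma nonstd_not_inj y z : y ∈ L -> ~ stdd y -> z ∈ c -> ~ stdd z ->
  exists w, w ∈ y /\ ~ stdd w /\ ~ typ_inj w.
Proof using HB HN Hi Hom HP0 closed std wfN Hf HcB Hc.
  intros Hy Hny Hz Hnz; apply NNPP; intros K.
  assert (E : forall w, w ∈ y -> (typ_inj w <-> ~ stdd w)).
  { intros w Hw; split.
    - intros Hin [b <-]; revert Hin; apply (std_not_inj b z); auto; apply (proj2 (HLp y Hy)); auto.
    - intros Hn; apply NNPP; intros Hin; apply K; exists w; auto. }
  destruct (min_def HB y (fun w => typ_inj w)) as [w [Hw [H1 H2]]].
  - unfold typ_inj; dfn.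
  - destruct (nonstd_mem y Hny) as [w [Hw Hn]]; exists w; split; auto; apply E; auto.
  - apply (E w Hw) in H1; apply H1, closed; intros v Hv.
    assert (Hvy : v ∈ y) by (apply (proj1 (HLp y Hy) w); auto).
    apply NNPP; intros Hn; apply (H2 v Hv Hvy), E; auto.
Qed.

(** Two distinct elements with the same type over f admit the same answer v, and v differs from one
    of them. *)
Lemma eqT_move y g z : eqT y f g -> ~ stdd y -> z ∈ c -> ~ stdd z ->
  exists w u v f' g', w ∈ y /\ ~ stdd w /\ u ∈ c /\ v ∈ B /\ u <> v /\
    setf f' f n u /\ setf g' g n v /\ eqT w f' g'.
Proof using HB HN Hi Hom HP0 closed std wfN Hf HcB Hc.
  intros He Hny Hz Hnz.
  destruct (nonstd_not_inj y z (proj1 He) Hny Hz Hnz) as [w [Hw [Hnw Hin]]].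
  assert (K : exists u1 u2 f1 f2, u1 ∈ c /\ u2 ∈ c /\ u1 <> u2 /\ f1 ∈ W /\ f2 ∈ W /\ setf f1 f n u1 /\
    setf f2 f n u2 /\ exists a, rel3 X T w f1 a /\ rel3 X T w f2 a).
  { apply NNPP; intros K; apply Hin; intros u1 Hu1 u2 Hu2 f1 Hf1 U1 f2 Hf2 U2 z1 R1 z2 R2 <-.
    apply NNPP; intros Hne; apply K; exists u1, u2, f1, f2; apply upd_setf in U1, U2; auto.
    repeat (split; auto); eauto. }
  destruct K as [u1 [u2 [f1 [f2 [Hu1 [Hu2 [Hne [Hf1 [Hf2 [S1 [S2 [a [R1 R2]]]]]]]]]]]]].
  assert (cB : forall u, u ∈ c -> u ∈ B) by (intros u Hu; apply (trB c); auto).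
  destruct (eqT_forth y f g w n u1 f1) as [v [g' [Hv [Hs H']]]]; auto.
  assert (H2 : eqT w f2 g').
  { destruct H' as [HwL [_ [Hg' [a' [R1' R3]]]]]; split; auto; split; auto; split; auto.
    exists a; split; auto; rewrite <- (proj1 (proj2 HTp) w HwL f1 Hf1 a R1 a' R1'); auto. }
  destruct (classic (u1 = v)) as [->|Hn].
  - exists w, u2, v, f2, g'; repeat (split; auto).
  - exists w, u1, v, f1, g'; repeat (split; auto).
Qed.
End Move.

(* The pairs in [l] are stored in f and g at coordinates below [length l]. *)
Definition Gd (l : list (BM * BM)) : Prop := exists y f g, ~ stdd y /\ eqT y f g /\
  forall p, In p l -> exists n, n < length l /\ ap f n = proj1_sig (fst p) /\ ap g n = proj1_sig (snd p).

Lemma Gd_nil : Gd nil.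
Proof using HP0 HLi closed.
  destruct (nonstd_mem L) as [y [Hy Hn]]; [intros [b Hb]; apply (HLi b Hb)|].
  destruct (proj1 HWp) as [f [Hf _]]; exists y, f, f; split; auto; split; [apply eqT_refl; auto|].
  intros p [].
Qed.

Lemma Gd_cons l f g w f' g' (u v : BM) : ~ stdd w -> eqT w f' g' ->
  (forall p, In p l -> exists n, n < length l /\ ap f n = proj1_sig (fst p) /\ ap g n = proj1_sig (snd p)) ->
  setf f' f (length l) (proj1_sig u) -> setf g' g (length l) (proj1_sig v) -> Gd ((u, v) :: l).
Proof using.
  intros Hw He H [S1 S2] [S3 S4]; exists w, f', g'; split; auto; split; auto.
  intros p [<-|Hp]; [exists (length l); simpl; auto|].
  destruct (H p Hp) as [n [Hn [H1 H2]]]; exists n; simpl.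
  rewrite S2, S4 by lia; split; [lia|auto].
Qed.

Lemma Gd_forth l (u : BM) : Gd l -> exists v, Gd ((u, v) :: l).
Proof using HB HP0 Hi Hom std closed.
  intros [y [f [g [Hy [He Hl]]]]]; pose proof He as [_ [Hf [Hg _]]].
  destruct (nonstd_mem y Hy) as [w [Hw Hn]], (setf_ex f (length l) (proj1_sig u) Hf (proj2_sig u)) as [f' [Hf' S1]].
  destruct (eqT_forth y f g w (length l) (proj1_sig u) f') as [v [g' [Hv [S2 He']]]]; auto.
  { exact (proj2_sig u). }
  exists (exist _ v Hv); apply (Gd_cons l f g w f' g'); auto.
Qed.

Lemma Gd_sym l : Gd l -> Gd (map (fun p => (snd p, fst p)) l).
Proof using.
  intros [y [f [g [Hy [He Hl]]]]]; exists y, g, f; split; auto; split; [apply eqT_sym; auto|].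
  intros p Hp; apply in_map_iff in Hp; destruct Hp as [q [<- Hq]].
  destruct (Hl q Hq) as [n [Hn [H1 H2]]]; exists n; rewrite length_map; auto.
Qed.

Lemma Gd_back l (v : BM) : Gd l -> exists u, Gd ((u, v) :: l).
Proof using HB HP0 Hi Hom std closed.
  intros H; destruct (Gd_forth _ v (Gd_sym l H)) as [u Hu]; exists u; apply Gd_sym in Hu; simpl in Hu.
  rewrite map_map in Hu; simpl in Hu.
  rewrite (map_ext _ (fun p => p)), map_id in Hu by (intros []; reflexivity); exact Hu.
Qed.

Lemma Gd_move l (c z : BM) : Gd l -> is_transitive BM c -> z ∈ c -> ~ stdd (proj1_sig z) ->
  exists u v, u ∈ c /\ u <> v /\ Gd ((u, v) :: l).
Proof using HB HN Hi Hom HP0 closed std wfN.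
  intros [y [f [g [Hy [He Hl]]]]] Hc Hz Hn; pose proof He as [_ [Hf [Hg _]]].
  assert (Hc' : is_transitive X (proj1_sig c)).
  { intros a Ha b Hb; assert (HaB : a ∈ B) by (apply (trB (proj1_sig c)); auto; apply (proj2_sig c)).
    assert (HbB : b ∈ B) by (apply (trB a); auto).
    exact (Hc (exist _ a HaB) Ha (exist _ b HbB) Hb). }
  destruct (eqT_move f Hf (length l) (proj1_sig c) (proj2_sig c) Hc' y g (proj1_sig z))
    as [w [u [v [f' [g' [Hw [Hnw [Hu [Hv [Hne [S1 [S2 He']]]]]]]]]]]]; auto.
  assert (HuB : u ∈ B) by (apply (trB (proj1_sig c)); auto; apply (proj2_sig c)).
  exists (exist _ u HuB), (exist _ v Hv); split; [exact Hu|split].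
  - intros E; injection E; auto.
  - apply (Gd_cons l f g w f' g'); auto.
Qed.

Lemma Gd_iso l (u v u' v' : BM) : Gd l -> In (u, v) l -> In (u', v') l ->
  (u ∈ u' <-> v ∈ v') /\ (u = u' <-> v = v').
Proof using HB HP0 Hi Hom std closed.
  intros [y [f [g [Hy [He Hl]]]]] H1 H2.
  destruct (Hl _ H1) as [n [_ [A1 A2]]], (Hl _ H2) as [m [_ [A3 A4]]]; simpl in A1, A2, A3, A4.
  destruct (nonstd_mem y Hy) as [w [Hw _]].
  pose proof (eqT_mem y f g n m He) as E1; pose proof (eqT_eq y f g w n m He Hw) as E2.
  rewrite A1, A2, A3, A4 in E1, E2; split; [exact E1|].
  destruct u as [u Hu], u' as [u' Hu'], v as [v Hv], v' as [v' Hv']; simpl in *; split; intros E;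
    apply subset_eq_compat, E2; injection E; auto.
Qed.

Definition iB (b : N) : BM := exist _ (i b) (HBi b).

Lemma iB_initial : initial iB.
Proof using Hi.
  constructor.
  - intros a b E; injection E; apply (in_inj i Hi).
  - intros a b; apply (in_mem i Hi).
  - intros a [x Hx] H; destruct (in_tr i Hi a x H) as [b Hb]; exists b; apply subset_eq_compat; auto.
Qed.

Lemma iB_std (x : BM) : stdd (proj1_sig x) <-> exists b, iB b = x.
Proof using.
  destruct x as [x Hx]; split; intros [b Hb]; exists b.
  - apply subset_eq_compat; auto.
  - injection Hb; auto.
Qed.

(** A request is a pair (c,z): c has to enter the domain and the range, and if c is transitive and z
    a nonstandard element of it, some element of c has to be moved. *)
Lemma automorphism_ex (en : nat -> X) : (forall x, exists n, en n = x) ->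
  exists j : BM -> BM, automorphism j /\
    forall c z : BM, is_transitive BM c -> z ∈ c -> (~ exists b, iB b = z) -> exists u, u ∈ c /\ j u <> u.
Proof using HB HN Hi Hom HP0 closed std wfN HLi HBi.
  intros Hen.
  set (Mv := fun (q : BM * BM) (l : list (BM * BM)) => is_transitive BM (fst q) -> snd q ∈ fst q ->
    (~ exists b, iB b = snd q) -> exists u v, u ∈ fst q /\ u <> v /\ In (u, v) l).
  destruct (@request_chain (BM * BM) (BM * BM) (fun n => (bm (en (fst (of_nat n))), bm (en (snd (of_nat n)))))) with (Gd := Gd)
    (Rq := fun (q : BM * BM) l => (exists v, In (fst q, v) l) /\ (exists u, In (u, fst q) l) /\ Mv q l)
    as [st [H1 [H2 H3]]].
  - intros [[x Hx] [y Hy]]; destruct (Hen x) as [n Hn], (Hen y) as [m Hm]; exists (to_nat (n, m)).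
    rewrite cancel_of_to; simpl; rewrite Hn, Hm, (bm_exist x Hx), (bm_exist y Hy); reflexivity.
  - apply Gd_nil.
  - intros q l Hl; destruct (Gd_forth l (fst q) Hl) as [v Hl1], (Gd_back _ (fst q) Hl1) as [u Hl2].
    set (l2 := (u, fst q) :: (fst q, v) :: l) in *.
    assert (K : exists l3, Gd l3 /\ incl l2 l3 /\ Mv q l3).
    { destruct (classic (is_transitive BM (fst q) /\ snd q ∈ fst q /\ ~ exists b, iB b = snd q))
        as [[A1 [A2 A3]]|K].
      - rewrite <- iB_std in A3; destruct (Gd_move l2 (fst q) (snd q) Hl2 A1 A2 A3) as [a [b [B1 [B2 B3]]]].
        exists ((a, b) :: l2); split; auto; split; [intros p Hp; right; auto|].
        intros _ _ _; exists a, b; split; auto; split; auto; left; auto.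
      - exists l2; split; auto; split; [intros p Hp; auto|]; intros A1 A2 A3; case K; auto. }
    destruct K as [l3 [K1 [K2 K3]]]; exists l3; split; auto; split.
    + intros p Hp; apply K2; right; right; auto.
    + split; [exists v; apply K2; right; left; auto|split; auto]; exists u; apply K2; left; auto.
  - set (Rl := fun u v => exists n, In (u, v) (st n)).
    assert (Riso : forall u v u' v', Rl u v -> Rl u' v' -> (u ∈ u' <-> v ∈ v') /\ (u = u' <-> v = v')).
    { intros u v u' v' [n Hn] [m Hm]; apply (Gd_iso (st (n + m))); auto.
      - apply (H2 n); auto; lia.
      - apply (H2 m); auto; lia. }
    assert (Rtot : forall u, exists v, Rl u v).
    { intros u; destruct (H3 (u, u)) as [n [[v Hv] _]]; exists v, n; auto. }
    set (j := fun u => proj1_sig (constructive_indefinite_description _ (Rtot u))).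
    assert (Rj : forall u, Rl u (j u)).
    { intros u; unfold j; destruct constructive_indefinite_description; auto. }
    exists j; split; [split; [split|]|].
    + intros x y E; apply (Riso x (j x) y (j y)); auto.
    + intros v; destruct (H3 (v, v)) as [n [_ [[u Hu] _]]]; exists u.
      assert (Ru : Rl u v) by (exists n; auto); apply (Riso u (j u) u v); auto.
    + intros x y; apply (Riso x (j x) y (j y)); auto.
    + intros c z Hc Hz Hn; destruct (H3 (c, z)) as [n [_ [_ K]]].
      destruct (K Hc Hz Hn) as [u [v [Hu [Hne Huv]]]]; exists u; split; auto.
      assert (Ru : Rl u v) by (exists n; auto); intros E; apply Hne.
      rewrite <- E at 1; apply (Riso u (j u) u v); auto.
Qed.

Lemma cut_automorphism (en : nat -> X) : (forall x, exists n, en n = x) ->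
  exists (M : structure) (j : M -> M), MOST M /\ automorphism j /\ ~ (forall x, j x = x) /\
    isomorphic (Ifix j) N.
Proof using HB HN Hi Hom HP0 closed std wfN HLi HBi.
  intros Hen; destruct (automorphism_ex en Hen) as [j [Hj Hmv]].
  pose proof BM_MOST as HM; pose proof (MOST_Mac BM HM) as HMac; pose proof (Mac_BST BM HMac) as HBM.
  assert (Hnf : forall z, ~ (exists b, iB b = z) -> ~ fixed j z).
  { intros z Hz Hfz; destruct (TC1_ex HMac z) as [s [c [Hs Hc]]].
    assert (Hzc : z ∈ c) by (apply (proj1 (proj2 Hc)), Hs; auto).
    destruct (Hmv c z (proj1 Hc) Hzc Hz) as [u [Hu Hju]]; apply Hju, Hfz; exists s, c; auto. }
  assert (Hfix : forall b, j (iB b) = iB b).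
  (* No care was taken in the back-and-forth to fix standard elements; every automorphism does so,
     by induction along the well-founded N. *)
  { refine (wfN (fun b => j (iB b) = iB b) _); intros b IH; apply (ext HBM); intros z; split; intros Hz.
    - destruct (proj2 (proj1 Hj) z) as [u <-]; apply (proj2 (proj2 Hj u (iB b))) in Hz.
      destruct (in_tr iB iB_initial b u Hz) as [a <-]; rewrite IH; auto.
      apply (in_mem iB iB_initial), Hz.
    - destruct (in_tr iB iB_initial b z Hz) as [a <-]; rewrite <- (IH a); [apply (proj1 (proj2 Hj (iB a) (iB b))), Hz|].
      apply (in_mem iB iB_initial), Hz. }
  assert (Hfx : forall b, fixed j (iB b)).
  { intros b; destruct (pair_ex HBN b b) as [s Hs].
    destruct (Mac_transitive_containment N (MOST_Mac N HN) s) as [t [Ht Hst]].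
    apply (fixed_of_transitive j (iB t)).
    - apply (abs1 iB iB_initial is_transitive); [dfn|auto].
    - apply (in_mem iB iB_initial), Hst, Hs; auto.
    - intros y Hy; destruct (in_tr iB iB_initial t y Hy) as [a <-]; apply Hfix. }
  exists BM, j; split; auto; split; auto; split.
  - assert (K : exists z : BM, ~ exists b, iB b = z).
    (* If all elements of B were standard, B would be standard too and hence an element of
       itself. *)
    { apply NNPP; intros K; destruct (closed B) as [b Hb].
      - intros z Hz; apply NNPP; intros Kz; apply K; exists (exist _ z Hz).
        rewrite <- iB_std; exact Kz.
      - apply (not_self HB B); rewrite <- Hb at 1; apply HBi. }
    destruct K as [z Hz]; intros E; apply (Hnf z Hz); intros y _; apply E.
  - assert (inv : forall x : Ifix j, exists b, iB b = proj1_sig x).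
    { intros [x Hx]; apply NNPP; intros K; apply (Hnf x K Hx). }
    set (g := fun x => proj1_sig (constructive_indefinite_description _ (inv x))).
    assert (Hg : forall x, iB (g x) = proj1_sig x).
    { intros x; unfold g; destruct constructive_indefinite_description; auto. }
    exists g; split; [split|].
    + intros x y E; assert (Exy : proj1_sig x = proj1_sig y) by (rewrite <- !Hg, E; auto).
      destruct x as [x Hx], y as [y Hy]; apply subset_eq_compat; exact Exy.
    + intros b; exists (exist _ (iB b) (Hfx b)); apply (in_inj iB iB_initial); rewrite Hg; reflexivity.
    + intros x y; rewrite (in_mem iB iB_initial), !Hg; reflexivity.
Qed.
End BackForth.

Theorem theorem5p5 (I : zset) (hcount : zcountable I) (htrans : ztransitive I)
    (homega : zmem omega I) :
  (MOST (in_structure I) /\ collection (in_structure I) Delta0P)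
  <->
  (exists (M : structure) (j : M -> M),
     MOST M /\ automorphism j /\ ~ (forall x : M, j x = x) /\
     isomorphic (Ifix j) (in_structure I)).
Proof.
  split.
  - intros [HN HP]; set (om := om_el I homega).
    destruct hcount as [code Hcode].
    set (en := fun n => epsilon (inhabits om) (fun x : in_structure I => code x = n)).
    assert (Hen : forall x, exists n, en n = x).
    { intros x; exists (code x); apply Hcode.
      exact (epsilon_spec (inhabits om) (fun y : in_structure I => code y = code x) (ex_intro _ x eq_refl)). }
    pose proof (om_inductive I htrans homega) as Hom.
    pose proof (om_num I htrans homega (Mac_BST _ (MOST_Mac _ HN))) as std.
    destruct (generic_model (in_structure I) HN HP om Hom en Hen std)
      as [X [i [en' [B [W [D [L [T [A1 [A2 [A3 [A4 [A5 [A6 A7]]]]]]]]]]]]]].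
    apply (cut_automorphism HN (in_structure_wf I htrans) i A3 A4 A2 om Hom std B W D L T A5 A6 A7 en' A1).
  - intros [M [j [H1 [H2 [H3 H4]]]]]; apply (automorphism_to_MOST I htrans homega M j); auto.
Qed.
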